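(* Let $X$ be a complex abelian variety of dimension $g\leq 4$ and let $f\colon X\to X$ be an automorphism of positive (topological) entropy. Then either $f$ is semi-conjugate to an automorphism of an abelian variety $Y$ with $0<\dim Y<\dim X$, or the following two properties hold: (i) The Haar measure of $X$ is an ergodic and invariant measure for $f$. (ii) Let $1\leq k\leq g-1$ be an integer. For any (smooth, not necessarily closed) $(k,k)$-form $\Omega$ on $X$, the limit in the sense of currents $$\lim_{N\to+\infty}\frac1N\sum_{j\leq N}\frac{(f^j)^*\Omega}{\lambda_k(f)^j}$$ exists and belongs to $E_k$.
   Context: A complex abelian variety of dimension $g$ is a complex torus $\mathbb{C}^g/\Lambda$ admitting an embedding into projective space. Endomorphisms and automorphisms are holomorphic group homomorphisms (respectively isomorphisms). The $k$-th dynamical degree $\lambda_k(f)$ is the spectral radius of $f^*$ acting on the Dolbeault cohomology $H^{k,k}(X)$; the topological entropy of $f$ equals $\max_k\log\lambda_k(f)$. $E_k$ denotes the eigenspace in $H^{k,k}(X)$ of $f^*$ associated to the eigenvalue $\lambda_k(f)$ (the spectral radius); $H^{k,k}(X)$ is identified with the space of $(k,k)$-forms with constant coefficients on $X=\mathbb{C}^g/\Lambda$. The index $j$ in the sum ranges over the integers $1\le j\le N$. ''$f$ is semi-conjugate to an automorphism $h$ of $Y$'' means that there is a surjective holomorphic map $\pi\colon X\to Y$ with $\pi\circ f=h\circ\pi$. *)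

(* Defs.v *)
(* MathComp / MathComp-Analysis. *)
From HB Require Import structures.
From mathcomp Require Import all_boot all_order all_algebra.
From mathcomp Require Import perm complex.
From mathcomp Require Import all_classical all_reals all_analysis.

Set Implicit Arguments.
Unset Strict Implicit.
Unset Printing Implicit Defensive.

Import Order.TTheory GRing.Theory Num.Theory.
Import numFieldNormedType.Exports.

Local Open Scope classical_set_scope.
Local Open Scope ring_scope.
Local Open Scope complex_scope.
Local Open Scope quotient_scope.

(* The usual topology and norm of the complex numbers.  MathComp-Analysis
   attaches them to the carrier of an abstract numFieldType only. *)
HB.instance Definition _ (R : rcfType) := NormedModule.copy R[i] R[i]^o.

Section Entropy.
Context {R : realType} {T : topologicalType}.
Implicit Types (U : set (set T)) (f : T -> T).

Definition open_cover U : Prop :=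
  (forall A, U A -> open A) /\ \bigcup_(A in U) A = setT.

(* U \/ f^-1 U \/ ... \/ f^-(n-1) U *)
Definition iter_join f U (n : nat) : set (set T) :=
  [set A | exists B : 'I_n -> set T,
     (forall i, U (B i)) /\ A = \bigcap_(i in [set: 'I_n]) (iter i f @^-1` B i)].

(* Minimal cardinality of a subcover; finite subcovers exist for open covers
   when T is compact. *)
Definition cover_number U : R :=
  inf [set n%:R | n in [set n : nat | exists B : 'I_n -> set T,
     (forall i, U (B i)) /\ \bigcup_(i in [set: 'I_n]) B i = setT]].

(* The sequence has a limit (its numerator is subadditive in n), so limsup and
   lim agree. *)
Definition cover_entropy f U : \bar R :=
  limn_esup (fun n => (ln (cover_number (iter_join f U n)) / n%:R)%:E).

(* Adler-Konheim-McAndrew *)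
Definition topological_entropy f : \bar R :=
  ereal_sup [set cover_entropy f U | U in open_cover].

End Entropy.
Arguments topological_entropy R {T} f.

Section Torus.
Context {R : realType} {g : nat}.
Local Notation C := R[i].
Local Notation V := 'rV[R[i]]_g.

Definition real_periods (P : 'M[C]_(g + g, g)) : 'M[R]_(g + g) :=
  row_mx (map_mx (@complex.Re R) P) (map_mx (@complex.Im R) P).

(* The 2g rows of the period matrix are an R-basis of C^g; they generate the
   lattice over Z. *)
Record lattice := Lattice {
  periods : 'M[C]_(g + g, g);
  periods_unit : real_periods periods \in unitmx }.

Implicit Types L : lattice.

Definition lattice_set L : set V :=
  [set map_mx intr n *m periods L | n in [set: 'rV[int]_(g + g)]].

Definition covolume L : R := `|\det (real_periods (periods L))|.

Lemma lattice_set0 L : lattice_set L 0.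
Proof. by exists 0 => //; rewrite map_mx0 mul0mx. Qed.

Lemma lattice_setB L x y :
  lattice_set L x -> lattice_set L y -> lattice_set L (x - y).
Proof.
by move=> [m _ <-] [n _ <-]; exists (m - n) => //; rewrite map_mxB mulmxBl.
Qed.

Lemma lattice_setN L x : lattice_set L x -> lattice_set L (- x).
Proof. by move=> Lx; rewrite -sub0r; apply: lattice_setB (lattice_set0 L) Lx. Qed.

Lemma lattice_setD L x y :
  lattice_set L x -> lattice_set L y -> lattice_set L (x + y).
Proof.
by move=> Lx Ly; rewrite -[y]opprK; apply: lattice_setB Lx (lattice_setN Ly).
Qed.

Definition lattice_rel L : rel V := fun x y => `[< lattice_set L (x - y) >].

Lemma lattice_rel_equiv L : equiv_class_of (lattice_rel L).
Proof.
split=> [x|x y|y x z].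
- by apply/asboolP; rewrite subrr; apply: lattice_set0.
- by apply/asboolP/asboolP => /lattice_setN; rewrite opprB.
- move=> /asboolP xy /asboolP yz; apply/asboolP.
  by rewrite -(subrKA y); apply: lattice_setD.
Qed.

Canonical lattice_equiv L := EquivRelPack (lattice_rel_equiv L).

(* C^g / L, with the quotient topology *)
Definition torus L : Type := quotient_topology {eq_quot lattice_equiv L}.

HB.instance Definition _ L :=
  PointedTopological.copy (torus L) (quotient_topology {eq_quot lattice_equiv L}).

Definition torus_pi L (z : V) : torus L := \pi_({eq_quot lattice_equiv L}) z.
Definition torus_repr L (x : torus L) : V :=
  repr (x : {eq_quot lattice_equiv L}).

Lemma torus_reprK L : cancel (@torus_repr L) (@torus_pi L).
Proof. by move=> x; exact: (@reprK _ {eq_quot lattice_equiv L}). Qed.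

Lemma torus_piP L (x y : V) :
  torus_pi L x = torus_pi L y <-> lattice_set L (x - y).
Proof.
split=> [/(@eqmodP _ (lattice_equiv L))|Lxy].
  by move=> /asboolP.
by apply/(@eqmodP _ (lattice_equiv L)); apply/asboolP.
Qed.

Lemma torus_piK L (z : V) : lattice_set L (torus_repr (torus_pi L z) - z).
Proof. by apply/torus_piP; rewrite torus_reprK. Qed.

Definition torus_add L (x y : torus L) := torus_pi L (torus_repr x + torus_repr y).
Definition torus_opp L (x : torus L) := torus_pi L (- torus_repr x).

Lemma torus_addE L z w :
  torus_add (torus_pi L z) (torus_pi L w) = torus_pi L (z + w).
Proof.
by apply/torus_piP; rewrite opprD addrACA; apply: lattice_setD; apply: torus_piK.
Qed.

Lemma torus_oppE L z : torus_opp (torus_pi L z) = torus_pi L (- z).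
Proof. by apply/torus_piP; rewrite -opprD; apply/lattice_setN/torus_piK. Qed.

Lemma torus_addA L : associative (@torus_add L).
Proof.
move=> x y z; rewrite -[x]torus_reprK -[y]torus_reprK -[z]torus_reprK.
by rewrite !torus_addE addrA.
Qed.

Lemma torus_addC L : commutative (@torus_add L).
Proof. by move=> x y; rewrite /torus_add addrC. Qed.

Lemma torus_add0 L : left_id (torus_pi L 0) (@torus_add L).
Proof. by move=> x; rewrite -[x]torus_reprK torus_addE add0r. Qed.

Lemma torus_addN L : left_inverse (torus_pi L 0) (@torus_opp L) (@torus_add L).
Proof. by move=> x; rewrite -[x]torus_reprK torus_oppE torus_addE addNr. Qed.

HB.instance Definition _ L := GRing.isZmodule.Build (torus L)
  (@torus_addA L) (@torus_addC L) (@torus_add0 L) (@torus_addN L).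

End Torus.
Arguments lattice : clear implicits.

Notation borel X := (g_sigma_algebraType (@open X)).

Section Holomorphic.
Context {R : realType}.

(* Near z, the map F is holomorphic and lifts f.  Differentiability is over the
   field R[i], so it means C-differentiability. *)
Definition local_lift {g h : nat} {L : lattice R g} {M : lattice R h}
    (f : torus L -> torus M) (z : 'rV[R[i]]_g) (F : 'rV[R[i]]_g -> 'rV[R[i]]_h)
    : Prop :=
  \forall w \near z, differentiable F w /\ f (torus_pi L w) = torus_pi M (F w).

Definition holomorphic {g h : nat} {L : lattice R g} {M : lattice R h}
    (f : torus L -> torus M) : Prop :=
  forall z, exists F, local_lift f z F.

(* df_x : C^g -> C^h, the tangent spaces of a torus being identified with the
   universal cover.  Two lifts differ by a locally constant lattice vector, so
   the choice made by xget is immaterial. *)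
Definition tangent {g h : nat} {L : lattice R g} {M : lattice R h}
    (f : torus L -> torus M) (x : torus L) : 'rV[R[i]]_g -> 'rV[R[i]]_h :=
  'd (xget (fun=> 0) [set F | local_lift f (torus_repr x) F]) (torus_repr x).

Definition torus_automorphism {g : nat} {L : lattice R g} (f : torus L -> torus L)
    : Prop :=
  {morph f : x y / x + y} /\ holomorphic f /\
  exists f' : torus L -> torus L,
    [/\ cancel f f', cancel f' f & holomorphic f'].

(* Holomorphic embedding in P^n.  The point phi x of P^n is given by some
   homogeneous coordinates, i.e. a nonzero row vector, two such vectors being
   identified when they span the same line; the map x |-> phi x itself need not
   be continuous, but it must have local holomorphic homogeneous coordinates s.
   The last clause says that the map to P^n is an immersion: the tangent space
   of P^n at the line [s z] is C^(n+1) modulo that line.  (The torus being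
   compact, an injective immersion is an embedding.) *)
Definition projective_embedding {g : nat} (L : lattice R g) (n : nat)
    (phi : torus L -> 'rV[R[i]]_n.+1) : Prop :=
  [/\ forall x, phi x != 0,
      forall x y, (phi x == phi y)%MS -> x = y
    & forall z, exists s : 'rV[R[i]]_g -> 'rV[R[i]]_n.+1,
        (\forall w \near z,
           differentiable s w /\ (s w == phi (torus_pi L w))%MS) /\
        (forall v, ('d s z v <= s z)%MS -> v = 0)].

Definition abelian_variety {g : nat} (L : lattice R g) : Prop :=
  exists n (phi : torus L -> 'rV[R[i]]_n.+1), projective_embedding phi.

Definition semi_conjugate_smaller {g : nat} {L : lattice R g}
    (f : torus L -> torus L) : Prop :=
  exists h (M : lattice R h) (a : torus M -> torus M) (p : torus L -> torus M),
    [/\ (0 < h < g)%N, abelian_variety M, torus_automorphism a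
      & [/\ holomorphic p, (forall y, exists x, p x = y) & p \o f = a \o p]].

End Holomorphic.

Section Measure.
Context {R : realType} {g : nat} {L : lattice R g}.
Local Notation X := (torus L).
Implicit Types (mu : probability (borel X) R) (f : X -> X).

(* The normalized Haar measure: the unique translation-invariant Borel
   probability. *)
Definition haar mu : Prop :=
  forall (a : X) (A : set (borel X)), measurable A ->
    mu ((fun x : X => a + x) @^-1` A) = mu A.

Definition invariant_measure mu f : Prop :=
  forall A : set (borel X), measurable A -> mu (f @^-1` A) = mu A.

Definition ergodic_measure mu f : Prop :=
  forall A : set (borel X), measurable A -> f @^-1` A = A ->
    mu A = 0%E \/ mu A = 1%E.

End Measure.

Section Smooth.
Context {R : realType}.

Fixpoint class_C {m : nat} (n : nat) (u : 'rV[R]_m -> R) : Prop :=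
  continuous u /\
  if n is n'.+1 then
    forall v, (forall x, derivable u x v) /\ class_C n' (fun x => 'D_v u x)
  else True.

Definition of_real_coord {g : nat} (x : 'rV[R]_(g + g)) : 'rV[R[i]]_g :=
  \row_j (x ord0 (lshift g j) +i* x ord0 (rshift g j)).

Definition smooth {g : nat} (u : 'rV[R[i]]_g -> R[i]) : Prop :=
  forall n, class_C n (fun x => complex.Re (u (of_real_coord x))) /\
            class_C n (fun x => complex.Im (u (of_real_coord x))).

End Smooth.

Section Forms.
Context {R : realType} {g : nat}.
Local Notation C := R[i].
Local Notation V := 'rV[R[i]]_g.

(* Complex-valued n-forms on the real vector space underlying C^g, as functions
   of n tangent vectors; n-fold alternating R-multilinearity is guaranteed by
   pq_form below. *)
Definition cform (n : nat) : Type := ('I_n -> V) -> C.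

(* dz_(I 0) /\ ... /\ dz_(I (p-1)) /\ dzbar_(J 0) /\ ... /\ dzbar_(J (q-1)) *)
Definition dz_wedge {p q : nat} (I : 'I_p -> 'I_g) (J : 'I_q -> 'I_g)
    : cform (p + q) :=
  fun v => \det (\matrix_(a, b) match fintype.split a with
                                | inl i => v b ord0 (I i)
                                | inr j => conjc (v b ord0 (J j))
                                end).

(* Forms of type (p, q) with constant coefficients. *)
Definition pq_form (p q : nat) (w : cform (p + q)) : Prop :=
  exists c : {ffun 'I_p -> 'I_g} -> {ffun 'I_q -> 'I_g} -> C,
    w = fun v => \sum_I \sum_J c I J * dz_wedge I J v.

Definition wedge {m n : nat} (w : cform m) (t : cform n) : cform (m + n) :=
  fun v => ((m`!)%:R * (n`!)%:R)^-1 *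
    \sum_(s : 'S_(m + n)) (-1) ^+ s *
      (w (fun a => v (s (lshift n a))) * t (fun b => v (s (rshift m b)))).

(* e_1, i e_1, e_2, i e_2, ...: for n = 2g, the positively oriented orthonormal
   real real_frame of C^g. *)
Definition real_frame (n : nat) : 'I_n -> V :=
  fun b => \row_j (if j == b./2 :> nat then (if odd b then 'i else 1) else 0).

End Forms.
Arguments cform R g n : clear implicits.
Arguments pq_form {R g} p q w.

Section FormsOnTorus.
Context {R : realType} {g : nat} {L : lattice R g}.
Local Notation C := R[i].
Local Notation X := (torus L).
Implicit Types (f : X -> X) (mu : probability (borel X) R).

Definition smooth_form (p q : nat) (W : X -> cform R g (p + q)) : Prop :=
  (forall x, pq_form p q (W x)) /\ (forall v, smooth (fun z => W (torus_pi L z) v)).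

Definition pullback f {n : nat} (W : X -> cform R g n) : X -> cform R g n :=
  fun x v => W (f x) (fun a => tangent f x (v a)).

(* w is an element of H^{k,k}(X), identified with the space of constant
   (k,k)-forms, such that f^* w = lam w *)
Definition eigenform f (k : nat) (lam : C) (w : cform R g (k + k)) : Prop :=
  pq_form k k w /\ pullback f (fun=> w) = fun=> (fun v => lam * w v).

(* Spectral radius of f^* on H^{k,k}(X). *)
Definition dynamical_degree f (k : nat) : R :=
  sup [set complex.Re `|lam| | lam in
        [set lam : C | exists2 w, @eigenform f k lam w & exists v, w v != 0]].

Definition dynamical_eigenspace f (k : nat) : set (cform R g (k + k)) :=
  [set w | @eigenform f k (dynamical_degree f k)%:C w].

Definition complex_integral mu (u : X -> C) : C :=
  (\int[mu]_x complex.Re (u x)) +i* (\int[mu]_x complex.Im (u x)).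

(* Integral over X of a form of degree n = 2g, when mu is the normalized Haar
   measure: covolume L * mu is then the Lebesgue measure of X. *)
Definition integral_form mu {n : nat} (W : X -> cform R g n) : C :=
  (covolume L)%:C * complex_integral mu (fun x => W x (real_frame (n := n))).

(* The current defined by a form, evaluated on a test form. *)
Definition current mu {m n : nat} (W : X -> cform R g m) (T : X -> cform R g n)
    : C :=
  integral_form mu (fun x => wedge (W x) (T x)).

Definition cesaro_mean f (k : nat) (W : X -> cform R g (k + k)) (N : nat)
    : X -> cform R g (k + k) :=
  fun x v => N%:R^-1 * \sum_(1 <= j < N.+1)
    (pullback (iter j f) W x v / (dynamical_degree f k)%:C ^+ j).

(* Weak convergence of the currents defined by the (k,k)-forms W_N to the
   current defined by W: test forms are the smooth (g-k,g-k)-forms. *)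
Definition cvg_currents mu (k : nat) (W_ : nat -> X -> cform R g (k + k))
    (W : X -> cform R g (k + k)) : Prop :=
  forall T : X -> cform R g ((g - k) + (g - k)), @smooth_form (g - k) (g - k) T ->
    current mu (W_ N) T @[N --> \oo] --> current mu W T.

End FormsOnTorus.
Arguments smooth_form {R g L} p q W.
Arguments eigenform {R g L} f k lam w.
Arguments dynamical_eigenspace {R g L} f k.
Arguments cesaro_mean {R g L} f k W N.
Arguments cvg_currents {R g L} mu k W_ W.

(* Main.v *)
(* The automorphism f lifts to a linear map A of C^g, and to an integral matrix
   N on the lattice.  If some polynomial in N is nonzero but singular, the
   corresponding polynomial in A is an endomorphism of X commuting with f whose
   image is a proper nonzero subtorus, and f is semi-conjugate to its
   restriction to this image (a subtorus of X is again projective).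

   Otherwise every polynomial in N is zero or invertible.  Applied to X^j - 1,
   this shows that N has no root of unity as an eigenvalue, unless f has finite
   order, in which case its entropy vanishes; so f acts without finite orbits on
   the nontrivial characters of X, and Haar measure is mixing.  Applied to the
   gcd of the minimal polynomial of N and its derivative, it shows that A is
   diagonalizable; in an eigenbasis of forms, f^* acts on the coefficients of
   Omega by u |-> a (u o f) with |a| <= lambda_k, and mixing computes the Cesaro
   limit coefficient by coefficient. *)
Require Import Defs.
From HB Require Import structures.
From mathcomp Require Import all_boot all_order all_algebra.
From mathcomp Require Import perm separable complex.
From mathcomp Require Import all_classical all_reals all_analysis.
From mathcomp Require Import measurable_realfun ring lra.

Set Implicit Arguments.
Unset Strict Implicit.
Unset Printing Implicit Defensive.

Import Order.TTheory GRing.Theory Num.Theory.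
Import numFieldNormedType.Exports.

Local Open Scope classical_set_scope.
Local Open Scope ring_scope.

(** * Real coordinates and topology *)

Section RealCoordinates.
Context {R : realType}.
Local Notation C := R[i].

(** The analysis rests on finite computations. A product of two cosine waves is a combination of two
    waves with explicit frequencies, so mixing for waves only says that an orbit of frequencies
    meets a given value at most once. Bounded measurable functions are reached by approximation in
    mean, through a sigma-algebra argument instead of Fourier series. The obstacle is that
    approximating [u o f] from an approximation of [u] requires the invariance of the measure, which
    is itself to be proved; hence the errors for [u] and for [u o f] are controlled together.

    For currents, the wedges of eigenforms indexed by all pairs of multi-indices span but are not
    independent. The coefficients of [Omega] are therefore read off by fixed finite combinations of
    values of [Omega] on vectors, which makes them bounded measurable functions of the point. A
    coefficient whose weight is [a] times [lambda_k] contributes its mean if [a = 1] and nothing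
    otherwise: this is why the limit is a constant form and why it lies in [E_k]. *)

Definition cplxmx {r n} (X : 'M[R]_(r, n)) : 'M[C]_(r, n) :=
  map_mx (real_complex R) X.

Definition realify {r n} (M : 'M[C]_(r, n)) : 'M[R]_(r, n + n) :=
  row_mx (map_mx (@complex.Re R) M) (map_mx (@complex.Im R) M).

Lemma ReD (x y : C) : complex.Re (x + y) = complex.Re x + complex.Re y.
Proof. by case: x y => ? ? []. Qed.

Lemma ImD (x y : C) : complex.Im (x + y) = complex.Im x + complex.Im y.
Proof. by case: x y => ? ? []. Qed.

Lemma Re_realM (a : R) (x : C) : complex.Re (real_complex R a * x) = a * complex.Re x.
Proof. by case: x => ? ? /=; rewrite mul0r subr0. Qed.

Lemma Im_realM (a : R) (x : C) : complex.Im (real_complex R a * x) = a * complex.Im x.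
Proof. by case: x => ? ? /=; rewrite mul0r addr0. Qed.

Lemma Re_sum (I : Type) (r : seq I) (P : pred I) (F : I -> C) :
  complex.Re (\sum_(i <- r | P i) F i) = \sum_(i <- r | P i) complex.Re (F i).
Proof. by apply: (big_morph _ ReD). Qed.

Lemma Im_sum (I : Type) (r : seq I) (P : pred I) (F : I -> C) :
  complex.Im (\sum_(i <- r | P i) F i) = \sum_(i <- r | P i) complex.Im (F i).
Proof. by apply: (big_morph _ ImD). Qed.

Lemma realifyM {q r n} (X : 'M[R]_(q, r)) (M : 'M[C]_(r, n)) :
  realify (cplxmx X *m M) = X *m realify M.
Proof.
rewrite /realify mul_mx_row; congr row_mx; apply/matrixP => i j; rewrite !mxE.
  by rewrite Re_sum; apply: eq_bigr => k _; rewrite !mxE Re_realM.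
by rewrite Im_sum; apply: eq_bigr => k _; rewrite !mxE Im_realM.
Qed.

Lemma realifyD {r n} (M N : 'M[C]_(r, n)) :
  realify (M + N) = realify M + realify N.
Proof.
rewrite /realify add_row_mx; congr row_mx; apply/matrixP => i j; rewrite !mxE.
  exact: ReD.
exact: ImD.
Qed.

Lemma realify0 {r n} : realify (0 : 'M[C]_(r, n)) = 0.
Proof. by apply: (addrI (realify 0)); rewrite -realifyD !addr0. Qed.

Lemma realify_inj {r n} : injective (@realify r n).
Proof.
move=> M N /eq_row_mx [/matrixP h1 /matrixP h2]; apply/matrixP => i j.
move: (h1 i j) (h2 i j); rewrite !mxE.
by case: (M i j) (N i j) => [a b] [c d] /= -> ->.
Qed.

Lemma realify_surj {r n} (X : 'M[R]_(r, n + n)) : exists M, realify M = X.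
Proof.
exists (\matrix_(i, j) Complex (X i (lshift n j)) (X i (rshift n j))).
rewrite -[RHS]hsubmxK; congr row_mx; apply/matrixP => i j; by rewrite !mxE.
Qed.

Lemma cplxmxM {q r n} (X : 'M[R]_(q, r)) (Y : 'M[R]_(r, n)) :
  cplxmx (X *m Y) = cplxmx X *m cplxmx Y.
Proof. exact: map_mxM. Qed.

Lemma cplxmx_int {r n} (N : 'M[int]_(r, n)) :
  cplxmx (map_mx intr N) = map_mx intr N.
Proof. by apply/matrixP => i j; rewrite !mxE rmorph_int. Qed.

Context {g : nat}.
Implicit Types L : lattice R g.

(** Coordinates in the real basis of [C^g] formed by the periods; the lattice becomes [Z^(2g)] in
    them. *)
Definition rcoord {r} L (M : 'M[C]_(r, g)) : 'M[R]_(r, g + g) :=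
  realify M *m invmx (realify (periods L)).

Definition of_rcoord {r} L (X : 'M[R]_(r, g + g)) : 'M[C]_(r, g) :=
  cplxmx X *m periods L.

Lemma of_rcoordK {r} L : cancel (@of_rcoord r L) (@rcoord r L).
Proof.
by move=> X; rewrite /rcoord /of_rcoord realifyM mulmxK //; exact: periods_unit.
Qed.

Lemma rcoordK {r} L : cancel (@rcoord r L) (@of_rcoord r L).
Proof.
move=> M; apply: realify_inj; rewrite /of_rcoord realifyM /rcoord mulmxKV //.
exact: periods_unit.
Qed.

Lemma of_rcoord_inj {r} L : injective (@of_rcoord r L).
Proof. exact: can_inj (of_rcoordK L). Qed.

Lemma rcoord_inj {r} L : injective (@rcoord r L).
Proof. exact: can_inj (rcoordK L). Qed.

Lemma of_rcoord0 {r} L : @of_rcoord r L 0 = 0.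
Proof. by rewrite /of_rcoord /cplxmx map_mx0 mul0mx. Qed.

Lemma rcoordD {r} L (M N : 'M[C]_(r, g)) :
  rcoord L (M + N) = rcoord L M + rcoord L N.
Proof. by rewrite /rcoord realifyD mulmxDl. Qed.

Lemma rcoord0 {r} L : @rcoord r L 0 = 0.
Proof. by rewrite -[0 in LHS](of_rcoord0 L) of_rcoordK. Qed.

Lemma rcoordN {r} L (M : 'M[C]_(r, g)) : rcoord L (- M) = - rcoord L M.
Proof. by apply: (addrI (rcoord L M)); rewrite -rcoordD !subrr rcoord0. Qed.

Lemma lattice_setP L (z : 'rV[C]_g) :
  lattice_set L z <-> exists n : 'rV[int]_(g + g), rcoord L z = map_mx intr n.
Proof.
split=> [[n _ <-]|[n hn]]; exists n => //.
  by rewrite -cplxmx_int -[cplxmx _ *m _]/(of_rcoord L _) of_rcoordK.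
by rewrite -cplxmx_int -hn -[LHS]/(of_rcoord L _) rcoordK.
Qed.

Lemma lattice_set_rows L r (M : 'M[C]_(r, g)) :
  (forall i, lattice_set L (row i M)) ->
  exists N : 'M[int]_(r, g + g), M = map_mx intr N *m periods L.
Proof.
move=> h; pose N i := xget 0 [set n | map_mx intr n *m periods L = row i M].
have hN i : map_mx intr (N i) *m periods L = row i M.
  by rewrite /N; case: xgetP => [n _ //|]; case: (h i) => n _ nM /(_ n).
exists (\matrix_i N i); apply/row_matrixP => i.
rewrite row_mul -hN; congr (_ *m _).
by apply/rowP => j; rewrite !mxE.
Qed.

Lemma periods_lattice L i : lattice_set L (row i (periods L)).
Proof.
exists (delta_mx 0 i) => //.
by rewrite map_delta_mx -rowE.
Qed.

Lemma cplxmx_periods_inj L r (X Y : 'M[R]_(r, g + g)) :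
  cplxmx X *m periods L = cplxmx Y *m periods L -> X = Y.
Proof. exact: of_rcoord_inj. Qed.

Lemma intr_mx_inj r n : injective (fun N : 'M[int]_(r, n) => map_mx intr N : 'M[R]_(r, n)).
Proof.
move=> M N /matrixP h; apply/matrixP => i j; have := h i j; rewrite !mxE.
exact: intr_inj.
Qed.

Lemma intmx_periods_inj L r (X Y : 'M[int]_(r, g + g)) :
  map_mx intr X *m periods L = map_mx intr Y *m periods L -> X = Y.
Proof.
move=> h; apply: intr_mx_inj; apply: (@cplxmx_periods_inj L).
by rewrite !cplxmx_int.
Qed.

(** The periods span [C^g] over the reals, so a complex matrix that kills them all is zero. This
    transfers identities from the integral matrix of an endomorphism to its complex lift. *)
Lemma periods_mul_eq0 L (T : 'M[C]_g) : periods L *m T = 0 -> T = 0.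
Proof.
move=> h; apply/row_matrixP => i; rewrite rowE row0.
by rewrite -[delta_mx 0 i](rcoordK L) /of_rcoord -mulmxA h mulmx0.
Qed.

End RealCoordinates.

Section MatrixContinuity.

Lemma cvg_sum (T : Type) (F : set_system T) {FF : Filter F} (K : numFieldType)
    (V : normedModType K) (I : Type) (r : seq I) (f : I -> T -> V) (l : I -> V) :

  (forall i, f i t @[t --> F] --> l i) ->
  \sum_(i <- r) f i t @[t --> F] --> \sum_(i <- r) l i.
Proof.
move=> h; elim: r => [|i r IH].
  rewrite big_nil; under eq_fun do rewrite big_nil; exact: cvg_cst.
rewrite big_cons; under eq_fun do rewrite big_cons.
exact: cvgD.
Qed.

Lemma mx_cvg_entries (T : Type) (F : set_system T) {FF : Filter F} (K : numFieldType) m n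
    (f : T -> 'M[K]_(m, n)) (l : 'M[K]_(m, n)) :

  (forall i j, f s i j @[s --> F] --> l i j) -> f s @[s --> F] --> l.
Proof.
move=> h A /= /nbhs_ballP[e e0 eA].
have : \forall s \near F, forall i j, ball (l i j) e (f s i j).
  apply: filter_forall => i; apply: filter_forall => j.
  by have := h i j (ball (l i j) e); apply; exact: nbhsx_ballx.
rewrite /= !near_simpl; apply: filterS => s hs.
by apply: eA; split.
Qed.

Lemma mulmx_continuous (K : numFieldType) p m n (A : 'M[K]_(m, n)) :
  continuous (fun z : 'M[K]_(p, m) => z *m A).
Proof.
move=> z; apply: (@mx_cvg_entries _ (nbhs z)) => i j.
rewrite (_ : (fun s : 'M[K]_(p, m) => (s *m A) i j) =
  (fun s => \sum_k s i k * A k j)); last by apply/funext => s; rewrite mxE.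
rewrite mxE; apply: (@cvg_sum _ (nbhs z) _ K K^o) => k; apply: cvgM; last exact: cvg_cst.
exact: coord_continuous.
Qed.

End MatrixContinuity.
Section ComplexTopology.
Context {R : realType}.
Local Notation C := R[i].

Lemma near_complex_dist (z : C) (e : R) : 0 < e ->
  \forall w \near z, `|z - w| < real_complex R e.
Proof.
move=> e0; apply/nbhs_ballP; exists (real_complex R e); first by rewrite /= ltcR.
by move=> w; exact.
Qed.

Lemma continuous_Re : continuous (@complex.Re R).
Proof.
move=> z; apply/(@cvgrPdist_lt _ _ _ (nbhs z)) => e e0; near=> w.
have : `|z - w| < real_complex R e by near: w; exact: near_complex_dist.
rewrite -ltcR; apply: le_lt_trans.
rewrite (_ : _ - _ = complex.Re (z - w)) ?normc_ge_Re//.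
by case: (z) (w) => ? ? [].
Unshelve. all: by end_near. Qed.

Lemma continuous_Im : continuous (@complex.Im R).
Proof.
move=> z; apply/(@cvgrPdist_lt _ _ _ (nbhs z)) => e e0; near=> w.
have : `|z - w| < real_complex R e by near: w; exact: near_complex_dist.
rewrite -ltcR; apply: le_lt_trans.
rewrite (_ : _ - _ = - complex.Re ((z - w) * 'i%C)); last first.
  by case: (z) (w) => ? ? [] /= ? ?; rewrite mulr0 mulr1 sub0r opprK.
rewrite normrN; apply: le_trans (normc_ge_Re _) _.
rewrite normrM (_ : `|'i%C| = 1) ?mulr1 //.
by rewrite normc_def /= expr0n expr1n add0r sqrtr1.
Unshelve. all: by end_near. Qed.

Lemma complex_dist_le (z w : C) :
  complex.Re `|z - w| <=
  `|complex.Re z - complex.Re w| + `|complex.Im z - complex.Im w|.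
Proof.
case: z w => a b [c d] /=.
rewrite -(ler_pXn2r (n := 2)) ?nnegrE ?sqrtr_ge0 ?addr_ge0//.
rewrite sqr_sqrtr ?addr_ge0 ?sqr_ge0// [leRHS]sqrrD !real_normK ?num_real//.
by rewrite addrAC lerDl mulrn_wge0// mulr_ge0.
Qed.

Lemma RRe_norm (z : C) : real_complex R (complex.Re `|z|) = `|z|.
Proof. by rewrite RRe_real// ger0_real. Qed.

Lemma cvg_complex (T : Type) (F : set_system T) {FF : Filter F}
    (f : T -> C) (l : C) :
  complex.Re (f t) @[t --> F] --> complex.Re l ->
  complex.Im (f t) @[t --> F] --> complex.Im l ->
  f t @[t --> F] --> l.
Proof.
move=> /cvgrPdist_lt hr /cvgrPdist_lt hi A /= /nbhs_ballP[e /= e0 eA].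
have [r re] : exists r, e = real_complex R r.
  by exists (complex.Re e); rewrite RRe_real// gtr0_real.
move: e0 eA; rewrite {e}re ltcR => r0 eA.
suff: \forall t \near F, A (f t) by [].
near=> t; apply: eA => /=.
suff : `|l - f t| < real_complex R r by [].
rewrite -RRe_norm ltcR; apply: le_lt_trans (complex_dist_le _ _) _.
by rewrite (splitr r) ltrD//; near: t; [apply: hr|apply: hi]; rewrite divr_gt0.
Unshelve. all: by end_near. Qed.

Context {g : nat}.

Lemma continuous_realify r : continuous (@realify R r g).
Proof.
move=> z; apply: (@mx_cvg_entries _ (nbhs z)) => i j.
case: (split_ordP j) => k ->.
  rewrite (_ : (fun s => _) = @complex.Re R \o (fun s : 'M[C]_(r, g) => s i k)).
    rewrite row_mxEl mxE; apply: (@continuous_comp _ _ _ _ (@complex.Re R)).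
      exact: coord_continuous.
    exact: continuous_Re.
  by apply/funext => s; rewrite row_mxEl mxE.
rewrite (_ : (fun s => _) = @complex.Im R \o (fun s : 'M[C]_(r, g) => s i k)).
  rewrite row_mxEr mxE; apply: (@continuous_comp _ _ _ _ (@complex.Im R)).
    exact: coord_continuous.
  exact: continuous_Im.
by apply/funext => s; rewrite row_mxEr mxE.
Qed.

Lemma continuous_cplxmx r n : continuous (@cplxmx R r n).
Proof.
move=> z; apply: (@mx_cvg_entries _ (nbhs z)) => i j.
apply: (@cvg_complex _ (nbhs z)).
  rewrite (_ : (fun s => _) = (fun s : 'M[R]_(r, n) => s i j)).
    by rewrite mxE; exact: coord_continuous.
  by apply/funext => s; rewrite mxE.
rewrite (_ : (fun s => _) = (fun s : 'M[R]_(r, n) => 0 : R)).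
  by rewrite mxE; exact: cvg_cst.
by apply/funext => s; rewrite mxE.
Qed.

Lemma continuous_rcoord r (L : lattice R g) : continuous (@rcoord R g r L).
Proof.
move=> z; apply: (@continuous_comp _ _ _ (@realify R r g)
  (fun X => X *m invmx (realify (periods L)))).
  exact: continuous_realify.
exact: mulmx_continuous.
Qed.

Lemma continuous_of_rcoord r (L : lattice R g) : continuous (@of_rcoord R g r L).
Proof.
move=> z; apply: (@continuous_comp _ _ _ (@cplxmx R r _)
  (fun X => X *m periods L)).
  exact: continuous_cplxmx.
exact: mulmx_continuous.
Qed.

Lemma torus_pi_continuous (L : lattice R g) : continuous (torus_pi L).
Proof. exact: pi_continuous. Qed.

Lemma torus_continuousP (L : lattice R g) (Z : topologicalType) (u : torus L -> Z) :
  continuous (u \o torus_pi L) -> continuous u.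
Proof. by move=> h; apply/(quotient_continuous u). Qed.

End ComplexTopology.

(** * Linear lifts of homomorphisms of tori *)

Section TorusGroup.
Context {R : realType} {g : nat}.
Implicit Type L : lattice R g.

Lemma torus_piD L : {morph torus_pi L : z w / z + w}.
Proof. by move=> z w; rewrite -torus_addE. Qed.

Lemma torus_pi0 L : torus_pi L 0 = 0.
Proof. by []. Qed.

Lemma torus_piMn L z n : torus_pi L (z *+ n) = torus_pi L z *+ n.
Proof. by elim: n => // n IH; rewrite !mulrS torus_piD IH. Qed.

Lemma torus_pi_eq0 L z : torus_pi L z = 0 <-> lattice_set L z.
Proof. by rewrite -torus_pi0 torus_piP subr0. Qed.

Lemma torus_pi_surj L x : exists z, x = torus_pi L z.
Proof. by exists (torus_repr x); rewrite torus_reprK. Qed.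

End TorusGroup.

(** * The lattice is closed and discrete *)

Section LatticeClosed.
Context {R : realType}.
Local Notation C := R[i].

Lemma closed_int : closed (range (intr : int -> R)).
Proof.
rewrite -openC.
rewrite (_ : ~` _ = \bigcup_(n in [set: int]) `]n%:~R, (n + 1)%:~R[%classic).
  by apply: bigcup_open => n _; exact: interval_open.
apply/seteqP; split=> [x hx|x [n _ /= nx] [m _ mx]] /=.
  exists (Num.floor x) => //=; rewrite in_itv/= lt_succ_floor ?num_real// andbT.
  rewrite lt_neqAle floor_le ?num_real// andbT.
  by apply/eqP => h; apply: hx; exists (Num.floor x).
by move: nx; rewrite -mx in_itv/= !ltr_int ltzD1 => /andP[/lt_le_trans h /h]; rewrite ltxx.
Qed.

Context {g : nat} (L : lattice R g).

Lemma lattice_set_coordP (z : 'rV[C]_g) :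
  lattice_set L z <-> forall i, range (intr : int -> R) (rcoord L z ord0 i).
Proof.
rewrite lattice_setP; split=> [[n ->] i|h]; first by exists (n ord0 i); rewrite ?mxE.
exists (\row_i Num.floor (rcoord L z ord0 i)).
apply/rowP => i; have [n _ nz] := h i.
by rewrite -nz 2![in RHS]mxE -nz intrKfloor.
Qed.

Lemma closed_lattice_set : closed (lattice_set L).
Proof.
rewrite (_ : lattice_set L = \bigcap_(i in [set: 'I_(g + g)])
  ((fun z => rcoord L z ord0 i) @^-1` range (intr : int -> R))); last first.
  apply/seteqP; split=> z; first by move=> /lattice_set_coordP h i _; exact: h.
  by move=> h; apply/lattice_set_coordP => i; exact: h.
apply: closed_bigI => i _; apply: preimage_closed; last exact: closed_int.
move=> z _; apply: (@continuous_comp _ _ _ (@rcoord R g 1 L) (fun x => x ord0 i)).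
  exact: continuous_rcoord.
exact: coord_continuous.
Qed.

(** Coordinates are continuous, and integers of absolute value less than 1 vanish. *)
Lemma lattice_set_near0 : \forall w \near (0 : 'rV[C]_g), lattice_set L w -> w = 0.
Proof.
have h : forall i j, \forall w \near (0 : 'rV[C]_g), `|rcoord L w i j| < 1.
  move=> i j.
  have c : rcoord L w i j @[w --> (0 : 'rV[C]_g)] --> (0 : R).
    have -> : (0 : R) = rcoord L (0 : 'rV_g) i j by rewrite rcoord0 mxE.
    apply: (@continuous_comp _ _ _ (@rcoord R g 1 L) (fun x => x i j)).
      exact: continuous_rcoord.
    exact: coord_continuous.
  exact: (@cvgr0_norm_lt _ _ _ (nbhs (0 : 'rV[C]_g)) _ _ c 1 ltr01).
have : \forall w \near (0 : 'rV[C]_g), forall i j, `|rcoord L w i j| < 1.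
  pose FF := nbhs_filter (0 : 'rV[C]_g).
  by apply: (@filter_forall _ _ _ _ FF) => i; apply: (@filter_forall _ _ _ _ FF) => j; exact: h.
apply: filterS => w hw /lattice_setP[n wn].
apply: (@rcoord_inj R g 1 L); rewrite rcoord0 wn; apply/rowP => j; rewrite !mxE.
have := hw ord0 j; rewrite wn mxE -intr_norm ltrz1.
by case: (n ord0 j) => [[]|].
Qed.

End LatticeClosed.

Section LinearLift.
Context {R : realType}.
Local Notation C := R[i].

Lemma cvg_harmonic_dnbhs : (n.+1%:R^-1 : C) @[n --> \oo] --> (0 : C)^'.
Proof.
have h : (n.+1%:R^-1 : C) @[n --> \oo] --> (0 : C).
  apply: cvg_complex.
    rewrite (_ : (fun n => _) = @harmonic R); first exact: cvg_harmonic.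
    apply/funext => n.
    by rewrite /harmonic /= -(rmorph_nat (real_complex R)) -fmorphV.
  rewrite (_ : (fun n => _) = fun=> 0); first exact: cvg_cst.
  by apply/funext => n; rewrite -(rmorph_nat (real_complex R)) -fmorphV.
move=> A hA.
have : \forall n \near \oo, (n.+1%:R^-1 : C) != 0 -> A (n.+1%:R^-1 : C) := h _ hA.
by apply: (@filterS nat) => n; apply; rewrite invr_eq0 pnatr_eq0.
Qed.

Context {g h : nat}.
Local Notation V := 'rV[C]_g.
Local Notation W := 'rV[C]_h.

(** Testing the derivative along [1/(n+1)] multiplies the increments by integers, so that they
    remain compatible with the group law of the torus. *)
Lemma cvg_scaled_increment (F : V -> W) (z v : V) : differentiable F z ->
  n.+1%:R *: (F (n.+1%:R^-1 *: v + z) - F z) @[n --> \oo] --> 'd F z v.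
Proof.
move=> dF; rewrite -deriveE//.
have := @diff_derivable _ _ _ _ _ v dF; rewrite /derivable -/(derive F z v).
move=> /(cvg_comp _ _ cvg_harmonic_dnbhs).
suff -> : (fun n => n.+1%:R *: (F (n.+1%:R^-1 *: v + z) - F z)) =
  (fun h => h^-1 *: ((F \o shift z) (h *: v) - F z)) \o
    (fun n => n.+1%:R^-1 : C) by [].
by apply/funext => n /=; rewrite invrK.
Qed.

Definition linear_lift (L : lattice R g) (M : lattice R h)
    (f : torus L -> torus M) (A : 'M[C]_(g, h)) : Prop :=
  forall z, f (torus_pi L z) = torus_pi M (z *m A).

(* For a local lift F at 0 and w small, F w - F 0 - n (F (w / n) - F 0) is a
   lattice vector; at the limit, F w - F 0 - dF_0 w is one as well. *)
Lemma linear_lift_ex (L : lattice R g) (M : lattice R h)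
    (f : torus L -> torus M) :
  {morph f : x y / x + y} -> holomorphic f -> exists A, linear_lift f A.
Proof.
move=> fD /(_ 0)[F hF].
have f0 : f 0 = 0 by apply: (addrI (f 0)); rewrite -fD !addr0.
have fMn x n : f (x *+ n) = f x *+ n.
  by elim: n => // n IH; rewrite !mulrS fD IH.
have [dF fF0] : differentiable F 0 /\ f (torus_pi L 0) = torus_pi M (F 0).
  exact: nbhs_singleton hF.
have F0 : lattice_set M (F 0) by apply/torus_pi_eq0; rewrite -fF0 torus_pi0.
have /nbhs_normP[e /= e0 he] : \forall w \near (0 : V),
    f (torus_pi L w) = torus_pi M (F w).
  by apply: (@filterS V) hF => w [].
have hF0 w : `|w| < e -> f (torus_pi L w) = torus_pi M (F w - F 0).
  move=> we; rewrite he ?/ball_ /= ?sub0r ?normrN//.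
  by apply/torus_piP; rewrite opprB addrC subrK.
have hd w : `|w| < e -> f (torus_pi L w) = torus_pi M ('d F 0 w).
  move=> we; rewrite hF0//; apply/torus_piP.
  apply: (@closed_cvg nat W \oo _ (fun n =>
      F w - F 0 - n.+1%:R *: (F (n.+1%:R^-1 *: w + 0) - F 0))
      (lattice_set M)); first exact: closed_lattice_set.
    apply: nearW => n; apply/torus_piP.
    rewrite -hF0// addr0 scaler_nat torus_piMn -hF0; last first.
      apply: le_lt_trans we; rewrite normrZ ler_piMl//.
      by rewrite normfV invf_le1 ?normr_gt0 ?pnatr_eq0// normr_nat ler1n.
    by rewrite -fMn -torus_piMn -scaler_nat scalerA mulfV ?pnatr_eq0// scale1r.
  apply: (@cvgB _ _ _ \oo); first exact: cvg_cst.
  exact: cvg_scaled_increment.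
exists (lin1_mx ('d F 0)) => z; rewrite mul_rV_lin1.
(* Additivity extends the formula from the small ball to all of [C^g]: [z] is an integral multiple
   of a vector of the ball. *)
have [n hn] : exists n : nat, `|n.+1%:R^-1 *: z| < e.
  have : (n.+1%:R^-1 : C) *: z @[n --> \oo] --> (0 : C) *: z.
    apply: (@cvgZr_tmp _ _ _ \oo).
    by apply: cvg_trans cvg_harmonic_dnbhs _; exact: cvg_within.
  rewrite scale0r => /cvgr0_norm_lt /(_ _ e0)[n _ hn].
  by exists n; apply: hn => /=.
have -> : z = (n.+1%:R^-1 *: z) *+ n.+1.
  by rewrite -scaler_nat scalerA mulfV ?pnatr_eq0// scale1r.
rewrite raddfMn !torus_piMn fMn hd//.
Qed.

End LinearLift.

(** * Tangent maps, integrality and construction of homomorphisms through linear lifts *)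

Section LinearMaps.
Context {R : realType}.
Local Notation C := R[i].

Lemma mulmx_differentiable g h (A : 'M[C]_(g, h)) (z : 'rV[C]_g) :
  differentiable (fun w => w *m A) z.
Proof.
apply: (@linear_differentiable _ _ _ (mulmxr A)); exact: mulmx_continuous.
Qed.

Lemma diff_mulmx g h (A : 'M[C]_(g, h)) (z v : 'rV[C]_g) :
  'd (fun w => w *m A) z v = v *m A.
Proof.
by rewrite (@diff_lin _ _ _ (mulmxr A)) //; exact: mulmx_continuous.
Qed.

Lemma linear_lift_local g h (L : lattice R g) (M : lattice R h)
    (f : torus L -> torus M) A z :
  linear_lift f A -> local_lift f z (fun w => w *m A).
Proof.
by move=> fA; apply: (@filterE _ (nbhs z) (nbhs_filter z)) => w; split=> //; exact: mulmx_differentiable.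
Qed.

Lemma linear_lift_holomorphic g h (L : lattice R g) (M : lattice R h)
    (f : torus L -> torus M) A :
  linear_lift f A -> holomorphic f.
Proof. by move=> fA z; exists (fun w => w *m A); exact: linear_lift_local. Qed.

(** The lift picked by [xget] and the linear one differ by a continuous function with values in a
    discrete lattice, hence by a constant near the point. The default value of [xget] never occurs,
    since the linear lift is a local lift. *)
Lemma tangent_linear g h (L : lattice R g) (M : lattice R h)
    (f : torus L -> torus M) A x v :
  linear_lift f A -> tangent f x v = v *m A.
Proof.
move=> fA; rewrite /tangent; set z := torus_repr x.
case: xgetP => [F _ hF|/(_ _ (linear_lift_local z fA))//].
have dF : differentiable F z by have [] := nbhs_singleton hF.
have cF : {for z, continuous F} by exact: differentiable_continuous.
pose D w := F w - w *m A.
have Dz : D w - D z @[w --> z] --> (0 : 'rV[C]_h).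
  rewrite -(subrr (D z)); apply: (@cvgB _ _ _ (nbhs z)); last exact: cvg_cst.
  by apply: (@cvgB _ _ _ (nbhs z)); [exact: cF | exact: mulmx_continuous].
have DL w : f (torus_pi L w) = torus_pi M (F w) -> lattice_set M (D w).
  by rewrite fA => /esym/torus_piP.
have Dc : \forall w \near z, F w - F z = (w - z) *m A.
  have h0 := Dz _ (lattice_set_near0 M).
  have hF' : \forall w \near z, f (torus_pi L w) = torus_pi M (F w).
    by apply: (@filterS _ (nbhs z) (nbhs_filter z)) hF => w [].
  have hz := nbhs_singleton hF'.
  apply: (@filterS2 _ (nbhs z) (nbhs_filter z) _ _ _ _ h0 hF') => w /= w0 wF.
  have /w0/subr0_eq : lattice_set M (D w - D z) by apply: lattice_setB; apply: DL.
  rewrite /D => e; rewrite -[F w](subrK (w *m A)) e mulmxBl.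
  by rewrite addrAC [F z - _ - _]addrAC subrr add0r addrC.
rewrite -deriveE// /derive.
apply: (@cvg_lim _ _ _ (0^')).
  exact: norm_hausdorff.
apply: (@cvg_near_cst _ _ _ _ (0^')).
have hc : h *: v + z @[h --> (0 : C)] --> z.
  have : h *: v + z @[h --> (0 : C)] --> (0 : C) *: v + z.
    apply: (@cvgD _ _ _ (nbhs (0 : C))); last exact: cvg_cst.
    by apply: (@cvgZr_tmp _ _ _ (nbhs (0 : C))); exact: cvg_id.
  by rewrite scale0r add0r.
have {}Dc : \forall h \near (0 : C), F (h *: v + z) - F z = (h *: v + z - z) *m A :=
  hc _ Dc.
apply: (@filterS _ (nbhs (0 : C)) (nbhs_filter _) _ _ _ Dc) => a /= -> a0.
by rewrite addrK -scalemxAl scalerA mulVf// scale1r.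
Qed.

Section Torus.
Context {g : nat} (L : lattice R g).

(** The images of the vectors [z/(n+1)] are lattice vectors tending to 0, so they vanish for large
    [n]. *)
Lemma linear_mx_lattice_eq0 h (M : lattice R h) (A : 'M[C]_(g, h)) :
  (forall z, lattice_set M (z *m A)) -> A = 0.
Proof.
move=> hA; apply/row_matrixP => i; rewrite row0 rowE; set z := delta_mx _ _.
have : n.+1%:R^-1 *: (z *m A) @[n --> \oo] --> (0 : 'rV[C]_h).
  rewrite -(scale0r (z *m A)); apply: (@cvgZr_tmp _ _ _ \oo).
  by apply: cvg_trans cvg_harmonic_dnbhs _; exact: cvg_within.
move=> /(_ _ (lattice_set_near0 M)) [n _ /(_ n)] /= /(_ (leqnn n)).
rewrite scalemxAl => /(_ (hA _)) /eqP.
by rewrite -scalemxAl scaler_eq0 invr_eq0 pnatr_eq0 /= => /eqP.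
Qed.

Lemma linear_lift_inj h (M : lattice R h) (f : torus L -> torus M) A B :
  linear_lift f A -> linear_lift f B -> A = B.
Proof.
move=> fA fB; apply/subr0_eq/(@linear_mx_lattice_eq0 _ M) => z.
by rewrite mulmxBr; apply/torus_piP; rewrite -fA -fB.
Qed.

Lemma linear_lift_comp h k (M : lattice R h) (N : lattice R k)
    (f : torus L -> torus M) (f' : torus M -> torus N) A B :
  linear_lift f A -> linear_lift f' B -> linear_lift (f' \o f) (A *m B).
Proof. by move=> fA fB z; rewrite /= fA fB mulmxA. Qed.

Lemma linear_lift_id : linear_lift (@id (torus L)) 1%:M.
Proof. by move=> z; rewrite mulmx1. Qed.

Lemma linear_lift_iter (f : torus L -> torus L) A j :
  linear_lift f A -> linear_lift (iter j f) (A ^+ j).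
Proof.
move=> fA; elim: j => [|j IH] z; first by rewrite mulmx1.
by rewrite iterS IH fA exprSr mulmxA.
Qed.

Lemma linear_lift_lattice h (M : lattice R h) (f : torus L -> torus M) A z :
  linear_lift f A -> lattice_set L z -> lattice_set M (z *m A).
Proof.
move=> fA Lz; have f0 : f 0 = 0 by rewrite -[0 in LHS]torus_pi0 fA mul0mx.
by apply/torus_pi_eq0; rewrite -fA (iffRL (torus_pi_eq0 _ _) Lz).
Qed.

Lemma linear_lift_int h (M : lattice R h) (f : torus L -> torus M) A :
  linear_lift f A ->
  exists B : 'M[int]_(_, _), periods L *m A = map_mx intr B *m periods M.
Proof.
move=> fA; apply: lattice_set_rows => i; rewrite row_mul.
exact: linear_lift_lattice fA (periods_lattice _ _).
Qed.

(** Representatives make the map total; it has the lift [A] once [A] sends [L] into [M]. *)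
Definition torus_map h (M : lattice R h) (A : 'M[C]_(g, h)) : torus L -> torus M :=
  fun x => torus_pi M (torus_repr x *m A).

Lemma torus_mapP h (M : lattice R h) (A : 'M[C]_(g, h)) :
  (forall z, lattice_set L z -> lattice_set M (z *m A)) ->
  linear_lift (torus_map M A) A.
Proof.
move=> hA z; apply/torus_piP; rewrite -mulmxBl; apply: hA.
exact: torus_piK.
Qed.

Lemma linear_liftD h (M : lattice R h) (f : torus L -> torus M) A :
  linear_lift f A -> {morph f : x y / x + y}.
Proof.
move=> fA x y; have [z ->] := torus_pi_surj x; have [w ->] := torus_pi_surj y.
by rewrite -torus_piD !fA mulmxDl torus_piD.
Qed.

Lemma linear_lift_continuous h (M : lattice R h) (f : torus L -> torus M) A :
  linear_lift f A -> continuous f.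
Proof.
move=> fA; apply: torus_continuousP.
rewrite (_ : _ \o _ = torus_pi M \o (fun z => z *m A)); last by apply/funext => z; exact: fA.
move=> z; apply: continuous_comp; first exact: mulmx_continuous.
exact: torus_pi_continuous.
Qed.

Lemma torus_automorphism_lift (f : torus L -> torus L) :
  torus_automorphism f -> exists (f' : torus L -> torus L) (A B : 'M[C]_g),
    [/\ linear_lift f A, linear_lift f' B, A *m B = 1%:M & B *m A = 1%:M].
Proof.
move=> [fD [fh [f' [fK f'K f'h]]]].
have f'D : {morph f' : x y / x + y}.
  by move=> x y; apply: (can_inj fK); rewrite fD !f'K.
have [A fA] := linear_lift_ex fD fh; have [B fB] := linear_lift_ex f'D f'h.
exists f', A, B; split=> //.
  have ff : f' \o f = id by apply/funext => x; exact: fK.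
  have := linear_lift_comp fA fB; rewrite ff => h.
  exact: linear_lift_inj h linear_lift_id.
have ff : f \o f' = id by apply/funext => x; exact: f'K.
have := linear_lift_comp fB fA; rewrite ff => h.
exact: linear_lift_inj h linear_lift_id.
Qed.

Lemma torus_automorphism_linear (f f' : torus L -> torus L) A B :
  linear_lift f A -> linear_lift f' B -> A *m B = 1%:M -> B *m A = 1%:M ->
  torus_automorphism f.
Proof.
move=> fA fB AB BA; split; first exact: linear_liftD fA.
split; first exact: linear_lift_holomorphic fA.
exists f'; split; last exact: linear_lift_holomorphic fB.
  move=> x; have [z ->] := torus_pi_surj x.
  by rewrite fA fB -mulmxA AB mulmx1.
move=> x; have [z ->] := torus_pi_surj x.
by rewrite fB fA -mulmxA BA mulmx1.
Qed.

End Torus.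
End LinearMaps.

(** * The image of an endomorphism *)

Section Quotient.
Context {R : realType} {g : nat}.
Local Notation C := R[i].

Lemma rowsub_supp_int (m : nat) (W : 'M[int]_m) (I : {set 'I_m}) (n : 'rV[int]_m) :
  (forall j, j \notin I -> n ord0 j = 0) ->
  n *m W = (\row_k n ord0 (enum_val k)) *m rowsub (enum_val : 'I_#|I| -> 'I_m) W.
Proof.
move=> n0; apply/rowP => j; rewrite !mxE.
rewrite (bigID (mem I)) /= [X in _ + X]big1 ?addr0; last first.
  by move=> i /n0 ->; rewrite mul0r.
rewrite big_enum_val /=.
by apply: eq_bigr => k _; rewrite !mxE.
Qed.

Variables (L : lattice R g) (N : 'M[int]_(g + g)) (T : 'M[C]_g).
Hypothesis PT : periods L *m T = map_mx intr N *m periods L.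
Let h := \rank T.
Let E : 'M[C]_(h, g) := row_base T.
Let S : 'M[C]_(g, h) := col_base T.
Let pS := pinvmx S.

Lemma image_baseE : S *m E = T. Proof. exact: mulmx_base. Qed.

Lemma image_base_free : row_free E. Proof. exact: row_base_free. Qed.

Lemma image_base_pinv : pS *m S = 1%:M.
Proof.
apply: mulVpmx; exact: col_base_full.
Qed.

(* The Smith normal form N = U D W provides the basis: the rows of W with a
   nonzero elementary divisor span the integral vectors of the row space of N.
   There are 2 rank T of them because they are R-free in C^(rank T) and contain
   the image of the lattice in their span. *)
Lemma image_lattice_basis : exists K : 'M[C]_(h + h, h),
  realify K \in unitmx /\
  forall y : 'rV[C]_h, lattice_set L (y *m E) <->
    exists n : 'rV[int]_(h + h), y = map_mx intr n *m K.
Proof.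
have [U Uu [W Wu [d _ NE]]] := int_Smith_normal_form N.
set D := \matrix_(i, j) _ in NE.
pose I : {set _} := [set i : 'I_(g + g) | d`_i != 0]%SET.
pose ev (k : 'I_#|I|) : 'I_(g + g) := enum_val k.
pose WI := rowsub ev W.
(* Since [Q *m E = U^-1 P T = U^-1 N P = D W P], where [P] is the period matrix, the row [ev k] of
   [Q *m E] is a lattice vector multiplied by an elementary divisor; [K] divides this divisor
   out. *)
pose Q := map_mx intr (invmx U) *m periods L *m S.
pose K : 'M[C]_(#|I|, h) := \matrix_k ((d`_(ev k))%:~R^-1 *: row (ev k) Q).
have KE : K *m E = map_mx intr WI *m periods L.
  apply/row_matrixP => k; rewrite row_mul rowK -scalemxAl -row_mul.
  have dk : d`_(ev k) != 0 by have := @enum_valP _ (mem I) k; rewrite inE.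
  have dk' : ((d`_(ev k))%:~R : C) != 0 by rewrite intr_eq0.
  apply: (scalerI dk'); rewrite scalerA mulfV// scale1r.
  rewrite /Q -(mulmxA _ S E) image_baseE -(mulmxA _ _ T) PT mulmxA -map_mxM.
  rewrite NE !mulmxA mulVmx// mul1mx.
  rewrite row_mul -map_row row_mul map_mxM.
  have -> : row (ev k) D = d`_(ev k) *: delta_mx 0 (ev k).
    by apply/rowP => j; rewrite !mxE eqxx /= eq_sym mulr_natr.
  rewrite map_mxZ map_delta_mx -!scalemxAl; congr (_ *: _).
  rewrite row_mul -rowE; congr (_ *m _).
  by apply/rowP => j; rewrite !mxE.
(* Independence over the reals, as a lattice requires: the selected rows of the invertible matrix
   [W] are independent, and so are the periods. *)
have Kfree (x : 'rV[R]_#|I|) : cplxmx x *m K = 0 -> x = 0.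
  move=> xK.
  have : cplxmx x *m (K *m E) = 0 by rewrite mulmxA xK mul0mx.
  rewrite KE -cplxmx_int mulmxA -cplxmxM -(mul0mx _ (periods L)).
  rewrite -[0 in RHS](map_mx0 (real_complex R)).
  move=> /cplxmx_periods_inj xWI.
  have := congr1 (mulmx^~ (map_mx intr (invmx W))) xWI.
  rewrite mul0mx -mulmxA -map_mxM /WI.
  have -> : rowsub ev W *m invmx W = rowsub ev 1%:M.
    by rewrite mul_rowsub_mx mulmxV.
  move=> /rowP xW; apply/rowP => k; have := xW (ev k); rewrite !mxE.
  rewrite (bigD1 k)//= big1 ?addr0; last first.
    move=> l lk; rewrite !mxE (inj_eq (@enum_val_inj _ (mem I))) (negbTE lk) mulr0//.
  by rewrite !mxE eqxx mulr1.
have latE (y : 'rV[C]_h) : lattice_set L (y *m E) <->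
    exists n : 'rV[int]_#|I|, y = map_mx intr n *m K.
  split=> [[n _ nE]|[n ->]]; last first.
    rewrite -mulmxA KE mulmxA -map_mxM; eexists=> //.
  (* The vector [y *m pS] is a preimage of [y] under [S]. Its coordinates [x] are only real, but
     [x N = n] is integral, and [n W^-1 = x U D] vanishes at the indices whose elementary divisor is
     0. *)
  pose x := rcoord L (y *m pS).
  have nx : map_mx intr n = x *m map_mx intr N.
    apply: (@cplxmx_periods_inj _ _ L).
    rewrite cplxmx_int nE cplxmxM -mulmxA cplxmx_int -PT mulmxA.
    have -> : cplxmx x *m periods L = y *m pS by exact: rcoordK.
    by rewrite -[in RHS]image_baseE mulmxA -(mulmxA y) image_base_pinv mulmx1.
  pose n' := n *m invmx W.
  have n'0 j : j \notin I -> n' ord0 j = 0.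
    rewrite inE negbK => /eqP dj.
    apply: (@intr_inj R).
    have : map_mx intr n' = x *m map_mx intr U *m map_mx intr D :> 'rV[R]_(g + g).
      have NW : N *m invmx W = U *m D by rewrite NE mulmxK.
      rewrite /n' map_mxM nx -[LHS]mulmxA -[in LHS]map_mxM NW map_mxM mulmxA.
      by [].
    move=> /rowP /(_ j); rewrite mxE => ->.
    rewrite mxE big1// => i _; rewrite !mxE.
    by case: eqP => [->|]; rewrite ?dj ?mul0rn ?mulr0n mulr0.
  exists (\row_k n' ord0 (ev k)).
  apply: (row_free_inj image_base_free); rewrite -nE -mulmxA KE [RHS]mulmxA -map_mxM.
  by rewrite -rowsub_supp_int// mulmxKV.
have hr : #|I| = (h + h)%N.
  have free : row_free (realify K).
    apply/inj_row_free => x; rewrite -realifyM => xK.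
    by apply: Kfree; apply: realify_inj; rewrite xK realify0.
  have full : row_full (realify K).
    rewrite -sub1mx; apply/row_subP => i.
    have [y yE] := realify_surj (row i (1%:M : 'M[R]_(h + h))); rewrite -yE {yE}.
    have [N' N'E] : exists N' : 'M[int]_(g + g, #|I|),
        periods L *m S = map_mx intr N' *m K.
      have hrow j : exists n : 'rV[int]_#|I|, row j (periods L *m S) = map_mx intr n *m K.
        apply/latE; rewrite row_mul -mulmxA image_baseE -row_mul PT row_mul.
        by exists (row j N); rewrite // map_row.
      pose F j := xget 0 [set n | row j (periods L *m S) = map_mx intr n *m K].
      have hF j : row j (periods L *m S) = map_mx intr (F j) *m K.
        by rewrite /F; case: xgetP => [n _ //|]; case: (hrow j) => n nE /(_ n).
      exists (\matrix_i F i); apply/row_matrixP => k.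
      rewrite hF row_mul; congr (_ *m _).
      by apply/rowP => j; rewrite !mxE.
    have -> : y = cplxmx (rcoord L (y *m pS) *m map_mx intr N') *m K.
      rewrite cplxmxM cplxmx_int -mulmxA -N'E mulmxA -/(of_rcoord L _) rcoordK.
      by rewrite -mulmxA image_base_pinv mulmx1.
    by rewrite realifyM submxMl.
  by move: free full; rewrite /row_free /row_full => /eqP -> /eqP.
move: K hr Kfree latE {KE} => K; move: #|I| K => r K hr; subst r => Kfree latE.
exists K; split=> //; rewrite -row_free_unit; apply/inj_row_free => x.
rewrite -realifyM => xK.
by apply: Kfree; apply: realify_inj; rewrite xK realify0.
Qed.

End Quotient.

(** * Restriction of commuting endomorphisms to the image *)

Section ImageConjugation.
Variables (F : fieldType) (g h : nat) (T : 'M[F]_g).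
Variables (S : 'M[F]_(g, h)) (E : 'M[F]_(h, g)) (pS : 'M[F]_(h, g)).
Hypotheses (SE : S *m E = T) (pSS : pS *m S = 1%:M) (Efree : row_free E).
Implicit Types X Y : 'M[F]_g.

(** If [X] commutes with [T], this is the matrix of the restriction of [X] to the image of [T], in
    the base of the image given by the rows of [E]. *)
Definition image_conj X : 'M[F]_h := pS *m X *m S.

Lemma image_conjE X : T *m X = X *m T -> image_conj X *m E = E *m X.
Proof.
move=> TX; rewrite /image_conj -(mulmxA _ S) SE -(mulmxA _ X) -TX -SE.
by rewrite !mulmxA pSS mul1mx.
Qed.

Lemma image_conjS X : T *m X = X *m T -> S *m image_conj X = X *m S.
Proof.
move=> TX; apply: (row_free_inj Efree).
by rewrite -(mulmxA S) (image_conjE TX) mulmxA SE -(mulmxA X) SE.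
Qed.

Lemma image_conjM X Y : T *m X = X *m T -> T *m Y = Y *m T ->
  X *m Y = 1%:M -> image_conj X *m image_conj Y = 1%:M.
Proof.
move=> TX TY XY; apply: (row_free_inj Efree).
rewrite -mulmxA (image_conjE TY) mulmxA (image_conjE TX).
by rewrite -mulmxA XY mulmx1 mul1mx.
Qed.

End ImageConjugation.

(** * The image as a projective factor of the dynamics *)

Section SemiConjugate.
Context {R : realType}.
Local Notation C := R[i].

(** The projective embedding is composed with the homomorphism of lift [E]. The composite stays
    injective because [M] is the full preimage of [L], and an immersion because [E] is row free. *)
Lemma abelian_variety_linear g h (M : lattice R h) (L : lattice R g)
    (E : 'M[C]_(h, g)) : row_free E ->
  (forall y, lattice_set M y <-> lattice_set L (y *m E)) ->
  abelian_variety L -> abelian_variety M.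
Proof.
move=> Efree ME [n [phi [phi0 phi_inj phi_loc]]].
have iE : linear_lift (torus_map (L := M) L E) E.
  by apply: torus_mapP => z /ME.
exists n, (phi \o torus_map (L := M) L E); split=> [x|x y /phi_inj|z] /=.
- exact: phi0.
- have [v ->] := torus_pi_surj x; have [w ->] := torus_pi_surj y.
  by rewrite !iE !torus_piP -mulmxBl ME.
have [s [s_near s_imm]] := phi_loc (z *m E).
have cE : (fun w : 'rV[C]_h => w *m E) w @[w --> z] --> z *m E.
  exact: mulmx_continuous.
have s_near' := cE _ s_near.
exists (s \o (fun w => w *m E)); split.
  apply: (@filterS _ (nbhs z) (nbhs_filter z) _ _ _ s_near') => w /= [ds es].
  split; last by rewrite iE.
  by apply: differentiable_comp; [exact: mulmx_differentiable|exact: ds].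
move=> v.
have [dsz _] := nbhs_singleton s_near.
rewrite diff_comp; [|exact: mulmx_differentiable|exact: dsz].
rewrite [X in (X <= _)%MS]/= diff_mulmx => /s_imm vE.
by apply: (row_free_inj Efree); rewrite vE mul0mx.
Qed.

Context {g : nat} (L : lattice R g).

(** The factorization [T = S *m E] splits the endomorphism into a surjection of [X] onto its image,
    which is the semi-conjugacy, and an inclusion. The dimension of the image is positive because
    [N], hence [T], is nonzero; it is less than [g] because a real vector killed by [N] is the
    coordinate vector of a vector killed by [T]. *)
Lemma semi_conjugate_of_singular (f f' : torus L -> torus L) (A B T : 'M[C]_g)
    (N : 'M[int]_(g + g)) :
  abelian_variety L -> linear_lift f A -> linear_lift f' B ->
  A *m B = 1%:M -> B *m A = 1%:M ->
  periods L *m T = map_mx intr N *m periods L -> T *m A = A *m T ->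
  N != 0 -> \det N = 0 -> semi_conjugate_smaller f.
Proof.
move=> avL fA fB AB BA PT TA N0 detN.
have TB : T *m B = B *m T.
  have -> : B *m T = B *m (T *m A *m B) by rewrite -(mulmxA T) AB mulmx1.
  by rewrite TA !mulmxA BA mul1mx.
have [h [S [E [pS [SE Efree pSS [hT [K [Ku latK]]]]]]]] :
    exists h (S : 'M[C]_(g, h)) (E : 'M[C]_(h, g)) (pS : 'M[C]_(h, g)),
    [/\ S *m E = T, row_free E, pS *m S = 1%:M & h = \rank T /\
      exists K : 'M[C]_(h + h, h), realify K \in unitmx /\
        forall y : 'rV[C]_h, lattice_set L (y *m E) <->
          exists n : 'rV[int]_(h + h), y = map_mx intr n *m K].
  exists (\rank T), (col_base T), (row_base T), (pinvmx (col_base T)).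
  split; [exact: image_baseE|exact: image_base_free|exact: image_base_pinv|].
  by split=> //; exact: image_lattice_basis PT.
pose M := @Lattice R h K Ku.
have latM y : lattice_set M y <-> lattice_set L (y *m E).
  rewrite latK; split=> [[n _ <-]|[n ->]]; by exists n.
have cE := image_conjE SE pSS; have cS := image_conjS SE pSS Efree.
have cM := image_conjM SE pSS Efree; set conj := image_conj S pS in cE cS cM.
have lift_conj (k : torus L -> torus L) X : linear_lift k X -> T *m X = X *m T ->
    linear_lift (torus_map (L := M) M (conj X)) (conj X).
  move=> kX TX; apply: torus_mapP => y /latM yE; apply/latM.
  by rewrite -(mulmxA y) (cE _ TX) mulmxA; exact: linear_lift_lattice kX yE.
have pS_lift : linear_lift (torus_map (L := L) M S) S.
  apply: torus_mapP => z [n _ <-]; apply/latM.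
  rewrite -!mulmxA SE PT mulmxA -map_mxM.
  by exists (n *m N).
have T0 : T != 0.
  apply: contraNneq N0 => T0; apply/eqP; apply: (@intmx_periods_inj _ _ L).
  by rewrite -PT T0 mulmx0 map_mx0 mul0mx.
have hg : (h < g)%N.
  rewrite hT ltn_neqAle rank_leq_row andbT; apply/negP => Tfree.
  have /eqP/det0P[x x0 xN] : \det (map_mx intr N : 'M[R]_(g + g)) = 0.
    by rewrite det_map_mx detN.
  have : of_rcoord L x *m T = 0.
    rewrite /of_rcoord -mulmxA PT mulmxA -cplxmx_int -cplxmxM xN.
    exact: of_rcoord0.
  rewrite -(mul0mx _ T) => /(row_free_inj Tfree).
  by rewrite -(of_rcoord0 L) => /of_rcoord_inj x0'; rewrite x0' eqxx in x0.
exists h, M, (torus_map (L := M) M (conj A)), (torus_map (L := L) M S); split.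
- by rewrite hg andbT hT lt0n mxrank_eq0.
- exact: abelian_variety_linear Efree latM avL.
- apply: torus_automorphism_linear (lift_conj _ _ fA TA) (lift_conj _ _ fB TB) _ _;
    exact: cM.
split.
- exact: linear_lift_holomorphic pS_lift.
- move=> y; have [w ->] := torus_pi_surj y.
  by exists (torus_pi L (w *m pS)); rewrite pS_lift -mulmxA pSS mulmx1.
apply/funext => x; have [z ->] := torus_pi_surj x.
by rewrite /= fA !pS_lift (lift_conj _ _ fA TA) -!mulmxA (cS _ TA).
Qed.

End SemiConjugate.

(** * Diagonalizability *)

Section HornerMatrix.

Lemma horner_mx_intertwine (F : comNzRingType) m n (P : 'M[F]_(m.+1, n.+1))
    (A : 'M[F]_n.+1) (B : 'M[F]_m.+1) (q : {poly F}) :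
  P *m A = B *m P -> P *m horner_mx A q = horner_mx B q *m P.
Proof.
move=> PA; elim/poly_ind: q => [|q c IH]; first by rewrite !rmorph0 mulmx0 mul0mx.
rewrite !rmorphD !rmorphM /= !horner_mx_X !horner_mx_C mulmxDr mulmxDl -!mulmxE.
by rewrite mulmxA IH -(mulmxA _ P) PA mulmxA scalar_mxC.
Qed.

Variables (n : nat) (B : 'M[int]_n.+1).
Hypothesis irrB : forall q : {poly int},
  horner_mx B q = 0 \/ \det (horner_mx B q) != 0.
Let BQ : 'M[rat]_n.+1 := map_mx intr B.

(** Clearing denominators reduces to integral coefficients. *)
Lemma horner_rat_mx_eq0_or_unit (q : {poly rat}) :
  horner_mx BQ q = 0 \/ horner_mx BQ q \in unitmx.
Proof.
have [p [a a0 ->]] := rat_poly_scale q.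
rewrite linearZ /= -map_horner_mx.
have [->|detp] := irrB p; first by left; rewrite map_mx0 scaler0.
right; rewrite unitmxZ ?unitrV ?unitfE ?intr_eq0//.
by rewrite unitmxE det_map_mx unitfE intr_eq0.
Qed.

(* The gcd of m and m' is singular at the matrix, as its cofactor in m does not
   vanish there; hence it vanishes and m divides m'. *)
Lemma coprime_mxminpoly_deriv :
  coprimep (mxminpoly BQ) (mxminpoly BQ)^`().
Proof.
set m := mxminpoly BQ; set d := gcdp m m^`().
have m0 : m != 0 by rewrite monic_neq0// mxminpoly_monic.
have mS : (1 < size m)%N by rewrite size_mxminpoly ltnS mxminpoly_nonconstant.
have m'0 : m^`() != 0.
  apply/eqP => /(congr1 (fun p : {poly rat} => p`_(size m).-2)).
  have ms : (size m).-2.+1 = (size m).-1 by case: (size m) mS => [|[]].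
  have := mxminpoly_monic BQ; rewrite monicE /lead_coef -/m => /eqP m1.
  by rewrite coef_deriv coef0 ms m1 => /eqP; rewrite pnatr_eq0 -ms.
have md : m %/ d * d = m by rewrite divpK// dvdp_gcdl.
rewrite /coprimep -/d; apply/negPn/negP => d1.
have d0 : d != 0 by rewrite gcdp_eq0 negb_and m0.
have dS : (1 < size d)%N.
  by rewrite ltn_neqAle eq_sym d1 lt0n size_poly_eq0.
have [dB|dU] := horner_rat_mx_eq0_or_unit d.
  have : m %| m^`() by apply: dvdp_trans (mxminpoly_min dB) (dvdp_gcdr _ _).
  move=> /(dvdp_leq m'0); rewrite leqNgt => /negP; apply.
  exact: lt_size_deriv.
have : horner_mx BQ (m %/ d) = 0.
  have : horner_mx BQ (m %/ d) *m horner_mx BQ d = 0.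
    by rewrite mulmxE -rmorphM md; exact: mx_root_minpoly.
  by move=> /(congr1 (mulmx^~ (invmx (horner_mx BQ d)))); rewrite mulmxK// mul0mx.
move=> /mxminpoly_min; rewrite -/m => /dvdp_leq.
have e0 : m %/ d != 0 by rewrite divp_eq0 negb_or m0 negb_or d0 -leqNgt dvdp_leq// dvdp_gcdl.
move=> /(_ e0); rewrite size_divp// leqNgt => /negP; apply.
by rewrite ltn_subrL -[(size d).-1]subn1 subn_gt0 dS (ltn_trans _ mS).
Qed.

End HornerMatrix.

Section DiagonalizableLift.
Context {R : realType} {g : nat} (L : lattice R g.+1).
Local Notation C := R[i].

(** The minimal polynomial of [B] over the rationals is separable, and remains so over the complex
    numbers. It annihilates [A] because [periods L] intertwines [A] with [B] and can be cancelled.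
    The minimal polynomial of [A] divides it, hence has simple roots. *)
Lemma diagonalizable_lift (A : 'M[C]_g.+1) (B : 'M[int]_(g.+1 + g.+1)) :
  periods L *m A = map_mx intr B *m periods L ->
  (forall q : {poly int}, @horner_mx _ (g + g.+1) B q = 0 \/
    \det (@horner_mx _ (g + g.+1) B q) != 0) ->
  exists U (d : 'rV[C]_g.+1), U \in unitmx /\ U *m A = diag_mx d *m U.
Proof.
move=> PA irrB; have := coprime_mxminpoly_deriv irrB; set m := mxminpoly _ => mm'.
pose mC := map_poly (ratr : rat -> C) m.
have mm'C : separable_poly mC by rewrite /mC separable_map separable_poly.unlock.
have mA : horner_mx A mC = 0.
  apply: (@periods_mul_eq0 _ _ L).
  rewrite (@horner_mx_intertwine _ (g + g.+1) g _ _ (map_mx intr B))//.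
  have -> : map_mx intr B = map_mx (ratr : rat -> C) (map_mx intr B).
    by apply/matrixP => i j; rewrite !mxE rmorph_int.
  rewrite -map_horner_mx mx_root_minpoly map_mx0 mul0mx//.
have [r mr] := closed_field_poly_normal mC.
have mC0 : lead_coef mC != 0.
  by rewrite lead_coef_eq0 map_poly_eq0 monic_neq0// mxminpoly_monic.
have : exists2 rs : seq C, uniq rs & mxminpoly A %| \prod_(x <- rs) ('X - x%:P).
  exists r.
    rewrite -separable_prod_XsubC; apply: dvdp_separable mm'C.
    by rewrite mr dvdpZr.
  rewrite -(dvdpZr _ _ mC0) -mr; exact: mxminpoly_min.
move=> /mxpoly.diagonalizableP[U Uu /diagonalizable_forPex[d /(simmxRL Uu) UA]].
by exists U, d; split=> //; rewrite UA mulmxKV.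
Qed.

End DiagonalizableLift.

(** * Entropy of maps of finite order *)

Section PeriodicEntropy.
Context {R : realType} {T : topologicalType}.
Variables (f : T -> T) (d : nat).
Hypotheses (d_gt0 : (0 < d)%N) (fd : forall x, iter d f x = x).

Lemma iter_modn n x : iter n f x = iter (n %% d) f x.
Proof.
rewrite [in LHS](divn_eq n d) iterD; elim: (n %/ d)%N => // k IH.
by rewrite mulSn iterD fd.
Qed.

(** A set of the join of length [d] is also one of length [n], by repeating its conditions modulo
    [d]. Conversely, keeping only the first [d] conditions of a set of the join of length [n]
    enlarges it, so subcovers remain subcovers with the same number of sets. *)
Lemma cover_number_periodic (U : set (set T)) n : (d <= n)%N ->
  cover_number (R := R) (iter_join f U n) = cover_number (iter_join f U d).
Proof.
move=> dn; rewrite /cover_number; congr inf; congr image; apply/seteqP.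
split=> k [B [BU Bcov]]; last first.
  exists B; split=> // i; have [D [DU ->]] := BU i.
  exists (fun j : 'I_n => D (Ordinal (ltn_pmod j d_gt0))); split=> //.
  apply/seteqP; split=> x h j _ /=.
    by rewrite iter_modn; exact: (h (Ordinal (ltn_pmod j d_gt0))).
  have /= := h (widen_ord dn j) I.
  by rewrite (_ : Ordinal _ = j)//; apply: val_inj; rewrite /= modn_small.
have /choice[D hD] : forall i, exists D : 'I_n -> set T, (forall j, U (D j)) /\
    B i = \bigcap_(j in [set: 'I_n]) (iter j f @^-1` D j).
  by move=> i; have [D hD] := BU i; exists D.
exists (fun i => \bigcap_(j in [set: 'I_d]) (iter j f @^-1` D i (widen_ord dn j))).
split=> [i|].
  exists (fun j => D i (widen_ord dn j)); split=> // j.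
  exact: (hD i).1.
rewrite -subTset -Bcov => x [i _]; rewrite (hD i).2 => hx; exists i => // j _.
exact: hx.
Qed.

(** The numerator in the entropy of a cover is constant from [d] on, and is divided by [n]. *)
Lemma topological_entropy_periodic : (topological_entropy R f <= 0)%E.
Proof.
apply: ge_ereal_sup => _ [U _ <-]; rewrite /cover_entropy.
set u := (fun n => _).
suff /cvg_limn_einf_sup[_ ->] : u n @[n --> \oo] --> 0%E by [].
set c := ln (cover_number (R := R) (iter_join f U d)).
have : (c / n%:R)%:E @[n --> \oo] --> 0%E.
  apply: cvg_EFin; first exact: nearW.
  rewrite -[0](mulr0 c); apply: cvgMr.
  by rewrite -cvg_shiftS; exact: cvg_harmonic.
apply: cvg_trans; apply: near_eq_cvg; near=> n.
by rewrite /u cover_number_periodic//; near: n; exact: nbhs_infty_ge.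
Unshelve. all: by end_near. Qed.

End PeriodicEntropy.

(** * Approximation of bounded measurable functions *)

Section RealSequences.
Context {R : realType}.
Implicit Types (x y : R) (n : nat).

Lemma bernoulli_ge y n : 0 <= y -> 1 + n%:R * y <= (1 + y) ^+ n.
Proof.
move=> y0; elim: n => [|n IH]; first by rewrite mul0r addr0 expr0.
rewrite exprS; apply: le_trans (ler_wpM2l _ IH); last by rewrite addr_ge0.
rewrite -natr1; have : 0 <= n%:R * (y * y) by rewrite mulr_ge0// mulr_ge0.
lra.
Qed.

Lemma bernoulli_le y n : 0 <= y <= 1 -> 1 - n%:R * y <= (1 - y) ^+ n.
Proof.
move=> /andP[y0 y1]; elim: n => [|n IH]; first by rewrite mul0r subr0 expr0.
rewrite exprS; apply: le_trans (ler_wpM2l _ IH); last by rewrite subr_ge0.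
rewrite -natr1; have : 0 <= n%:R * (y * y) by rewrite mulr_ge0// mulr_ge0.
lra.
Qed.

(** The product of [(1 - y)^n] and [(1 + y)^n] is [(1 - y^2)^n], which is at most 1; the second
    factor is bounded below by Bernoulli. *)
Lemma expr_onem_le y n : 0 <= y <= 1 -> (1 - y) ^+ n <= (1 + n%:R * y)^-1.
Proof.
move=> /andP[y0 y1].
have b0 : 0 < 1 + n%:R * y by rewrite ltr_wpDr// mulr_ge0.
rewrite -[leRHS]mul1r ler_pdivlMr//.
apply: le_trans (ler_wpM2l _ (bernoulli_ge n y0)) _.
  by rewrite exprn_ge0// subr_ge0.
rewrite -exprMn exprn_ile1//; last by nra.
by rewrite mulr_ge0 ?subr_ge0// addr_ge0.
Qed.

(** With [x = t^2], the product of [n] and [t^n] is at most [1/(1 - t)], and a factor [t^n]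
    remains. *)
Lemma cvg_natr_expr x : 0 <= x < 1 -> n%:R * x ^+ n @[n --> \oo] --> (0 : R).
Proof.
move=> /andP[x0 x1]; pose t := Num.sqrt x.
have t0 : 0 <= t := sqrtr_ge0 x.
have t1 : t < 1 by rewrite -sqrtr1 ltr_sqrt.
have tx : x = t * t by rewrite -expr2 sqr_sqrtr.
have ct : (1 - t)^-1 * t ^+ n @[n --> \oo] --> (0 : R).
  rewrite -[X in _ --> X](mulr0 (1 - t)^-1); apply: cvgMr; apply: cvg_expr.
  by rewrite ger0_norm.
apply: (@squeeze_cvgr _ _ _ _ (fun=> 0) (fun n => (1 - t)^-1 * t ^+ n)) => //;
  last exact: cvg_cst.
apply: nearW => n; apply/andP; split; first by rewrite mulr_ge0 ?exprn_ge0.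
rewrite tx exprMn mulrA ler_wpM2r ?exprn_ge0//.
have u0 : 0 < 1 - t by rewrite subr_gt0.
have d0 : 0 < 1 + n%:R * (1 - t) by rewrite ltr_wpDr// mulr_ge0// ltW.
have ht : t ^+ n <= (1 + n%:R * (1 - t))^-1.
  by have := @expr_onem_le (1 - t) n; rewrite subKr; apply; apply/andP; split; lra.
apply: (le_trans (ler_wpM2l _ ht)) => //.
rewrite ler_pdivrMr// ler_pdivlMl//; lra.
Qed.

(* (1 - x^n)^(n 2^n) tends to 0 if x >= 1/2, to 1 if 0 <= x < 1/2. *)
Definition step_approx n x : R := 1 - (1 - x ^+ n) ^+ (n * 2 ^ n).

Lemma step_approx_bound n x : 0 <= x <= 1 -> 0 <= step_approx n x <= 1.
Proof.
move=> /andP[x0 x1].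
have h0 : 0 <= 1 - x ^+ n by rewrite subr_ge0 exprn_ile1.
have h1 : 1 - x ^+ n <= 1 by rewrite gerBl exprn_ge0.
by rewrite /step_approx subr_ge0 exprn_ile1//= gerBl exprn_ge0.
Qed.

(** Both Bernoulli bounds compare the exponent with [x^n] through [n (2x)^n], which is at least [n]
    if [x >= 1/2] and tends to 0 if [x < 1/2]. The factor [n] in the exponent settles the threshold
    [x = 1/2]. *)
Lemma cvg_step_approx x : 0 <= x <= 1 ->
  step_approx n x @[n --> \oo] --> ((2^-1 <= x)%R%:R : R).
Proof.
move=> x01; have /andP[x0 x1] := x01.
have xn n : 0 <= x ^+ n <= 1 by rewrite exprn_ge0// exprn_ile1.
have [hx|hx] := leP 2^-1 x.
  have c0 : 1 - (1 + n%:R)^-1 @[n --> \oo] --> (1 : R).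
    rewrite -[X in _ --> X]subr0; apply: cvgB; first exact: cvg_cst.
    rewrite (_ : (fun n => _) = @harmonic R); first exact: cvg_harmonic.
    by apply/funext => n; rewrite /harmonic /= nat1r.
  apply: (@squeeze_cvgr _ _ _ _ (fun n => 1 - (1 + n%:R)^-1) (fun=> 1)) => //;
    last exact: cvg_cst.
  apply: nearW => n; apply/andP; split; last first.
    by have /andP[] := step_approx_bound n x01.
  rewrite /step_approx lerD2l lerN2; apply: le_trans (expr_onem_le _ (xn n)) _.
  rewrite lef_pV2 ?posrE ?ltr_wpDr ?mulr_ge0//; last by have /andP[] := xn n.
  rewrite lerD2l natrM -mulrA ler_peMr// natrX -exprMn exprn_ege1//; lra.
have c0 : n%:R * (2 * x) ^+ n @[n --> \oo] --> (0 : R).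
  by apply: cvg_natr_expr; apply/andP; split; lra.
apply: (@squeeze_cvgr _ _ _ _ (fun=> 0) (fun n => n%:R * (2 * x) ^+ n)) => //;
  last exact: cvg_cst.
apply: nearW => n; apply/andP; split; first by have /andP[] := step_approx_bound n x01.
rewrite exprMn mulrA -natrX -natrM /step_approx.
have := bernoulli_le (n * 2 ^ n) (xn n); lra.
Qed.

End RealSequences.

(** * The algebra of bounded measurable functions and its integral *)

Section BoundedMeasurable.
Context {d : measure_display} {T : measurableType d} {R : realType}.
Implicit Types u v : T -> R.

(** This class is stable under products and consists of integrable functions for any probability, so
    correlations of two members are always defined. *)
Definition bounded_measurable u : Prop :=
  measurable_fun [set: T] u /\ exists M, forall x, `|u x| <= M.

Lemma bmeas_cst c : bounded_measurable (fun=> c).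
Proof. by split=> //; exists `|c|. Qed.

Lemma bmeasD u v : bounded_measurable u -> bounded_measurable v ->
  bounded_measurable (fun x => u x + v x).
Proof.
move=> [mu [M uM]] [mv [N vN]]; split; first exact: measurable_funD.
by exists (M + N) => x; apply: le_trans (ler_normD _ _) _; exact: lerD.
Qed.

Lemma bmeasM u v : bounded_measurable u -> bounded_measurable v ->
  bounded_measurable (fun x => u x * v x).
Proof.
move=> [mu [M uM]] [mv [N vN]]; split; first exact: measurable_funM.
by exists (M * N) => x; rewrite normrM; exact: ler_pM.
Qed.

Lemma bmeasZ c u : bounded_measurable u -> bounded_measurable (fun x => c * u x).
Proof. by apply: bmeasM; exact: bmeas_cst. Qed.

Lemma bmeasN u : bounded_measurable u -> bounded_measurable (fun x => - u x).
Proof.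
move=> [mu [M uM]]; split; first exact: measurableT_comp.
by exists M => x; rewrite normrN.
Qed.

Lemma bmeasB u v : bounded_measurable u -> bounded_measurable v ->
  bounded_measurable (fun x => u x - v x).
Proof. by move=> bu /bmeasN; exact: bmeasD. Qed.

Lemma bmeas_norm u : bounded_measurable u -> bounded_measurable (fun x => `|u x|).
Proof.
move=> [mu [M uM]]; split; first exact: measurableT_comp.
by exists M => x; rewrite normr_id.
Qed.

Lemma bmeas_indic A : measurable A -> bounded_measurable (\1_A).
Proof.
move=> mA; split; first exact: measurable_indic.
by exists 1 => x; rewrite indicE; case: (_ \in _); rewrite ?normr0 ?normr1.
Qed.

Lemma bmeas_comp u (S : T -> T) : measurable_fun setT S ->
  bounded_measurable u -> bounded_measurable (u \o S).
Proof.
move=> mS [mu [M uM]]; split; first exact: measurableT_comp.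
by exists M => x; exact: uM.
Qed.

Lemma bmeas_sum I (r : seq I) (F : I -> T -> R) :
  (forall i, bounded_measurable (F i)) ->
  bounded_measurable (fun x => \sum_(i <- r) F i x).
Proof.
move=> bF; elim: r => [|i r IH].
  by under eq_fun do rewrite big_nil; exact: bmeas_cst.
by under eq_fun do rewrite big_cons; exact: bmeasD.
Qed.

Variable P : probability T R.
Local Notation I u := (\int[P]_x (u x)).

Lemma bmeas_integrable u : bounded_measurable u -> P.-integrable setT (EFin \o u).
Proof.
move=> [mu [M uM]]; apply: measurable_bounded_integrable => //.
  by apply: le_lt_trans (probability_le1 P measurableT) _; rewrite ltry.
exists M; split; first by rewrite num_real.
by move=> y My x _ /=; apply: le_trans (uM x) (ltW My).
Qed.

Lemma bmeas_intD u v : bounded_measurable u -> bounded_measurable v ->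
  I (fun x => u x + v x) = I u + I v.
Proof. by move=> bu bv; rewrite RintegralD//; exact: bmeas_integrable. Qed.

Lemma bmeas_intB u v : bounded_measurable u -> bounded_measurable v ->
  I (fun x => u x - v x) = I u - I v.
Proof. by move=> bu bv; rewrite RintegralB//; exact: bmeas_integrable. Qed.

Lemma bmeas_intZ c u : bounded_measurable u -> I (fun x => c * u x) = c * I u.
Proof. by move=> bu; rewrite RintegralZl//; exact: bmeas_integrable. Qed.

Lemma bmeas_int_cst c : I (fun=> c) = c.
Proof. by rewrite Rintegral_cst//= probability_setT mulr1. Qed.

Lemma bmeas_int_sum J (r : seq J) (F : J -> T -> R) :
  (forall i, bounded_measurable (F i)) ->
  I (fun x => \sum_(i <- r) F i x) = \sum_(i <- r) I (F i).
Proof.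
move=> bF; elim: r => [|i r IH].
  by rewrite big_nil; under eq_fun do rewrite big_nil; exact: bmeas_int_cst.
rewrite big_cons -IH -bmeas_intD//; last exact: bmeas_sum.
by congr (Rintegral _ _ _); apply/funext => x; rewrite big_cons.
Qed.

Lemma bmeas_int_le u v : bounded_measurable u -> bounded_measurable v ->
  (forall x, u x <= v x) -> I u <= I v.
Proof. by move=> bu bv uv; apply: le_Rintegral => //; exact: bmeas_integrable. Qed.

Lemma bmeas_int_norm u : bounded_measurable u -> `|I u| <= I (fun x => `|u x|).
Proof. by move=> bu; apply: le_normr_Rintegral => //; exact: bmeas_integrable. Qed.

Lemma bmeas_int_indic A : measurable A -> (I (\1_A : T -> R))%:E = P A.
Proof.
move=> mA; rewrite /Rintegral fineK; last first.
  by rewrite integral_indic// setIT fin_num_measure.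
by rewrite integral_indic// setIT.
Qed.

Lemma bmeas_int_cvg (u_ : nat -> T -> R) u M :
  (forall n, measurable_fun setT (u_ n)) -> (forall n x, `|u_ n x| <= M) ->
  (forall x, u_ n x @[n --> \oo] --> u x) ->
  I (u_ n) @[n --> \oo] --> I u.
Proof.
move=> mu uM ucvg.
apply: fine_cvg.
have bu : bounded_measurable u.
  split; first by apply: measurable_fun_cvg => // x _; exact: ucvg.
  exists M => x; apply: (@closed_cvg _ _ \oo _ (fun n => `|u_ n x|) (fun y => y <= M)).
  - exact: closed_le.
  - by apply: nearW => n; exact: uM.
  - by apply: cvg_norm; exact: ucvg.
rewrite fineK; last exact: integrable_fin_num (bmeas_integrable bu).
apply: (@dominated_cvg _ _ _ P setT _ (fun n => EFin \o u_ n) (EFin \o u) (cst M%:E)) => //.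
- by move=> n; exact/measurable_EFinP.
- by move=> x _; apply: cvg_EFin; [exact: nearW|exact: ucvg].
- by apply: (@bmeas_integrable (fun=> M)); exact: bmeas_cst.
- by move=> n x _ /=; rewrite lee_fin.
Qed.

End BoundedMeasurable.

(** * Approximation in mean by the members of an algebra *)

Section Approximation.
Context {d : measure_display} {T : measurableType d} {R : realType}.
Variables (P : probability T R) (S : T -> T) (mS : measurable_fun setT S).
Variable alg : set (T -> R).
Hypotheses (alg_bmeas : forall t, alg t -> bounded_measurable t)
  (alg_cst : forall c, alg (fun=> c))
  (algD : forall s t, alg s -> alg t -> alg (fun x => s x + t x))
  (algM : forall s t, alg s -> alg t -> alg (fun x => s x * t x)).
Implicit Types u v : T -> R.

(* The second term controls u o S without assuming that S preserves P: this is
   what makes it possible to deduce the invariance of P from its values on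
   trigonometric polynomials. *)
Definition seminorm u : R := \int[P]_x `|u x| + \int[P]_x `|u (S x)|.

Definition approximable u : Prop :=
  bounded_measurable u /\
  forall e, 0 < e -> exists2 t, alg t & seminorm (fun x => u x - t x) < e.

Lemma seminormD u v : bounded_measurable u -> bounded_measurable v ->
  seminorm (fun x => u x + v x) <= seminorm u + seminorm v.
Proof.
move=> bu bv; have buS := bmeas_comp mS bu; have bvS := bmeas_comp mS bv.
rewrite /seminorm addrACA; apply: lerD.
  rewrite -bmeas_intD; try exact: bmeas_norm.
  apply: bmeas_int_le; last by move=> x; exact: ler_normD.
    by apply: bmeas_norm; exact: bmeasD.
  by apply: bmeasD; exact: bmeas_norm.
rewrite -(bmeas_intD P (bmeas_norm buS) (bmeas_norm bvS)).
apply: bmeas_int_le; last by move=> x; exact: ler_normD.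
  by apply: bmeas_norm; apply: (bmeasD buS bvS).
exact: (bmeasD (bmeas_norm buS) (bmeas_norm bvS)).
Qed.

Lemma seminormM M u v : bounded_measurable u -> bounded_measurable v ->
  0 <= M -> (forall x, `|v x| <= M) -> seminorm (fun x => u x * v x) <= M * seminorm u.
Proof.
move=> bu bv M0 vM.
have buS := bmeas_comp mS bu; have bvS := bmeas_comp mS bv.
have nu := bmeas_norm bu; have nuS := bmeas_norm buS.
rewrite /seminorm mulrDr -!bmeas_intZ//; apply: lerD; apply: bmeas_int_le.
- by apply: bmeas_norm; exact: bmeasM.
- exact: bmeasZ.
- by move=> x; rewrite normrM mulrC ler_wpM2r.
- by apply: bmeas_norm; apply: (bmeasM buS bvS).
- exact: (bmeasZ _ nuS).
- by move=> x; rewrite normrM mulrC ler_wpM2r.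
Qed.

Lemma seminorm_cvg0 (u_ : nat -> T -> R) M :
  (forall n, measurable_fun setT (u_ n)) -> (forall n x, `|u_ n x| <= M) ->
  (forall x, u_ n x @[n --> \oo] --> 0) -> seminorm (u_ n) @[n --> \oo] --> 0.
Proof.
move=> mu uM u0; rewrite -(addr0 0); apply: cvgD.
  rewrite -[X in _ --> X](bmeas_int_cst P 0); apply: (@bmeas_int_cvg _ _ _ _ _ _ M).
  - by move=> n; exact: measurableT_comp.
  - by move=> n x; rewrite normr_id.
  - by move=> x; rewrite -(normr0 R); apply: cvg_norm; exact: u0.
rewrite -[X in _ --> X](bmeas_int_cst P 0).
apply: (@bmeas_int_cvg _ _ _ _ (fun n x => `|u_ n (S x)|) _ M).
- by move=> n; apply: measurableT_comp => //; exact: measurableT_comp.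
- by move=> n x; rewrite normr_id.
- by move=> x; rewrite -(normr0 R); apply: cvg_norm; exact: u0.
Qed.

Lemma approx_alg t : alg t -> approximable t.
Proof.
move=> at_; split; first exact: alg_bmeas.
move=> e e0; exists t => //; rewrite /seminorm.
have h : (fun x => `|t x - t x|) = fun=> 0 :> R.
  by apply/funext => x; rewrite subrr normr0.
have hS : (fun x => `|t (S x) - t (S x)|) = fun=> 0 :> R.
  by apply/funext => x; rewrite subrr normr0.
by rewrite h hS bmeas_int_cst addr0.
Qed.

Lemma approxD u v : approximable u -> approximable v ->
  approximable (fun x => u x + v x).
Proof.
move=> [bu au] [bv av]; split; first exact: bmeasD.
move=> e e0; have e2 : 0 < e / 2 by rewrite divr_gt0.
have [s as_ hs] := au _ e2; have [t at_ ht] := av _ e2.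
exists (fun x => s x + t x); first exact: algD.
rewrite (splitr e); apply: le_lt_trans (ltrD hs ht).
have -> : (fun x => u x + v x - (s x + t x)) =
          (fun x => (u x - s x) + (v x - t x)).
  by apply/funext => x; rewrite opprD addrACA.
by apply: seminormD; apply: bmeasB => //; exact: alg_bmeas.
Qed.

Lemma approxM u v : approximable u -> approximable v ->
  approximable (fun x => u x * v x).
Proof.
move=> [bu au] [bv av]; split; first exact: bmeasM.
move=> e e0; have [_ [M vM]] := bv.
have pos (x : R) : 0 < `|x| + 1 by rewrite ltr_wpDl.
have eM : 0 < e / 2 / (`|M| + 1) by rewrite !divr_gt0.
have [s as_ hs] := au _ eM; have bs := alg_bmeas as_.
have [_ [N sN]] := bs.
(* The tolerance for [v] depends on the bound [N] of [s], so [t] is chosen after [s]. *)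
have eN : 0 < e / 2 / (`|N| + 1) by rewrite !divr_gt0.
have [t at_ ht] := av _ eN; have bt := alg_bmeas at_.
exists (fun x => s x * t x); first exact: algM.
have -> : (fun x => u x * v x - s x * t x) =
          (fun x => (u x - s x) * v x + (v x - t x) * s x).
  by apply/funext => x; ring.
have bus := bmeasB bu bs; have bvt := bmeasB bv bt.
apply: le_lt_trans (seminormD (bmeasM bus bv) (bmeasM bvt bs)) _.
rewrite (splitr e); apply: ltrD.
  apply: (@le_lt_trans _ _ ((`|M| + 1) * seminorm (fun x => u x - s x))).
    apply: seminormM => // x.
    by apply: le_trans (vM x) _; rewrite (le_trans (ler_norm _))// lerDl.
  by rewrite mulrC -ltr_pdivlMr.
apply: (@le_lt_trans _ _ ((`|N| + 1) * seminorm (fun x => v x - t x))).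
  apply: seminormM => // x.
  by apply: le_trans (sN x) _; rewrite (le_trans (ler_norm _))// lerDl.
by rewrite mulrC -ltr_pdivlMr.
Qed.

Lemma approxB u v : approximable u -> approximable v ->
  approximable (fun x => u x - v x).
Proof.
move=> au av; under eq_fun do rewrite -mulN1r.
by apply: approxD => //; apply: approxM => //; exact: approx_alg.
Qed.

Lemma approx_sum I (r : seq I) (F : I -> T -> R) :
  (forall i, approximable (F i)) -> approximable (fun x => \sum_(i <- r) F i x).
Proof.
move=> aF; elim: r => [|i r IH].
  by under eq_fun do rewrite big_nil; exact: approx_alg.
by under eq_fun do rewrite big_cons; exact: approxD.
Qed.

Lemma approx_prod I (r : seq I) (F : I -> T -> R) :
  (forall i, approximable (F i)) -> approximable (fun x => \prod_(i <- r) F i x).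
Proof.
move=> aF; elim: r => [|i r IH].
  by under eq_fun do rewrite big_nil; exact: approx_alg.
by under eq_fun do rewrite big_cons; exact: approxM.
Qed.

Lemma approxX u n : approximable u -> approximable (fun x => u x ^+ n).
Proof.
move=> au; elim: n => [|n IH]; first by under eq_fun do rewrite expr0; exact: approx_alg.
by under eq_fun do rewrite exprS; exact: approxM.
Qed.

(** Dominated convergence applies to both terms of the seminorm, with the constant [M + M] as the
    dominating function. *)
Lemma approx_lim (u_ : nat -> T -> R) u M :
  (forall n, approximable (u_ n)) -> (forall n x, `|u_ n x| <= M) ->
  (forall x, u_ n x @[n --> \oo] --> u x) -> approximable u.
Proof.
move=> au uM ucvg.
have mu n : measurable_fun setT (u_ n) by have [[]] := au n.
have uM' x : `|u x| <= M.
  apply: (@closed_cvg _ _ \oo _ (fun n => `|u_ n x|) (fun y => y <= M)).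
  - exact: closed_le.
  - by apply: nearW => n; exact: uM.
  - by apply: cvg_norm; exact: ucvg.
have mlim : measurable_fun setT u by apply: measurable_fun_cvg => // x _; exact: ucvg.
split; first by split=> //; exists M.
move=> e e0; have e2 : 0 < e / 2 by rewrite divr_gt0.
have : seminorm (fun x => u x - u_ n x) @[n --> \oo] --> 0.
  apply: (@seminorm_cvg0 (fun n x => u x - u_ n x) (M + M)).
  - by move=> n; exact: measurable_funB.
  - by move=> n x; apply: le_trans (ler_normB _ _) _; exact: lerD.
  - by move=> x; rewrite -(subrr (u x)); apply: cvgB => //; exact: cvg_cst.
move=> /cvgrPdist_lt /(_ _ e2)[n _ /(_ n (leqnn n))] /=.
rewrite sub0r normrN => hn.
have [bun /(_ _ e2)[t at_ ht]] := au n; exists t => //.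
have -> : (fun x => u x - t x) = (fun x => (u x - u_ n x) + (u_ n x - t x)).
  by apply/funext => x; rewrite subrKA.
have bu : bounded_measurable u by split=> //; exists M.
apply: le_lt_trans (seminormD (bmeasB bu bun) (bmeasB bun (alg_bmeas at_))) _.
rewrite (splitr e); apply: ltrD => //.
exact: le_lt_trans (ler_norm _) hn.
Qed.

Definition approx_set (A : set T) : Prop := measurable A /\ approximable (\1_A).

(** The affine function [o] of [s] takes values in [[0, 1]] and equals 1/2 where [s = c]; composing
    it with the polynomials [step_approx n], whose limit jumps at 1/2, gives the indicator. The
    constant [D] is at least twice the oscillation of [s] around [c]. *)
Lemma approx_set_ge s c : alg s -> approx_set [set x | c <= s x].
Proof.
move=> as_; have bs := alg_bmeas as_; have [ms [M sM]] := bs.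
have mA : measurable [set x | c <= s x].
  rewrite [X in measurable X](_ : _ = s @^-1` `[c, +oo[%classic).
    by rewrite -[X in measurable X]setTI; apply: ms => //; exact: measurable_itv.
  by apply/seteqP; split=> x /=; rewrite in_itv/= andbT.
split=> //; pose D := 2 * (`|M| + `|c| + 1).
have D0 : 0 < D by rewrite mulr_gt0// ltr_wpDl// addr_ge0.
pose o x := 2^-1 + D^-1 * (s x - c).
have ao : alg o.
  have -> : o = (fun x => (2^-1 - D^-1 * c) + D^-1 * s x).
    by apply/funext => x; rewrite /o; ring.
  by apply: algD => //; exact: algM.
have o01 x : 0 <= o x <= 1.
  have : `|D^-1 * (s x - c)| <= 2^-1.
    rewrite normrM gtr0_norm ?invr_gt0// ler_pdivrMl// /D.
    have h := le_trans (sM x) (ler_norm M).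
    have := ler_normB (s x) c; lra.
  by rewrite ler_norml /o => /andP[? ?]; apply/andP; split; lra.
apply: (@approx_lim (fun n x => step_approx n (o x)) _ 1).
- move=> n; apply: approxB; first exact: approx_alg.
  apply: approxX; apply: approxB; first exact: approx_alg.
  by apply: approxX; exact: approx_alg.
- move=> n x; have /andP[h0 h1] := step_approx_bound n (o01 x).
  by rewrite ger0_norm.
- move=> x; rewrite indicE (_ : (x \in _) = (2^-1 <= o x)).
    exact: cvg_step_approx.
  rewrite /o lerDl pmulr_rge0 ?invr_gt0// subr_ge0.
  by apply/idP/idP => [|h]; rewrite inE.
Qed.

Lemma approx_setC A : approx_set A -> approx_set (~` A).
Proof.
move=> [mA aA]; split; first exact: measurableC.
have -> : \1_(~` A) = (fun x => 1 - \1_A x) :> (T -> R).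
  apply/funext => x; rewrite !indicE in_setC.
  by case: (x \in A); rewrite ?subrr ?subr0.
by apply: approxB => //; exact: approx_alg.
Qed.

(** The indicator of the union is the bounded limit of one minus the partial products of the
    indicators of the complements. *)
Lemma approx_set_bigcup (A : nat -> set T) : (forall n, approx_set (A n)) ->
  approx_set (\bigcup_n A n).
Proof.
move=> aA; split; first by apply: bigcup_measurable => n _; have [] := aA n.
pose u n x : R := 1 - \prod_(i <- index_iota 0 n) (1 - \1_(A i) x).
apply: (@approx_lim u _ 1).
- move=> n; apply: approxB; first exact: approx_alg.
  apply: approx_prod => i; apply: approxB; first exact: approx_alg.
  by have [] := aA i.
- move=> n x; rewrite /u.
  have h i : 0 <= (1 - \1_(A i) x : R) <= 1.
    by rewrite indicE; case: (_ \in _) => /=; apply/andP; split; lra.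
  have h0 : 0 <= \prod_(i <- index_iota 0 n) (1 - \1_(A i) x : R).
    by apply: prodr_ge0 => i _; have /andP[] := h i.
  rewrite ger0_norm; first by rewrite gerBl.
  by rewrite subr_ge0; apply: prodr_ile1 => i _; exact: h.
move=> x; rewrite indicE; have [[i Ai]|nA] := pselect (exists i, A i x).
  rewrite mem_set; last by exists i.
  apply: cvg_near_cst; near=> n; rewrite /u (big_rem i)/=; last first.
    by rewrite mem_index_iota /=; near: n; exact: nbhs_infty_gt.
  by rewrite indicE mem_set// subrr mul0r subr0.
rewrite memNset => [|[i _ Ai]]; last by apply: nA; exists i.
apply: cvg_near_cst; apply: nearW => n; rewrite /u big1 ?subrr// => i _.
by rewrite indicE memNset ?subr0// => Ai; apply: nA; exists i.
Unshelve. all: by end_near. Qed.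

Lemma approx_set_setT : approx_set setT.
Proof.
split=> //; rewrite (_ : \1__ = fun=> 1); first exact: approx_alg.
by apply/funext => x; rewrite indicE in_setT.
Qed.

Lemma approx_set_sigma_algebra : sigma_algebra setT approx_set.
Proof.
split.
- by rewrite -setCT; apply: approx_setC; exact: approx_set_setT.
- by move=> A aA; rewrite setTD; exact: approx_setC.
- by move=> A; exact: approx_set_bigcup.
Qed.

Hypothesis all_approx : forall A : set T, measurable A -> approx_set A.

Lemma count_le_truncn n (y : R) : 0 <= y ->
  (\sum_(k <- index_iota 0 n) (k.+1%:R <= y)%R)%N = minn n (Num.truncn y).
Proof.
move=> y0; elim: n => [|n IH]; first by rewrite big_nil min0n.
rewrite big_nat_recr//= IH -truncn_ge_nat//.
case: (leqP n.+1 (Num.truncn y)) => h /=.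
  by rewrite (minn_idPl (ltnW h)) addn1.
by rewrite addn0 (minn_idPr _).
Qed.

(** Rounding [u] down to a multiple of [1/(n+1)] costs at most [1/(n+1)]. The rounded function
    counts the levels [k+1] that [(n+1) u] reaches, so it is a combination of indicators of level
    sets. *)
Lemma approx_bmeas01 u : measurable_fun setT u -> (forall x, 0 <= u x <= 1) ->
  approximable u.
Proof.
move=> mu u01.
pose A n k := [set x | k.+1%:R <= n.+1%:R * u x].
pose u_ n x : R := n.+1%:R^-1 * \sum_(k <- index_iota 0 n.+1) \1_(A n k) x.
have mA n k : measurable (A n k).
  rewrite (_ : A n k = (fun x => n.+1%:R * u x) @^-1` `[k.+1%:R, +oo[%classic).
    by rewrite -[X in measurable X]setTI; apply: measurable_funM.
  by apply/seteqP; split=> x /=; rewrite /A /= in_itv/= andbT.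
have uE n x : u_ n x = n.+1%:R^-1 * (Num.truncn (n.+1%:R * u x))%:R.
  have /andP[u0 u1] := u01 x.
  have nu0 : 0 <= n.+1%:R * u x by rewrite mulr_ge0.
  have h : (Num.truncn (n.+1%:R * u x) <= n.+1)%N.
    have /andP[h1 _] := truncn_itv nu0.
    by rewrite -(ler_nat R); apply: le_trans h1 _; rewrite ler_piMr.
  rewrite /u_ -(minn_idPr h) -count_le_truncn// natr_sum; congr (_ * _).
  apply: eq_bigr => k _; rewrite indicE; congr (nat_of_bool _)%:R.
  by apply/idP/idP => [|hk]; rewrite inE.
have u_le n x : `|u x - u_ n x| <= n.+1%:R^-1.
  have /andP[u0 u1] := u01 x.
  rewrite uE -[X in `|X - _|](mulKf (_ : n.+1%:R != 0)) ?pnatr_eq0// -mulrBr.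
  rewrite normrM ger0_norm ?invr_ge0// ler_piMr ?invr_ge0//.
  have nu0 : 0 <= n.+1%:R * u x by rewrite mulr_ge0.
  have /andP[h1 h2] := truncn_itv nu0.
  rewrite ger0_norm ?subr_ge0//; move: h2; rewrite -natr1; lra.
apply: (@approx_lim u_ _ 2).
- move=> n; apply: approxM; first exact: approx_alg.
  by apply: approx_sum => k; have [] := all_approx (mA n k).
- move=> n x; have /andP[u0 u1] := u01 x.
  have : n.+1%:R^-1 <= 1 :> R by rewrite invf_le1 ?ler1n.
  have := u_le n x; move: (n.+1%:R^-1) => c; rewrite !ler_norml => /andP[h1 h2] h3.
  by apply/andP; split; lra.
- move=> x; apply/cvgrPdist_le => e e0; near=> n.
  apply: le_trans (u_le n x) _.
  by apply: ltW; near: n; exact: (near_infty_natSinv_lt (PosNum e0)).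
Unshelve. all: by end_near. Qed.

Lemma approx_bmeas u : bounded_measurable u -> approximable u.
Proof.
move=> [mu [M uM]].
pose N := `|M| + 1; have N0 : 0 < N by rewrite ltr_wpDl.
have uN x : `|u x| <= N by apply: le_trans (uM x) _; rewrite (le_trans (ler_norm _))// lerDl.
pose v x := (2 * N)^-1 * (u x + N).
have -> : u = (fun x => 2 * N * v x - N).
  by apply/funext => x; rewrite /v; field; apply: lt0r_neq0.
apply: approxB; last exact: approx_alg.
apply: approxM; first exact: approx_alg.
apply: approx_bmeas01.
  by apply: measurable_funM => //; exact: measurable_funD.
move=> x; rewrite /v; have := uN x; rewrite ler_norml => /andP[h1 h2].
have N2 : 0 < 2 * N by rewrite mulr_gt0.
apply/andP; split; last by rewrite ler_pdivrMl//; lra.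
by rewrite mulr_ge0 ?invr_ge0 ?(ltW N2)//; lra.
Qed.

End Approximation.

(** * Trigonometric polynomials and mixing *)

Section CosineNearOne.
Context {R : realType}.
Implicit Types s d : R.

Lemma cosD2piz s (k : int) : cos (s + 2 * pi * k%:~R) = cos s.
Proof.
have nat_case (n : nat) t : cos (t + 2 * pi * n%:R) = cos t :> R.
  elim: n => [|n IH]; first by rewrite mulr0 addr0.
  have -> : t + 2 * pi * n.+1%:R = (t + 2 * pi * n%:R) + pi *+ 2.
    by rewrite -natr1 -[pi *+ 2]mulr_natl; ring.
  by rewrite cosD2pi IH.
case: k => n; first exact: nat_case.
rewrite NegzE mulrNz mulrN -[LHS](nat_case n.+1); congr cos.
by rewrite pmulrn subrK.
Qed.

(** Modulo integers, [s] is replaced by its distance [|r|] to a nearest integer, found as the floor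
    of [s + 1/2]. Then [2 pi |r|] lies in [[0, pi]], where the cosine decreases; taking [e <= 1/2]
    puts [2 pi e] in the same interval. *)
Lemma cos_near1 d : 0 < d -> exists n : nat, forall s,
  1 - cos (2 * pi * s) < n.+1%:R^-1 -> exists k : int, `|s - k%:~R| < d.
Proof.
move=> d0; have pi0 := pi_gt0 R.
pose e := Num.min d 2^-1.
have e0 : 0 < e by rewrite lt_min d0 invr_gt0 ltr0n.
have e2 : e <= 2^-1 by rewrite ge_min lexx orbT.
have ine : 2 * pi * e \in `[0, pi].
  by rewrite in_itv/=; apply/andP; split; nra.
have c1 : cos (2 * pi * e) < 1.
  have in0 : (0 : R) \in `[0, pi] by rewrite in_itv/= lexx ltW.
  by rewrite -[ltRHS]cos0 (ltr_cos in0 ine) !mulr_gt0.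
have [n hn] : exists n : nat, n.+1%:R^-1 < 1 - cos (2 * pi * e).
  have h : 0 < 1 - cos (2 * pi * e) by rewrite subr_gt0.
  by have [n _ /(_ n (leqnn n))] := near_infty_natSinv_lt (PosNum h); exists n.
exists n => s hs; exists (Num.floor (s + 2^-1)).
set k := Num.floor _; set r := s - _.
have /andP[r1 r2] : - 2^-1 <= r <= 2^-1.
  have /andP[] := floor_itv (s + 2^-1); rewrite -/k intrD /r => h1 h2.
  by apply/andP; split; lra.
have cr : cos (2 * pi * s) = cos (2 * pi * `|r|).
  rewrite -[RHS]cos_norm normrM normr_id -normrM cos_norm.
  by rewrite -[RHS](cosD2piz _ k) -mulrDr subrK.
have r0 : `|r| <= 2^-1 by rewrite ler_norml r1 r2.
have inr : 2 * pi * `|r| \in `[0, pi].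
  have h : pi * `|r| <= pi * 2^-1 by rewrite ler_pM2l.
  have h0 : 0 <= pi * `|r| by rewrite mulr_ge0// ltW.
  by rewrite in_itv/=; apply/andP; split; lra.
have := lt_trans hs hn; rewrite ltrD2l ltrN2 cr ltr_cos// => h.
have : `|r| < e by rewrite -(ltr_pM2l (_ : 0 < 2 * pi)) ?mulr_gt0.
by move=> /lt_le_trans; apply; rewrite ge_min lexx.
Qed.

Lemma rat_cos_near1 s d : 0 < d ->
  exists q : rat, 1 - cos (2 * pi * (s - ratr q)) < d.
Proof.
move=> d0.
have : cos (2 * pi * (s - r)) @[r --> s] --> cos (2 * pi * (s - s)).
  apply: (@continuous_comp _ _ _ (fun r => 2 * pi * (s - r)) (@cos R)).
    apply: (@cvgMr _ _ (nbhs s)).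
    by apply: (@cvgB _ _ _ (nbhs s)); [exact: cvg_cst|exact: cvg_id].
  exact: continuous_cos.
rewrite subrr mulr0 cos0.
move=> /(@cvgrPdist_lt _ _ _ (nbhs s)) /(_ _ d0).
move=> /nbhs_ballP[e /= e0 he].
have se : s - e < s + e by rewrite ltrBlDr -addrA ltrDl addr_gt0.
have [q] := rat_in_itvoo se; rewrite in_itv/= => /andP[q1 q2].
exists q; have : ball s e (ratr q) by rewrite /ball/= ltr_norml; apply/andP; split; lra.
by move=> /he /=; rewrite ltr_norml => /andP[].
Qed.

End CosineNearOne.

(** * Real characters of the torus *)

Section Waves.
Context {R : realType} {g : nat} (L : lattice R g).
Local Notation C := R[i].
Local Notation X := (torus L).
Implicit Types (n k : 'rV[int]_(g + g)) (t : 'rV[R]_(g + g)) (p : R).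

Definition pairing n t : R := \sum_i (n ord0 i)%:~R * t ord0 i.

Lemma pairingDr n t u : pairing n (t + u) = pairing n t + pairing n u.
Proof. by rewrite -big_split; apply: eq_bigr => i _; rewrite mxE mulrDr. Qed.

Lemma pairingDl n k t : pairing (n + k) t = pairing n t + pairing k t.
Proof. by rewrite -big_split; apply: eq_bigr => i _; rewrite mxE intrD mulrDl. Qed.

Lemma pairingBl n k t : pairing (n - k) t = pairing n t - pairing k t.
Proof.
by rewrite -sumrB; apply: eq_bigr => i _; rewrite !mxE intrD mulrDl mulrNz mulNr.
Qed.

Lemma pairing0l t : pairing 0 t = 0.
Proof. by rewrite /pairing big1// => i _; rewrite mxE mul0r. Qed.

Lemma pairing_int n k : exists l : int, pairing n (map_mx intr k) = l%:~R.
Proof.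
exists (\sum_i n ord0 i * k ord0 i); rewrite rmorph_sum.
by apply: eq_bigr => i _; rewrite mxE rmorphM.
Qed.

Lemma pairing_delta i t : pairing (delta_mx ord0 i) t = t ord0 i.
Proof.
rewrite /pairing (bigD1 i)//= big1 ?addr0; last first.
  by move=> j /negbTE ji; rewrite mxE ji andbF mul0r.
by rewrite mxE !eqxx mul1r.
Qed.

Lemma pairing_mul n t (B : 'M[int]_(g + g)) :
  pairing n (t *m map_mx intr B) = pairing (n *m B^T) t.
Proof.
rewrite /pairing; under eq_bigr do rewrite mxE mulr_sumr.
rewrite exchange_big; apply: eq_bigr => j _; rewrite mxE rmorph_sum mulr_suml.
by apply: eq_bigr => i _; rewrite !mxE rmorphM /=; ring.
Qed.

Lemma continuous_pairing n : continuous (pairing n).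
Proof.
move=> t; rewrite /pairing.
apply: (@cvg_sum _ (nbhs t) _ R R^o) => i.
by apply: (@cvgMr _ _ (nbhs t)); exact: coord_continuous.
Qed.

(** The phases [0] and [- pi/2] give the real and imaginary parts of the character of frequency [n].
    An arbitrary phase makes translations act on the phase alone and products of waves combine into
    waves. The value is independent of the representative, by [waveE]. *)
Definition wave n p (x : X) : R :=
  cos (2 * pi * pairing n (rcoord L (torus_repr x)) + p).

Lemma waveE n p z : wave n p (torus_pi L z) = cos (2 * pi * pairing n (rcoord L z) + p).
Proof.
rewrite /wave.
have /lattice_setP[k hk] := torus_piK L z.
have -> : torus_repr (torus_pi L z) = z + (torus_repr (torus_pi L z) - z).
  by rewrite addrC subrK.
rewrite rcoordD hk pairingDr; have [l ->] := pairing_int n k.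
by rewrite mulrDr addrAC cosD2piz.
Qed.

Lemma continuous_wave n p : continuous (wave n p).
Proof.
apply: torus_continuousP.
rewrite (_ : _ \o _ = fun z => cos (2 * pi * pairing n (rcoord L z) + p)); last first.
  by apply/funext => z; exact: waveE.
move=> z; apply: (@continuous_comp _ _ _
  (fun z => 2 * pi * pairing n (rcoord L z) + p) (@cos R)); last exact: continuous_cos.
apply: (@cvgD _ _ _ (nbhs z)); last exact: cvg_cst.
apply: (@cvgMr _ _ (nbhs z)).
apply: (@continuous_comp _ _ _ (@rcoord R g 1 L) (pairing n)).
  exact: continuous_rcoord.
exact: continuous_pairing.
Qed.

Lemma wave_le1 n p x : `|wave n p x| <= 1.
Proof. exact: cos_max. Qed.

Lemma wave0 p x : wave 0 p x = cos p.
Proof. by rewrite /wave pairing0l mulr0 add0r. Qed.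

Lemma waveM n k p q x : wave n p x * wave k q x =
  2^-1 * wave (n + k) (p + q) x + 2^-1 * wave (n - k) (p - q) x.
Proof.
rewrite /wave pairingDl pairingBl.
set a := pairing n _; set b := pairing k _.
have -> : 2 * pi * (a + b) + (p + q) = (2 * pi * a + p) + (2 * pi * b + q) by ring.
have -> : 2 * pi * (a - b) + (p - q) = (2 * pi * a + p) - (2 * pi * b + q) by ring.
by move: (2 * pi * a + p) (2 * pi * b + q) => u v; rewrite cosD cosB; field.
Qed.

Lemma wave_translate n p a x :
  wave n p (torus_pi L a + x) = wave n (p + 2 * pi * pairing n (rcoord L a)) x.
Proof.
have [z ->] := torus_pi_surj x; rewrite -torus_piD !waveE rcoordD pairingDr.
by congr cos; ring.
Qed.

Lemma rcoord_linear (A : 'M[C]_g) (B : 'M[int]_(g + g)) (z : 'rV[C]_g) :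
  periods L *m A = map_mx intr B *m periods L ->
  rcoord L (z *m A) = rcoord L z *m map_mx intr B.
Proof.
move=> PA; apply: (@of_rcoord_inj R g 1 L); rewrite rcoordK.
rewrite /of_rcoord cplxmxM cplxmx_int -mulmxA -PA mulmxA.
by rewrite -[cplxmx _ *m _]/(of_rcoord L _) rcoordK.
Qed.

Lemma wave_linear (f : X -> X) (A : 'M[C]_g) (B : 'M[int]_(g + g)) n p x :
  linear_lift f A -> periods L *m A = map_mx intr B *m periods L ->
  wave n p (f x) = wave (n *m B^T) p x.
Proof.
move=> fA PA; have [z ->] := torus_pi_surj x.
by rewrite fA !waveE (rcoord_linear _ PA) pairing_mul.
Qed.

End Waves.

(** * Trigonometric polynomials approximate all bounded measurable functions *)

Section TrigonometricPolynomials.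
Context {R : realType} {g : nat} (L : lattice R g).
Local Notation C := R[i].
Local Notation X := (torus L).
Local Notation B := (borel (torus L)).

Lemma continuous_borel_measurable (u : X -> R) : continuous u ->
  measurable_fun [set: B] (u : B -> R).
Proof.
move=> /continuousP cu; apply: (measurability _ (RGenOpens.measurableE R)).
move=> _ [_ [a [b ->] <-]]; rewrite setTI; apply: sub_sigma_algebra.
exact/cu/interval_open.
Qed.

Lemma continuous_borel_measurable_self (f : X -> X) : continuous f ->
  measurable_fun [set: B] (f : B -> B).
Proof.
move=> /continuousP cf.
apply: (@measurability _ _ B B [set: B] f (@open X) erefl).
move=> _ [A oA <-]; rewrite setTI; apply: sub_sigma_algebra.
exact: cf.
Qed.

Definition trig_poly : set (B -> R) := [set u |
  exists s : seq (R * 'rV[int]_(g + g) * R),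
    u = fun x => \sum_(c <- s) c.1.1 * wave c.1.2 c.2 x].

Lemma trig_wave n p : trig_poly (wave n p).
Proof.
exists [:: (1, n, p)]; apply/funext => x; by rewrite big_seq1 mul1r.
Qed.

Lemma trig_cst c : trig_poly (fun=> c).
Proof.
exists [:: (c, 0, 0)]; apply/funext => x.
by rewrite big_seq1 wave0 cos0 mulr1.
Qed.

Lemma trigD u v : trig_poly u -> trig_poly v -> trig_poly (fun x => u x + v x).
Proof.
by move=> [s ->] [t ->]; exists (s ++ t); apply/funext => x; rewrite big_cat.
Qed.

Lemma trigZ c u : trig_poly u -> trig_poly (fun x => c * u x).
Proof.
move=> [s ->]; exists [seq (c * a.1.1, a.1.2, a.2) | a <- s].
apply/funext => x; rewrite big_map mulr_sumr.
by apply: eq_bigr => a _; rewrite mulrA.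
Qed.

Lemma trig_sum I (r : seq I) (F : I -> B -> R) :
  (forall i, trig_poly (F i)) -> trig_poly (fun x => \sum_(i <- r) F i x).
Proof.
move=> tF; elim: r => [|i r IH].
  by under eq_fun do rewrite big_nil; exact: trig_cst.
by under eq_fun do rewrite big_cons; exact: trigD.
Qed.

Lemma trigM u v : trig_poly u -> trig_poly v -> trig_poly (fun x => u x * v x).
Proof.
move=> [s ->] [t ->]; under eq_fun do rewrite mulr_suml.
apply: trig_sum => a; under eq_fun do rewrite mulr_sumr.
apply: trig_sum => b; under eq_fun do rewrite mulrACA waveM.
by apply: trigZ; apply: trigD; apply: trigZ; exact: trig_wave.
Qed.

Lemma bmeas_wave n p : bounded_measurable (wave n p : B -> R).
Proof.
split; first by apply: continuous_borel_measurable; exact: continuous_wave.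
by exists 1 => x; exact: wave_le1.
Qed.

Lemma bmeas_trig u : trig_poly u -> bounded_measurable u.
Proof.
by move=> [s ->]; apply: bmeas_sum => a; apply: bmeasZ; exact: bmeas_wave.
Qed.

(** A neighbourhood of the point with coordinates [a], cut out by a single trigonometric polynomial.
    Rational centres leave only countably many boxes. *)
Definition torus_box (a : 'rV[rat]_(g + g)) (n : nat) : set X :=
  [set x | \sum_i (1 - wave (delta_mx ord0 i) (2 * pi * - ratr (a ord0 i)) x) < n.+1%:R^-1].

Lemma torus_boxP a n z : torus_box a n (torus_pi L z) <->
  \sum_i (1 - cos (2 * pi * (rcoord L z ord0 i - ratr (a ord0 i)))) < n.+1%:R^-1.
Proof.
rewrite /torus_box /=; under eq_bigr do rewrite waveE pairing_delta -mulrDr.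
by [].
Qed.

(** In a small box each coordinate is close to that of the centre modulo an integer, and the
    integers are absorbed by the lattice. Two points of the box, [z] and [w], are each compared with
    the centre, whence the radius [d / 2]. *)
Lemma torus_box_base (O : set X) x : open O -> O x ->
  exists a n, torus_box a n x /\ torus_box a n `<=` O.
Proof.
have [z ->] := torus_pi_surj x => oO Oz.
have pO : \forall t \near rcoord L z, O (torus_pi L (of_rcoord L t)).
  have c : (torus_pi L \o of_rcoord L) t @[t --> rcoord L z] --> torus_pi L z.
    rewrite -[X in _ --> torus_pi L X](rcoordK L).
    apply: (@continuous_comp _ _ _ (@of_rcoord R g 1 L) (torus_pi L)).
      exact: continuous_of_rcoord.
    exact: torus_pi_continuous.
  by apply: c; exact: open_nbhs_nbhs.
move: pO => /nbhs_ballP[d /= d0 hd].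
have d2 : 0 < d / 2 by rewrite divr_gt0.
have [n hn] := cos_near1 d2.
set t := rcoord L z in hd *.
(* The bound [1/(n+1)] is shared among [2g] terms; dividing by [2g + 1] makes the sum strictly
   smaller and also covers [g = 0]. *)
have m0 : 0 < (g + g).+1%:R^-1 * n.+1%:R^-1 :> R by rewrite mulr_gt0 ?invr_gt0.
have /choice[a ha] : forall i, exists q : rat,
    1 - cos (2 * pi * (t ord0 i - ratr q)) < (g + g).+1%:R^-1 * n.+1%:R^-1.
  by move=> i; exact: rat_cos_near1.
pose a' := \row_i a i.
have a'E i : a' ord0 i = a i by rewrite mxE.
have box_near w : torus_box a' n (torus_pi L w) ->
    forall i, exists k : int, `|rcoord L w ord0 i - ratr (a i) - k%:~R| < d / 2.
  move=> /torus_boxP h i; apply: hn; apply: le_lt_trans h.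
  rewrite (bigD1 i)//= a'E lerDl; apply: sumr_ge0 => j _.
  by rewrite subr_ge0; exact: cos_le1.
have zbox : torus_box a' n (torus_pi L z).
  apply/torus_boxP; rewrite -/t.
  apply: (@le_lt_trans _ _ (\sum_(i < g + g) (g + g).+1%:R^-1 * n.+1%:R^-1)).
    by apply: ler_sum => i _; rewrite a'E; exact: ltW.
  rewrite sumr_const card_ord -[ltLHS]mulr_natl mulrA gtr_pMl ?invr_gt0//.
  by rewrite ltr_pdivrMr// mul1r ltr_nat.
exists a', n; split=> // y; have [w ->] := torus_pi_surj y => wbox.
have /choice[k hk] := box_near _ wbox; have /choice[l hl] := box_near _ zbox.
(* The representative of [y] whose coordinates are within [d] of those of [z]. *)
pose s := rcoord L w - map_mx intr (\row_i (k i - l i)).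
have -> : torus_pi L w = torus_pi L (of_rcoord L s).
  apply/torus_piP/lattice_setP; exists (\row_i (k i - l i)).
  rewrite -[w in w - _](rcoordK L) /s.
  by rewrite rcoordD rcoordN !of_rcoordK opprB addrC subrK.
apply: hd; split => // i j; rewrite (ord1 i) /ball /=.
have -> : s ord0 j = rcoord L w ord0 j - ((k j)%:~R - (l j)%:~R).
  by rewrite /s mxE; congr (_ + _); rewrite !mxE rmorphB.
have := hk j; have := hl j; rewrite -/t !ltr_norml => /andP[h1 h2] /andP[h3 h4].
by apply/andP; split; lra.
Qed.

Variables (P : probability B R) (S : X -> X) (cS : continuous S).

(** An open set is the union of the countably many boxes that it contains, and a box is the
    complement of a superlevel set of a trigonometric polynomial. The sigma-algebra of approximable
    sets therefore contains all Borel sets. *)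
Lemma torus_approx (u : B -> R) : bounded_measurable u ->
  approximable P S trig_poly u.
Proof.
have mS := continuous_borel_measurable_self cS.
have sa := approx_set_sigma_algebra P mS bmeas_trig trig_cst trigD trigM.
apply: (approx_bmeas mS bmeas_trig trig_cst trigD trigM) => A mA.
apply: (smallest_sub sa) mA => O oO.
have box_approx a n : approx_set P S trig_poly (torus_box a n).
  rewrite (_ : torus_box a n = ~` [set x | n.+1%:R^-1 <= \sum_i
      (1 - wave (delta_mx ord0 i) (2 * pi * - ratr (a ord0 i)) x)]); last first.
    apply/seteqP; split=> x; rewrite /torus_box /= ltNge; first by move/negP.
    by move=> h; apply/negP.
  apply: (approx_setC mS bmeas_trig trig_cst trigD trigM).
  have ts : trig_poly (fun x => \sum_i
      (1 - wave (delta_mx ord0 i) (2 * pi * - ratr (a ord0 i)) x)).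
    apply: trig_sum => i; under eq_fun do rewrite -mulN1r.
    by apply: trigD; [exact: trig_cst|apply: trigZ; exact: trig_wave].
  exact: (approx_set_ge P mS bmeas_trig trig_cst trigD trigM _ ts).
pose F (k : nat) := if unpickle k is Some (a, n) then
  if `[< torus_box a n `<=` O >] then torus_box a n else set0 else set0.
have -> : O = \bigcup_k F k.
  apply/seteqP; split=> [x Ox|x [k _]].
    have [a [n [xbox boxO]]] := torus_box_base oO Ox.
    exists (pickle (a, n)) => //; rewrite /F pickleK.
    by case: asboolP.
  by rewrite /F; case: unpickle => [[a n]|//]; case: asboolP => // h /h.
have set0_approx : approx_set P S trig_poly set0.
  by have [] := sa.
apply: (approx_set_bigcup mS bmeas_trig trig_cst trigD trigM) => k.
rewrite /F; case: unpickle => [[a n]|//].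
by case: asboolP.
Qed.

End TrigonometricPolynomials.

(** * Invariance, mixing and ergodicity of Haar measure *)

Section Mixing.
Context {R : realType} {g : nat} (L : lattice R g).
Local Notation C := R[i].
Local Notation X := (torus L).
Local Notation B := (borel (torus L)).
Variables (mu : probability B R) (haar_mu : haar mu).
Local Notation I u := (\int[mu]_x (u x)).

Lemma bmeas_int_pushforward (S : B -> B) (u : B -> R) :
  measurable_fun setT S ->
  (forall A, measurable A -> mu (S @^-1` A) = mu A) ->
  bounded_measurable u -> I (u \o S) = I u.
Proof.
move=> mS muS bu; rewrite /Rintegral; congr fine.
transitivity (\int[pushforward mu S]_x (u x)%:E)%E.
  rewrite integral_pushforward ?preimage_setT//.
  - by apply/measurable_EFinP; have [] := bu.
  - by apply: bmeas_integrable; exact: bmeas_comp.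
apply: eq_measure_integral => A mA _; exact: muS.
Qed.

Lemma continuous_translate (a : X) : continuous (fun x : X => a + x).
Proof.
apply: torus_continuousP; have [z ->] := torus_pi_surj a.
rewrite (_ : _ \o _ = torus_pi L \o (fun w => z + w)); last first.
  by apply/funext => w; rewrite /= torus_piD.
move=> w; apply: (@continuous_comp _ _ _ (fun w => z + w) (torus_pi L)).
  by apply: (@cvgD _ _ _ (nbhs w)); [exact: cvg_cst|exact: cvg_id].
exact: torus_pi_continuous.
Qed.

(* Translation by half a period changes the sign of the wave. *)
Lemma int_wave n p : n != 0 -> I (wave n p) = 0.
Proof.
move=> n0; have [i ni] : exists i, n ord0 i != 0.
  apply/existsP; apply: contraNT n0 => /existsPn h; apply/eqP/rowP => i.
  by rewrite mxE; apply/eqP; have := h i; rewrite negbK.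
have ni' : (n ord0 i)%:~R != 0 :> R by rewrite intr_eq0.
pose t : 'rV[R]_(g + g) := ((2 * (n ord0 i)%:~R)^-1) *: delta_mx ord0 i.
have pt : pairing n t = 2^-1.
  rewrite /pairing (bigD1 i)//= big1 ?addr0; last first.
    by move=> j /negbTE ji; rewrite !mxE ji andbF mulr0 mulr0.
  by rewrite !mxE !eqxx mulr1; field.
have h : (wave n p \o (fun x : X => torus_pi L (of_rcoord L t) + x)) =
    (fun x => (-1) * wave n p x).
  apply/funext => x; rewrite /= wave_translate of_rcoordK pt mulN1r.
  rewrite /wave addrA (_ : 2 * pi / 2 = pi); last by field.
  by rewrite cosDpi.
have := bmeas_int_pushforward
  (continuous_borel_measurable_self (@continuous_translate _))
  (haar_mu (torus_pi L (of_rcoord L t))) (bmeas_wave L n p).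
rewrite h bmeas_intZ; last exact: bmeas_wave.
lra.
Qed.

Variables (f : X -> X) (A : 'M[C]_g) (N : 'M[int]_(g + g)).
Hypotheses (fA : linear_lift f A) (PA : periods L *m A = map_mx intr N *m periods L).
Hypothesis orbit_inj : forall n : 'rV[int]_(g + g), n != 0 ->
  injective (fun j => n *m (N ^+ j)^T).

Lemma linear_lift_int_iter j : periods L *m A ^+ j = map_mx intr (N ^+ j) *m periods L.
Proof.
elim: j => [|j IH]; first by rewrite map_mx1 mul1mx mulmx1.
by rewrite exprSr mulmxA IH -mulmxA PA mulmxA -map_mxM exprSr.
Qed.

Lemma wave_iter n p j x : wave n p (iter j f x) = wave (n *m (N ^+ j)^T) p x.
Proof. exact: wave_linear (linear_lift_iter j fA) (linear_lift_int_iter j). Qed.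

Lemma iter_continuous j : continuous (iter j f).
Proof. exact: linear_lift_continuous (linear_lift_iter j fA). Qed.

Let mf j := continuous_borel_measurable_self (@iter_continuous j).

Lemma orbit_neq0 (n : 'rV[int]_(g + g)) j : n != 0 -> n *m (N ^+ j)^T != 0.
Proof.
move=> n0; apply/eqP => nj.
have h : n *m (N ^+ j.+1)^T = 0.
  by rewrite exprS -mulmxE trmx_mul mulmxA nj mul0mx.
have /(orbit_inj n0)/eqP : n *m (N ^+ j)^T = n *m (N ^+ j.+1)^T by rewrite nj h.
by rewrite ltn_eqF.
Qed.

Lemma bmeas_waveZ a n p : bounded_measurable (fun x : B => a * wave n p x : R).
Proof. exact: bmeasZ (bmeas_wave L n p). Qed.

(** Only the frequency 0 has a nonzero integral, and the dual action of [f] sends no other frequency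
    to it. *)
Lemma int_trig_iter u j : trig_poly (L := L) u -> I (fun x => u (iter j f x)) = I u.
Proof.
move=> [s ->].
transitivity (I (fun x => \sum_(c <- s) c.1.1 * wave (c.1.2 *m (N ^+ j)^T) c.2 x)).
  congr (Rintegral _ _ _); apply/funext => x.
  by apply: eq_bigr => c _; rewrite wave_iter.
rewrite (bmeas_int_sum _ _ (fun c => bmeas_waveZ c.1.1 (c.1.2 *m (N ^+ j)^T) c.2)).
rewrite (bmeas_int_sum _ _ (fun c => bmeas_waveZ c.1.1 c.1.2 c.2)).
apply: eq_bigr => c _; rewrite !(bmeas_intZ mu _ (bmeas_wave L _ _)).
congr (_ * _); have [->|c0] := eqVneq c.1.2 0; first by rewrite mul0mx.
by rewrite !int_wave// orbit_neq0.
Qed.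

(** The seminorm attached to [iter j f] bounds the errors before and after composition by the same
    trigonometric polynomial, for which the two integrals agree. *)
Lemma bmeas_int_iter (u : B -> R) j : bounded_measurable u ->
  I (fun x => u (iter j f x)) = I u.
Proof.
move=> bu; apply/subr0_eq/eqP; rewrite -normr_le0; apply/ler_addgt0Pr => e e0.
rewrite add0r; have [_ /(_ _ e0)[t tt ht]] := torus_approx mu (@iter_continuous j) bu.
have bt := bmeas_trig tt; have buj := bmeas_comp (mf j) bu.
have btj := bmeas_comp (mf j) bt.
have -> : I (fun x => u (iter j f x)) - I u =
    I (fun x => (u \o iter j f) x - (t \o iter j f) x) - I (fun x => u x - t x).
  rewrite !bmeas_intB// [X in _ - X - _](int_trig_iter j tt); ring.
apply: ltW; apply: le_lt_trans (ler_normB _ _) _.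
apply: le_lt_trans ht; rewrite /seminorm addrC lerD//.
  exact: (bmeas_int_norm mu (bmeasB bu bt)).
exact: (bmeas_int_norm mu (bmeasB buj btj)).
Qed.

Lemma haar_invariant : invariant_measure mu f.
Proof.
move=> D mD; have mfD : measurable (f @^-1` D : set B).
  by have := mf 1 measurableT mD; rewrite setTI.
have := bmeas_int_iter 1 (bmeas_indic (R := R) mD).
rewrite -(bmeas_int_indic mu mD) -(bmeas_int_indic mu mfD) => <-.
by congr (_%:E).
Qed.

(** The product of the waves has frequencies [n (N^j)^T + k] and [n (N^j)^T - k]. For [n] nonzero,
    the orbit of [n] meets [- k] and [k] at most once each, so the correlation is exactly 0 for
    large [j]. *)
Lemma mixing_wave n p k q :
  I (fun x => wave n p (iter j f x) * wave k q x) @[j --> \oo] -->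
  I (wave n p) * I (wave k q).
Proof.
have [->|n0] := eqVneq n 0.
  apply: cvg_near_cst; apply: nearW => j.
  have -> : (wave 0 p : X -> R) = fun=> cos p by apply/funext => x; exact: wave0.
  by rewrite bmeas_intZ ?bmeas_int_cst//; exact: bmeas_wave.
rewrite int_wave// mul0r; apply: cvg_near_cst.
have ev (l : 'rV[int]_(g + g)) : \forall j \near \oo, n *m (N ^+ j)^T != l.
  have [[j nj]|h] := pselect (exists j, n *m (N ^+ j)^T = l).
    exists j.+1 => // i /= ji; apply/eqP => ni.
    have /orbit_inj : n *m (N ^+ i)^T = n *m (N ^+ j)^T by rewrite ni nj.
    by move=> /(_ n0) ij; rewrite ij ltnn in ji.
  by apply: nearW => j; apply/eqP => nj; apply: h; exists j.
near=> j.
rewrite (_ : (fun x => _) = fun x => 2^-1 * wave (n *m (N ^+ j)^T + k) (p + q) x +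
   2^-1 * wave (n *m (N ^+ j)^T - k) (p - q) x); last first.
  by apply/funext => x; rewrite wave_iter waveM.
rewrite (bmeas_intD mu (bmeas_waveZ _ _ _) (bmeas_waveZ _ _ _)).
rewrite !(bmeas_intZ mu _ (bmeas_wave L _ _)).
rewrite !int_wave ?mulr0 ?addr0//.
  by rewrite subr_eq0; near: j; exact: ev.
by rewrite addr_eq0; near: j; exact: ev.
Unshelve. all: by end_near. Qed.

Lemma mixing_trig u v : trig_poly (L := L) u -> trig_poly (L := L) v ->
  I (fun x => u (iter j f x) * v x) @[j --> \oo] --> I u * I v.
Proof.
have bw := bmeas_waveZ.
move=> [s ->] [t ->].
rewrite (_ : (fun j => _) = fun j => \sum_(c <- s) \sum_(b <- t)
    (c.1.1 * b.1.1) * I (fun x => wave c.1.2 c.2 (iter j f x) * wave b.1.2 b.2 x)); last first.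
  apply/funext => j.
  have bm (c b : R * 'rV[int]_(g + g) * R) :
      bounded_measurable (fun x : B => wave c.1.2 c.2 (iter j f x) * wave b.1.2 b.2 x : R).
    by apply: bmeasM; [exact: (bmeas_comp (mf j) (bmeas_wave _ _ _))|exact: bmeas_wave].
  rewrite (_ : (fun x => _) = fun x => \sum_(c <- s) \sum_(b <- t)
    (c.1.1 * b.1.1) * (wave c.1.2 c.2 (iter j f x) * wave b.1.2 b.2 x)); last first.
    apply/funext => x; rewrite mulr_suml; apply: eq_bigr => c _.
    by rewrite mulr_sumr; apply: eq_bigr => b _; rewrite mulrACA.
  rewrite bmeas_int_sum; last by move=> c; apply: bmeas_sum => b; exact: bmeasZ.
  apply: eq_bigr => c _; rewrite bmeas_int_sum; last by move=> b; exact: bmeasZ.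
  by apply: eq_bigr => b _; rewrite bmeas_intZ.
rewrite !bmeas_int_sum// mulr_suml.
apply: (@cvg_sum _ \oo _ R R^o) => c; rewrite mulr_sumr.
apply: (@cvg_sum _ \oo _ R R^o) => b.
rewrite !(bmeas_intZ mu _ (bmeas_wave L _ _)).
by rewrite mulrACA; apply: cvgMr; exact: mixing_wave.
Qed.

(** Replacing [u] by [t] and [v] by [s] produces five errors: two in the product of the integrals,
    two in the correlation, and one from mixing for [t] and [s]. The polynomial [s] is chosen after
    [t], because its tolerance involves the bound [K] of [t]. *)
Lemma mixing (u v : B -> R) : bounded_measurable u -> bounded_measurable v ->
  I (fun x => u (iter j f x) * v x) @[j --> \oo] --> I u * I v.
Proof.
move=> bu bv; apply/cvgrPdist_lt => e e0.
have pos (x : R) : 0 < `|x| + 1 by rewrite ltr_wpDl.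
have le_pos (x y : R) : y <= x -> y <= `|x| + 1.
  by move=> /le_trans; apply; rewrite (le_trans (ler_norm _))// lerDl.
have [_ [M vM]] := bv.
have e5 : 0 < e / 5 / (`|M| + 1) by rewrite !divr_gt0.
have [_ /(_ _ e5)[t tt ht]] := torus_approx mu (@iter_continuous 1) bu.
have bt := bmeas_trig tt; have [_ [K tK]] := bt.
have e5' : 0 < e / 5 / (`|K| + 1) by rewrite !divr_gt0.
have [_ /(_ _ e5')[s ts hs]] := torus_approx mu (@iter_continuous 1) bv.
have bs := bmeas_trig ts.
have semi (w : B -> R) : bounded_measurable w ->
    I (fun x => `|w x|) <= seminorm mu (iter 1 f) w.
  move=> bw; rewrite /seminorm lerDl; apply: Rintegral_ge0 => x _; exact: normr_ge0.
have but := bmeasB bu bt; have bvs := bmeasB bv bs.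
have hut : (`|M| + 1) * I (fun x => `|u x - t x|) < e / 5.
  by rewrite mulrC -ltr_pdivlMr//; apply: le_lt_trans ht; exact: semi.
have hvs : (`|K| + 1) * I (fun x => `|v x - s x|) < e / 5.
  by rewrite mulrC -ltr_pdivlMr//; apply: le_lt_trans hs; exact: semi.
have bound (w w' : B -> R) (c : R) : bounded_measurable w -> bounded_measurable w' ->
    (forall x, `|w' x| <= c) -> `|I (fun x => w x * w' x)| <= c * I (fun x => `|w x|).
  move=> bw bw' wc; apply: le_trans (bmeas_int_norm mu (bmeasM bw bw')) _.
  rewrite -bmeas_intZ; last exact: bmeas_norm.
  apply: bmeas_int_le; first by apply: bmeas_norm; exact: bmeasM.
    by apply: bmeasZ; exact: bmeas_norm.
  by move=> x; rewrite normrM mulrC ler_wpM2r.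
have e55 : 0 < e / 5 by rewrite divr_gt0.
have /cvgrPdist_lt /(_ _ e55) := mixing_trig tt ts.
apply: filterS => j hj.
have buj := bmeas_comp (mf j) bu; have btj := bmeas_comp (mf j) bt.
have bfs := bmeasM (bmeas_comp (mf j) but) bv.
have bts := bmeasM bvs btj.
have -> : I u * I v - I (fun x => u (iter j f x) * v x) =
   (I u - I t) * I v + I t * (I v - I s)
   + (I t * I s - I (fun x => t (iter j f x) * s x))
   - I (fun x => (u (iter j f x) - t (iter j f x)) * v x)
   - I (fun x => (v x - s x) * t (iter j f x)).
  have -> : I (fun x => u (iter j f x) * v x) =
      I (fun x => (u (iter j f x) - t (iter j f x)) * v x) +
      I (fun x => (v x - s x) * t (iter j f x)) + I (fun x => t (iter j f x) * s x).
    rewrite -(bmeas_intD mu bfs bts) -bmeas_intD; [|exact: (bmeasD bfs bts)|exact: (bmeasM btj bs)].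
    by congr (Rintegral _ _ _); apply/funext => x; rewrite /=; ring.
  ring.
have Iv : `|I v| <= `|M| + 1.
  apply: le_trans (bmeas_int_norm mu bv) _; rewrite -[leRHS](bmeas_int_cst mu).
  by apply: bmeas_int_le => [||x]; [exact: bmeas_norm|exact: bmeas_cst|exact: le_pos].
have It : `|I t| <= `|K| + 1.
  apply: le_trans (bmeas_int_norm mu bt) _; rewrite -[leRHS](bmeas_int_cst mu).
  by apply: bmeas_int_le => [||x]; [exact: bmeas_norm|exact: bmeas_cst|exact: le_pos].
have h1 : `|(I u - I t) * I v| < e / 5.
  rewrite normrM mulrC -bmeas_intB//; apply: le_lt_trans hut.
  by apply: ler_pM => //; exact: (bmeas_int_norm mu but).
have h2 : `|I t * (I v - I s)| < e / 5.
  rewrite normrM -bmeas_intB//; apply: le_lt_trans hvs.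
  by apply: ler_pM => //; exact: (bmeas_int_norm mu bvs).
(* Invariance makes the mean of [|u - t|] along [iter j f] independent of [j]. *)
have h4 : `|I (fun x => (u (iter j f x) - t (iter j f x)) * v x)| < e / 5.
  apply: le_lt_trans (bound _ _ _ (bmeas_comp (mf j) but) bv (fun x => le_pos _ _ (vM x))) _.
  rewrite [X in _ * X](bmeas_int_iter j (bmeas_norm but)) //.
have h5 : `|I (fun x => (v x - s x) * t (iter j f x))| < e / 5.
  exact: le_lt_trans (bound _ _ _ bvs btj (fun x => le_pos _ _ (tK _))) _.
rewrite [e](_ : _ = e / 5 + e / 5 + e / 5 + e / 5 + e / 5); last by field.
apply: le_lt_trans (ler_normB _ _) _; apply: ltrD => //.
apply: le_lt_trans (ler_normB _ _) _; apply: ltrD => //.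
apply: le_lt_trans (ler_normD _ _) _; apply: ltrD => //.
by apply: le_lt_trans (ler_normD _ _) _; apply: ltrD.
Qed.

(** For an invariant set, mixing of its indicator with itself reads [mu D = (mu D)^2]. *)
Lemma haar_ergodic : ergodic_measure mu f.
Proof.
move=> D mD fD; pose u : B -> R := \1_D.
have bu : bounded_measurable u by exact: bmeas_indic.
have uj j x : u (iter j f x) = u x.
  elim: j => // j IH; rewrite iterS -IH /u !indicE; congr (nat_of_bool _)%:R.
  by rewrite -[in RHS]fD; apply/idP/idP; rewrite !inE.
have : I u @[j --> \oo] --> I u * I u.
  have := mixing bu bu; rewrite (_ : (fun j => _) = fun=> I u)//.
  apply/funext => j; congr (Rintegral _ _ _); apply/funext => x.
  rewrite uj /u indicE; by case: (_ \in _); rewrite ?mulr1 ?mulr0.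
move=> /(cvg_unique (@Rhausdorff R) (cvg_cst _)) h.
have {}h : I u * (I u - 1) = 0 by rewrite mulrBr mulr1 -h subrr.
move/eqP: h; rewrite mulf_eq0 subr_eq0 => /orP[] /eqP h.
  by left; rewrite -(bmeas_int_indic mu mD) -/u h.
by right; rewrite -(bmeas_int_indic mu mD) -/u h.
Qed.

End Mixing.

(** * Forms and currents *)

Section FormAlgebra.
Context {R : realType} {g : nat}.
Local Notation C := R[i].
Local Notation V := 'rV[R[i]]_g.

Lemma pq_form0 p q : @pq_form R g p q (fun=> 0).
Proof.
exists (fun _ _ => 0); apply/funext => v.
by rewrite big1// => I _; rewrite big1// => J _; rewrite mul0r.
Qed.

Lemma pq_formD p q (w t : cform R g (p + q)) :
  pq_form p q w -> pq_form p q t -> pq_form p q (fun v => w v + t v).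
Proof.
move=> [c ->] [b ->]; exists (fun I J => c I J + b I J); apply/funext => v.
rewrite -big_split; apply: eq_bigr => I _; rewrite -big_split.
by apply: eq_bigr => J _; rewrite mulrDl.
Qed.

Lemma pq_formZ p q a (w : cform R g (p + q)) :
  pq_form p q w -> pq_form p q (fun v => a * w v).
Proof.
move=> [c ->]; exists (fun I J => a * c I J); apply/funext => v.
rewrite mulr_sumr; apply: eq_bigr => I _; rewrite mulr_sumr.
by apply: eq_bigr => J _; rewrite mulrA.
Qed.

Lemma pq_form_sum p q (T : Type) (r : seq T) (F : T -> cform R g (p + q)) :
  (forall i, pq_form p q (F i)) -> pq_form p q (fun v => \sum_(i <- r) F i v).
Proof.
move=> hF; elim: r => [|i r IH].
  by under eq_fun do rewrite big_nil; exact: pq_form0.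
by under eq_fun do rewrite big_cons; exact: pq_formD.
Qed.

Lemma dz_wedge_ffun p q (I : 'I_p -> 'I_g) (J : 'I_q -> 'I_g) (v : 'I_(p + q) -> V) :
  dz_wedge (finfun I) (finfun J) v = dz_wedge I J v.
Proof.
rewrite /dz_wedge; congr (\det _); apply/matrixP => a b; rewrite !mxE.
by case: fintype.split => i; rewrite ffunE.
Qed.

Lemma pq_form_dz p q (I : 'I_p -> 'I_g) (J : 'I_q -> 'I_g) :
  pq_form p q (dz_wedge I J : cform R g (p + q)).
Proof.
exists (fun I' J' => ((I' == finfun I) && (J' == finfun J))%:R).
apply/funext => v; rewrite (bigD1 (finfun I))//= (bigD1 (finfun J))//=.
rewrite !eqxx mul1r dz_wedge_ffun big1 ?addr0; last first.
  by move=> J' /negbTE ->; rewrite andbF mul0r.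
rewrite big1 ?addr0// => I' /negbTE ->; rewrite big1// => J' _.
by rewrite mul0r.
Qed.

Lemma det_sum_rows n (K : 'I_n -> 'I_g -> C) (Y : 'I_n -> 'I_g -> 'I_n -> C) :
  \det (\matrix_(a, b) \sum_l K a l * Y a l b) =
  \sum_(h : {ffun 'I_n -> 'I_g}) (\prod_a K a (h a)) *
    \det (\matrix_(a, b) Y a (h a) b).
Proof.
rewrite /determinant.
under [RHS]eq_bigr do rewrite mulr_sumr.
rewrite exchange_big; apply: eq_bigr => s _.
transitivity ((-1) ^+ s * \prod_a \sum_l (K a l * Y a l (s a))).
  by congr (_ * _); apply: eq_bigr => a _; rewrite mxE.
rewrite bigA_distr_bigA mulr_sumr; apply: eq_bigr => h _.
rewrite big_split /= mulrCA; congr (_ * (_ * _)).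
by apply: eq_bigr => a _; rewrite mxE.
Qed.

(** A complex linear substitution sends each [dz_i] to a combination of the [dz_l] and each
    conjugate to a combination of conjugates. The matrix [K] holds these coefficients, and the
    determinant is expanded along its rows. *)
Lemma pq_form_linear p q (M : 'M[C]_g) (w : cform R g (p + q)) :
  pq_form p q w -> pq_form p q (fun v => w (fun b => v b *m M)).
Proof.
move=> [c ->]; apply: pq_form_sum => I; apply: pq_form_sum => J.
apply: pq_formZ.
pose K (a : 'I_(p + q)) (l : 'I_g) : C := match fintype.split a with
  | inl i => M l (I i) | inr j => conjc (M l (J j)) end.
pose Y (v : 'I_(p + q) -> V) (a : 'I_(p + q)) (l : 'I_g) (b : 'I_(p + q)) : C :=
  match fintype.split a with
  | inl i => v b ord0 l | inr j => conjc (v b ord0 l) end.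
rewrite (_ : (fun v => _) = fun v => \sum_(h : {ffun 'I_(p + q) -> 'I_g})
    (\prod_a K a (h a)) *
      dz_wedge (fun i => h (lshift q i)) (fun j => h (rshift p j)) v).
  by apply: pq_form_sum => h; apply: pq_formZ; exact: pq_form_dz.
apply/funext => v; rewrite /dz_wedge.
transitivity (\det (\matrix_(a, b) \sum_l K a l * Y v a l b)).
  congr (\det _); apply/matrixP => a b; rewrite !mxE /K /Y.
  case: fintype.split => i; first by rewrite mxE; apply: eq_bigr => l _; rewrite mulrC.
  by rewrite mxE rmorph_sum; apply: eq_bigr => l _; rewrite rmorphM mulrC.
rewrite det_sum_rows; apply: eq_bigr => h _; congr (_ * \det _).
apply/matrixP => a b; rewrite !mxE /Y.
by case: (split_ordP a) => i ->.
Qed.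

(** * Constant forms in an eigenbasis of the lift *)

Section Eigenbasis.
Variables (A U : 'M[C]_g) (d : 'rV[C]_g).
Hypotheses (Uu : U \in unitmx) (UA : U *m A = diag_mx d *m U).
Variables p q : nat.
Let T : finType := ({ffun 'I_p -> 'I_g} * {ffun 'I_q -> 'I_g})%type.

(** The rows of [U] are eigenvectors of [A], and [v b *m invmx U] gives the coordinates of [v b] in
    this basis: these are the wedges of the dual coordinate forms and their conjugates. *)
Definition eigen_wedge (t : T) : cform R g (p + q) :=
  fun v => dz_wedge t.1 t.2 (fun b => v b *m invmx U).

Definition eigen_weight (t : T) : C :=
  \prod_(a < p + q) match fintype.split a with
    | inl i => d ord0 (t.1 i) | inr j => conjc (d ord0 (t.2 j)) end.

Lemma eigen_wedge_pullback t v :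
  eigen_wedge t (fun b => v b *m A) = eigen_weight t * eigen_wedge t v.
Proof.
have AW : A *m invmx U = invmx U *m diag_mx d.
  by rewrite -[A in LHS](mulKmx Uu) UA !mulmxA mulmxK.
pose c : 'rV[C]_(p + q) := \row_a match fintype.split a with
    | inl i => d ord0 (t.1 i) | inr j => conjc (d ord0 (t.2 j)) end.
have -> : eigen_weight t = \det (diag_mx c).
  by rewrite det_diag; apply: eq_bigr => a _; rewrite mxE.
rewrite /eigen_wedge /dz_wedge -det_mulmx; congr (\det _).
apply/matrixP => a b; rewrite mul_diag_mx !mxE.
case: fintype.split => i.
  by rewrite -mulmxA AW mulmxA mul_mx_diag mxE mulrC.
by rewrite -mulmxA AW mulmxA mul_mx_diag mxE mulrC rmorphM.
Qed.

Lemma eigen_wedge_iter t v j :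
  eigen_wedge t (fun b => v b *m A ^+ j) = eigen_weight t ^+ j * eigen_wedge t v.
Proof.
elim: j => [|j IH].
  by rewrite expr0 mul1r; congr (eigen_wedge t _); apply/funext => b; rewrite mulmx1.
rewrite [in RHS]exprS -mulrA -IH -eigen_wedge_pullback.
by congr (eigen_wedge t _); apply/funext => b; rewrite exprSr mulmxA.
Qed.

Lemma pq_form_eigen t : pq_form p q (eigen_wedge t).
Proof. by apply: pq_form_linear; exact: pq_form_dz. Qed.

Lemma pq_form_eigenP (w : cform R g (p + q)) : pq_form p q w ->
  exists c : T -> C, w = fun v => \sum_t c t * eigen_wedge t v.
Proof.
move=> /(pq_form_linear U)[c wc].
exists (fun t => c t.1 t.2); apply/funext => v.
transitivity (w (fun b => (v b *m invmx U) *m U)).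
  by congr w; apply/funext => b; rewrite mulmxKV.
have := congr1 (fun h => h (fun b => v b *m invmx U)) wc => /= ->.
by rewrite pair_bigA.
Qed.

End Eigenbasis.
End FormAlgebra.

(** * Coefficients read off from finitely many values *)

Section Coefficients.
Variables (F : fieldType) (S : Type) (T : eqType) (phi : T -> S -> F).

(** Such a functional, applied to [Omega x], yields a finite combination of the functions
    [Omega x v], and so inherits their measurability and boundedness. *)
Definition evaluation_comb (l : (S -> F) -> F) : Prop :=
  exists e : seq (F * S), forall w, l w = \sum_(a <- e) a.1 * w a.2.

Lemma evaluation_combZD c l l' : evaluation_comb l -> evaluation_comb l' ->
  evaluation_comb (fun w => c * l w + l' w).
Proof.
move=> [e he] [e' he']; exists ([seq (c * a.1, a.2) | a <- e] ++ e') => w.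
rewrite he he' big_cat big_map mulr_sumr; congr (_ + _).
by apply: eq_bigr => a _; rewrite mulrA.
Qed.

Lemma evaluation_comb0 : evaluation_comb (fun=> 0).
Proof. by exists [::] => w; rewrite big_nil. Qed.

Lemma evaluation_comb_at s : evaluation_comb (fun w => w s).
Proof. by exists [:: (1, s)] => w; rewrite big_seq1 mul1r. Qed.

Lemma evaluation_comb_sum I (r : seq I) (c : I -> F) (l : I -> (S -> F) -> F) :
  (forall i, evaluation_comb (l i)) ->
  evaluation_comb (fun w => \sum_(i <- r) c i * l i w).
Proof.
move=> hl; elim: r => [|i r IH].
  by under eq_fun do rewrite big_nil; exact: evaluation_comb0.
by under eq_fun do rewrite big_cons; exact: evaluation_combZD.
Qed.

Lemma evaluation_comb_linear l : evaluation_comb l -> forall c w w',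
  l (fun s => c * w s + w' s) = c * l w + l w'.
Proof.
move=> [e he] c w w'; rewrite !he mulr_sumr -big_split.
by apply: eq_bigr => a _; rewrite mulrDr mulrCA.
Qed.

(* Induction on r: if phi i is not reproduced by the functionals found for the
   other functions, its coefficient is read off at a point s0 where it is not. *)
Lemma coefficients_from_values (r : seq T) : uniq r ->
  exists l : T -> (S -> F) -> F, (forall i, evaluation_comb (l i)) /\
  forall (c : T -> F) (w : S -> F), w = (fun s => \sum_(i <- r) c i * phi i s) ->
  forall s, w s = \sum_(i <- r) l i w * phi i s.
Proof.
elim: r => [_|i r IH /= /andP[ir ur]].
  exists (fun _ _ => 0); split=> [_|c w -> s]; first exact: evaluation_comb0.
  by rewrite !big_nil.
have [l [le lw]] := IH ur.
pose P w s := \sum_(k <- r) l k w * phi k s.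
have PZD c w w' s : P (fun s => c * w s + w' s) s = c * P w s + P w' s.
  rewrite /P mulr_sumr -big_split; apply: eq_bigr => k _.
  by rewrite (evaluation_comb_linear (le k)) mulrDl mulrA.
(* Whatever the coefficients [c], the part of [w] that [P] does not reproduce comes from [phi i]
   alone. *)
have key c w : w = (fun s => \sum_(k <- i :: r) c k * phi k s) ->
    forall s, w s - P w s = c i * (phi i s - P (phi i) s).
  move=> wE s; pose wr s := \sum_(k <- r) c k * phi k s.
  have -> : w = (fun s => c i * phi i s + wr s).
    by rewrite wE; apply/funext => u; rewrite big_cons.
  by rewrite PZD -[P wr s](lw c wr erefl); ring.
(* No independence is assumed: a [phi i] in the span of the other functions receives the coefficient
   0. *)
have [r0|/existsNP[s0 /eqP rs0]] := pselect (forall s, phi i s - P (phi i) s = 0).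
  exists (fun k => if k == i then fun=> 0 else l k); split=> [k|c w wE s].
    by case: ifP => _ //; exact: evaluation_comb0.
  rewrite big_cons eqxx mul0r add0r.
  have /eqP := key c w wE s; rewrite r0 mulr0 subr_eq0 => /eqP ->.
  rewrite /P !big_seq; apply: eq_bigr => k kr.
  by rewrite ifN//; apply: contraNneq ir => <-.
pose rho := phi i s0 - P (phi i) s0.
pose li w := rho^-1 * w s0 + \sum_(k <- r) (- (rho^-1 * phi k s0)) * l k w.
have lie : evaluation_comb li.
  by apply: evaluation_combZD; [exact: evaluation_comb_at|exact: evaluation_comb_sum].
have liE c w : w = (fun s => \sum_(k <- i :: r) c k * phi k s) -> li w = c i.
  move=> wE; have := key c w wE s0; rewrite -/rho => h.
  have -> : li w = rho^-1 * (w s0 - P w s0).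
    rewrite /li /P mulrBr mulr_sumr -sumrN; congr (_ + _).
    by apply: eq_bigr => k _; ring.
  by rewrite h mulrCA mulVf ?mulr1.
exists (fun k => if k == i then li else fun w => (- l k (phi i)) * li w + l k w).
split=> [k|c w wE s].
  by case: ifP => _ //; exact: evaluation_combZD.
rewrite big_cons eqxx.
have -> : \sum_(k <- r) (if k == i then li else fun w => - l k (phi i) * li w + l k w) w * phi k s
    = P w s - li w * P (phi i) s.
  rewrite /P mulr_sumr -sumrB !big_seq; apply: eq_bigr => k kr.
  rewrite ifN; last by apply: contraNneq ir => <-.
  by ring.
have := key c w wE s; rewrite (liE c w wE) => h.
by rewrite -[LHS](subrK (P w s)) h; ring.
Qed.

End Coefficients.

(** * Cesaro means twisted by a geometric sequence *)

Section Cesaro.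
Context {R : realType}.
Local Notation C := R[i].

(** The norm of [R[i]] takes values in [R[i]]; its real part allows comparison and squeezing in
    [R]. *)
Definition modulus (z : C) : R := complex.Re `|z|.

Lemma modulusE z : real_complex R (modulus z) = `|z|.
Proof. exact: RRe_norm. Qed.

Lemma modulus_ge0 z : 0 <= modulus z.
Proof. by rewrite -lecR modulusE normr_ge0. Qed.

Lemma modulus0 : modulus 0 = 0.
Proof. by rewrite /modulus normr0. Qed.

Lemma modulusM z w : modulus (z * w) = modulus z * modulus w.
Proof. by apply: complexI; rewrite rmorphM !modulusE normrM. Qed.

Lemma modulusX z n : modulus (z ^+ n) = modulus z ^+ n.
Proof. by apply: complexI; rewrite rmorphXn !modulusE normrX. Qed.

Lemma modulusD z w : modulus (z + w) <= modulus z + modulus w.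
Proof. by rewrite -lecR rmorphD !modulusE ler_normD. Qed.

Lemma modulusN z : modulus (- z) = modulus z.
Proof. by rewrite /modulus normrN. Qed.

Lemma modulus_real (a : R) : modulus (real_complex R a) = `|a|.
Proof. by rewrite /modulus normc_def /= expr0n addr0 sqrtr_sqr. Qed.

Lemma modulusV z : modulus z^-1 = (modulus z)^-1.
Proof. by apply: complexI; rewrite fmorphV !modulusE normfV. Qed.

Lemma modulus_natV n : modulus (n%:R^-1) = n%:R^-1.
Proof. by rewrite -(rmorph_nat (real_complex R)) modulusV modulus_real ger0_norm. Qed.

Lemma modulus_sum I (r : seq I) (F : I -> C) :
  modulus (\sum_(i <- r) F i) <= \sum_(i <- r) modulus (F i).
Proof.
elim: r => [|i r IH]; first by rewrite !big_nil modulus0.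
by rewrite !big_cons; apply: le_trans (modulusD _ _) _; rewrite lerD2l.
Qed.

Lemma cvg_modulusP (T : Type) (F : set_system T) {FF : Filter F} (z : T -> C) (l : C) :
  (z t @[t --> F] --> l) <-> (modulus (z t - l) @[t --> F] --> (0 : R)).
Proof.
split=> [zl|/cvgrPdist_lt h].
  apply/cvgrPdist_lt => e e0.
  have {}zl : \forall t \near F, `|l - z t| < real_complex R e.
    exact: zl _ (near_complex_dist l e0).
  near=> t; rewrite sub0r normrN ger0_norm ?modulus_ge0//.
  by rewrite -ltcR modulusE distrC; near: t.
move=> A /nbhs_ballP[e /= e0 eA].
have [r re] : exists r, e = real_complex R r.
  by exists (complex.Re e); rewrite RRe_real// gtr0_real.
move: e0 eA; rewrite {e}re ltcR => r0 eA.
suff : \forall t \near F, A (z t) by [].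
near=> t; apply: eA => /=.
suff : `|l - z t| < real_complex R r by [].
rewrite distrC -modulusE ltcR -[ltLHS]ger0_norm ?modulus_ge0//.
by rewrite -normrN -sub0r; near: t; exact: h.
Unshelve. all: by end_near. Qed.

(** With [z j = l + e j], the errors [e j] average to 0 because the powers of [a] are bounded by 1.
    The powers themselves average to 1 if [a = 1]; otherwise their sums are bounded by
    [2/|a - 1|]. *)
Lemma cvg_cesaro_twist (a l : C) (z : nat -> C) : modulus a <= 1 ->
  z j @[j --> \oo] --> l ->
  N%:R^-1 * \sum_(1 <= j < N.+1) (a ^+ j * z j) @[N --> \oo] -->
  (if a == 1 then l else 0).
Proof.
move=> a1 zl; pose e j := z j - l.
have e0 : modulus (e j) @[j --> \oo] --> (0 : R) by apply/cvg_modulusP.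
have e0' : modulus (e j.+1) @[j --> \oo] --> (0 : R).
  by move: e0; rewrite -cvg_shiftS.
have mean0 : n.+1%:R^-1 * \sum_(1 <= j < n.+2) modulus (e j) @[n --> \oo] --> (0 : R).
  rewrite (_ : (fun n => _) = arithmetic_mean (fun j => modulus (e j.+1))).
    exact: cesaro.
  by apply/funext => n; rewrite big_add1.
have part1 : N%:R^-1 * \sum_(1 <= j < N.+1) (a ^+ j * e j) @[N --> \oo] --> (0 : C).
  rewrite -cvg_shiftS; apply/cvg_modulusP.
  apply: (squeeze_cvgr _ (cvg_cst 0) mean0); apply: nearW => n.
  rewrite modulus_ge0 subr0 modulusM modulus_natV ler_wpM2l ?invr_ge0//.
  apply: le_trans (modulus_sum _ _) _; apply: ler_sum => j _.
  by rewrite modulusM modulusX ler_piMl ?modulus_ge0// exprn_ile1 ?modulus_ge0.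
have part2 : N%:R^-1 * \sum_(1 <= j < N.+1) a ^+ j @[N --> \oo] -->
    (if a == 1 then 1 else 0 : C).
  rewrite -cvg_shiftS; have [->|na] := eqVneq a 1.
    apply: cvg_near_cst; apply: nearW => n /=.
    rewrite (eq_bigr (fun=> 1)) => [|j _]; last exact: expr1n.
    by rewrite sumr_const_nat subn1/= mulVf// pnatr_eq0.
  have na' : a - 1 != 0 by rewrite subr_eq0.
  have h n : \sum_(1 <= j < n.+2) a ^+ j = a * ((a ^+ n.+1 - 1) / (a - 1)).
    rewrite subrX1 mulrAC mulfV// mul1r big_add1 /= big_mkord mulr_sumr.
    by apply: eq_bigr => j _; rewrite exprS.
  apply/cvg_modulusP.
  have c0 : (2 / modulus (a - 1)) * n.+1%:R^-1 @[n --> \oo] --> (0 : R).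
    by rewrite -[X in _ --> X](mulr0 (2 / modulus (a - 1))); apply: cvgMr; exact: cvg_harmonic.
  apply: (squeeze_cvgr _ (cvg_cst 0) c0); apply: nearW => n.
  rewrite modulus_ge0 subr0 modulusM modulus_natV mulrC ler_wpM2r ?invr_ge0//.
  rewrite h modulusM -[leRHS]mul1r ler_pM ?modulus_ge0//.
  rewrite modulusM modulusV ler_wpM2r ?invr_ge0 ?modulus_ge0//.
  apply: le_trans (modulusD _ _) _; rewrite modulusN modulusX.
  have m1 : modulus 1 = 1 by rewrite -(rmorph1 (real_complex R)) modulus_real normr1.
  have : modulus a ^+ n.+1 <= 1 by rewrite exprn_ile1 ?modulus_ge0.
  rewrite m1; lra.
have -> : (fun N => N%:R^-1 * \sum_(1 <= j < N.+1) (a ^+ j * z j)) =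
  (fun N => N%:R^-1 * \sum_(1 <= j < N.+1) (a ^+ j * e j) +
    (N%:R^-1 * \sum_(1 <= j < N.+1) a ^+ j) * l).
  apply/funext => N; rewrite -mulrA -mulrDr mulr_suml -big_split; congr (_ * _).
  by apply: eq_bigr => j _; rewrite /e /=; ring.
have -> : (if a == 1 then l else 0) = 0 + (if a == 1 then 1 else 0) * l.
  by case: ifP; rewrite add0r ?mul1r ?mul0r.
apply: (@cvgD _ C^o _ \oo); first exact: part1.
by apply: (@cvgM C _ \oo); [exact: part2|exact: cvg_cst].
Qed.

End Cesaro.

(** * Complex coefficients on the compact torus *)

Section TorusCompact.
Context {R : realType} {g : nat} (L : lattice R g).
Local Notation C := R[i].
Local Notation X := (torus L).
Local Notation B := (borel (torus L)).

Lemma torus_unit_cube (x : X) : exists2 t : 'rV[R]_(g + g),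
  (forall i, `[0, 1]%classic (t ord0 i)) & x = torus_pi L (of_rcoord L t).
Proof.
have [z ->] := torus_pi_surj x; pose n := \row_i Num.floor (rcoord L z ord0 i).
exists (rcoord L z - map_mx intr n).
  move=> i; have -> : (rcoord L z - map_mx intr n) ord0 i =
      rcoord L z ord0 i - (Num.floor (rcoord L z ord0 i))%:~R.
    by rewrite mxE; congr (_ + _); rewrite !mxE.
  have /andP[h1 h2] := floor_itv (rcoord L z ord0 i).
  rewrite /= in_itv /= subr_ge0 h1 /= lerBlDl; apply: ltW.
  by move: h2; rewrite intrD.
apply/torus_piP/lattice_setP; exists n.
rewrite -[z in z - _](rcoordK L) rcoordD rcoordN !of_rcoordK.
by rewrite opprB addrC subrK.
Qed.

(** The torus is the image of the compact unit cube of real coordinates. *)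
Lemma torus_continuous_bounded (u : X -> R) : continuous u ->
  exists M, forall x, `|u x| <= M.
Proof.
move=> cu.
pose cube := [set t : 'rV[R]_(g + g) | forall i, `[0, 1]%classic (t ord0 i)].
have cube0 : cube !=set0.
  by exists 0 => i; rewrite mxE /= in_itv /= lexx ler01.
have ccube : compact cube.
  exact: (@rV_compact _ (g + g) _ (fun=> @segment_compact R 0 1)).
pose w t := `|u (torus_pi L (of_rcoord L t))|.
have cw : continuous w.
  move=> t; apply: (@cvg_norm _ _ _ (nbhs t)).
  apply: (@continuous_comp _ _ _ (torus_pi L \o of_rcoord L) u); last exact: cu.
  apply: (@continuous_comp _ _ _ (@of_rcoord R g 1 L) (torus_pi L)).
    exact: continuous_of_rcoord.
  exact: torus_pi_continuous.
have [c _ hc] := EVT_max_rV cube0 ccube (continuous_subspaceT cw).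
exists (w c) => x; have [t tc ->] := torus_unit_cube x.
by apply: hc; rewrite inE.
Qed.

Lemma bmeas_continuous (u : X -> R) : continuous u -> bounded_measurable (u : B -> R).
Proof.
by move=> cu; split; [exact: continuous_borel_measurable|exact: torus_continuous_bounded].
Qed.

Definition complex_bmeas (u : X -> C) : Prop :=
  bounded_measurable ((fun x => complex.Re (u x)) : B -> R) /\
  bounded_measurable ((fun x => complex.Im (u x)) : B -> R).

Lemma complex_ReM (z w : C) : complex.Re (z * w) =
  complex.Re z * complex.Re w - complex.Im z * complex.Im w.
Proof. by case: z w => ? ? []. Qed.

Lemma complex_ImM (z w : C) : complex.Im (z * w) =
  complex.Re z * complex.Im w + complex.Im z * complex.Re w.
Proof. by case: z w => ? ? []. Qed.

Lemma complex_bmeas_cst c : complex_bmeas (fun=> c).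
Proof. by split; exact: bmeas_cst. Qed.

Lemma complex_bmeasD u v : complex_bmeas u -> complex_bmeas v ->
  complex_bmeas (fun x => u x + v x).
Proof.
move=> [ur ui] [vr vi]; split.
  by under eq_fun do rewrite ReD; exact: bmeasD.
by under eq_fun do rewrite ImD; exact: bmeasD.
Qed.

Lemma complex_bmeasM u v : complex_bmeas u -> complex_bmeas v ->
  complex_bmeas (fun x => u x * v x).
Proof.
move=> [ur ui] [vr vi]; split.
  under eq_fun do rewrite complex_ReM.
  by apply: bmeasB; exact: bmeasM.
under eq_fun do rewrite complex_ImM.
by apply: bmeasD; exact: bmeasM.
Qed.

Lemma complex_bmeasZ c u : complex_bmeas u -> complex_bmeas (fun x => c * u x).
Proof. exact: (complex_bmeasM (complex_bmeas_cst c)). Qed.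

Lemma complex_bmeas_sum I (r : seq I) (F : I -> X -> C) :
  (forall i, complex_bmeas (F i)) -> complex_bmeas (fun x => \sum_(i <- r) F i x).
Proof.
move=> bF; elim: r => [|i r IH].
  by under eq_fun do rewrite big_nil; exact: complex_bmeas_cst.
by under eq_fun do rewrite big_cons; exact: complex_bmeasD.
Qed.

Lemma complex_bmeas_comp (S : X -> X) u : continuous S -> complex_bmeas u ->
  complex_bmeas (fun x => u (S x)).
Proof.
move=> /continuous_borel_measurable_self mS [ur ui].
by split; [exact: (bmeas_comp mS ur)|exact: (bmeas_comp mS ui)].
Qed.

Lemma complex_bmeas_evaluation n (W : X -> cform R g n) (l : cform R g n -> C) :
  evaluation_comb l -> (forall v, complex_bmeas (fun x => W x v)) ->
  complex_bmeas (fun x => l (W x)).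
Proof.
move=> [e he] bW; under eq_fun do rewrite he.
by apply: complex_bmeas_sum => a; exact: complex_bmeasZ.
Qed.

Lemma smooth_form_bmeas p q (W : X -> cform R g (p + q)) v :
  smooth_form p q W -> complex_bmeas (fun x => W x v).
Proof.
move=> [_ /(_ v)/(_ 0%N)[/= [cr _] [ci _]]].
have realifyK (z : 'rV[C]_g) : of_real_coord (realify z) = z.
  by apply/rowP => j; rewrite mxE row_mxEl row_mxEr !mxE; case: (z ord0 j).
split; apply: bmeas_continuous; apply: torus_continuousP.
  rewrite (_ : _ \o _ = (fun x => complex.Re (W (torus_pi L (of_real_coord x)) v)) \o
      @realify R 1 g); last by apply/funext => z; rewrite /= realifyK.
  by move=> z; apply: continuous_comp; [exact: continuous_realify|exact: cr].
rewrite (_ : _ \o _ = (fun x => complex.Im (W (torus_pi L (of_real_coord x)) v)) \o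
    @realify R 1 g); last by apply/funext => z; rewrite /= realifyK.
by move=> z; apply: continuous_comp; [exact: continuous_realify|exact: ci].
Qed.

Variable mu : probability B R.
Local Notation CI := (complex_integral mu).

Lemma complex_intD u v : complex_bmeas u -> complex_bmeas v ->
  CI (fun x => u x + v x) = CI u + CI v.
Proof.
move=> [ur ui] [vr vi]; rewrite /complex_integral.
under eq_Rintegral do rewrite ReD.
under [X in Complex _ X]eq_Rintegral do rewrite ImD.
by rewrite !bmeas_intD.
Qed.

Lemma complex_intZ c u : complex_bmeas u -> CI (fun x => c * u x) = c * CI u.
Proof.
case: c => a b [ur ui]; rewrite /complex_integral.
under eq_Rintegral do rewrite complex_ReM.
under [X in Complex _ X]eq_Rintegral do rewrite complex_ImM.
rewrite bmeas_intB; try exact: bmeasZ.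
rewrite bmeas_intD; try exact: bmeasZ.
by rewrite !bmeas_intZ.
Qed.

Lemma complex_int_cst c : CI (fun=> c) = c.
Proof. by rewrite /complex_integral !bmeas_int_cst; case: c. Qed.

Lemma complex_int_sum I (r : seq I) (F : I -> X -> C) :
  (forall i, complex_bmeas (F i)) ->
  CI (fun x => \sum_(i <- r) F i x) = \sum_(i <- r) CI (F i).
Proof.
move=> bF; elim: r => [|i r IH].
  by rewrite big_nil; under eq_fun do rewrite big_nil; exact: complex_int_cst.
rewrite big_cons -IH -complex_intD//; last exact: complex_bmeas_sum.
by congr (CI _); apply/funext => x; rewrite big_cons.
Qed.

Variables (haar_mu : haar mu).
Variables (f : X -> X) (A : 'M[C]_g) (N : 'M[int]_(g + g)).
Hypotheses (fA : linear_lift f A) (PA : periods L *m A = map_mx intr N *m periods L).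
Hypothesis orbit_inj : forall n : 'rV[int]_(g + g), n != 0 ->
  injective (fun j => n *m (N ^+ j)^T).

Lemma complex_mixing u v : complex_bmeas u -> complex_bmeas v ->
  CI (fun x => u (iter j f x) * v x) @[j --> \oo] --> CI u * CI v.
Proof.
move=> [ur ui] [vr vi].
have mixR (a b : B -> R) : bounded_measurable a -> bounded_measurable b ->
  \int[mu]_x (a (iter j f x) * b x) @[j --> \oo] -->
    (\int[mu]_x a x) * (\int[mu]_x b x).
  exact: (mixing haar_mu fA PA orbit_inj).
have bm (a b : B -> R) j : bounded_measurable a -> bounded_measurable b ->
    bounded_measurable (fun x : B => a (iter j f x) * b x : R).
  move=> ba bb; apply: bmeasM => //; apply: (bmeas_comp _ ba).
  exact: continuous_borel_measurable_self (linear_lift_continuous (linear_lift_iter j fA)).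
apply: cvg_complex.
  rewrite complex_ReM /=.
  rewrite (_ : (fun j => _) = fun j =>
    \int[mu]_x (complex.Re (u (iter j f x)) * complex.Re (v x)) -
    \int[mu]_x (complex.Im (u (iter j f x)) * complex.Im (v x))).
    by apply: (@cvgB _ R^o _ \oo); exact: mixR.
  apply/funext => j; rewrite /complex_integral /=.
  under eq_Rintegral do rewrite complex_ReM.
  by rewrite (bmeas_intB mu (bm _ _ j ur vr) (bm _ _ j ui vi)).
rewrite complex_ImM /=.
rewrite (_ : (fun j => _) = fun j =>
  \int[mu]_x (complex.Re (u (iter j f x)) * complex.Im (v x)) +
  \int[mu]_x (complex.Im (u (iter j f x)) * complex.Re (v x))).
  by apply: (@cvgD _ R^o _ \oo); exact: mixR.
apply/funext => j; rewrite /complex_integral /=.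
under eq_Rintegral do rewrite complex_ImM.
by rewrite (bmeas_intD mu (bm _ _ j ur vi) (bm _ _ j ui vr)).
Qed.

End TorusCompact.

(** * Convergence of the averaged currents *)

Section EigenCurrents.
Context {R : realType} {g : nat} (L : lattice R g).
Local Notation C := R[i].
Local Notation X := (torus L).
Local Notation B := (borel (torus L)).
Local Notation V := 'rV[R[i]]_g.
Variables (mu : probability B R) (haar_mu : haar mu).
Local Notation CI := (complex_integral mu).
Variables (f : X -> X) (A : 'M[C]_g) (N : 'M[int]_(g + g)).
Hypotheses (fA : linear_lift f A) (PA : periods L *m A = map_mx intr N *m periods L).
Hypothesis orbit_inj : forall n : 'rV[int]_(g + g), n != 0 ->
  injective (fun j => n *m (N ^+ j)^T).
Variables (U : 'M[C]_g) (d : 'rV[C]_g).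
Hypotheses (Uu : U \in unitmx) (UA : U *m A = diag_mx d *m U).

Lemma pullback_iter n (W : X -> cform R g n) j x v :
  pullback (iter j f) W x v = W (iter j f x) (fun a => v a *m A ^+ j).
Proof.
rewrite /pullback; congr (W _ _); apply/funext => a.
exact: tangent_linear (linear_lift_iter j fA).
Qed.

Lemma pullback_lift n (W : X -> cform R g n) x v :
  pullback f W x v = W (f x) (fun a => v a *m A).
Proof. by rewrite (pullback_iter W 1). Qed.

Variable k : nat.
Let T : finType := ({ffun 'I_k -> 'I_g} * {ffun 'I_k -> 'I_g})%type.
Let phi (t : T) : cform R g (k + k) := eigen_wedge U t.
Let weight (t : T) : C := eigen_weight d t.
Let lambda : R := dynamical_degree f k.

Lemma eigenform_wedge (c : T -> C) (l : C) : (forall t, c t != 0 -> weight t = l) ->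
  eigenform f k l (fun v => \sum_t c t * phi t v).
Proof.
move=> cl; split.
  apply: pq_form_sum => t; apply: pq_formZ; exact: pq_form_eigen.
apply/funext => x; apply/funext => v; rewrite pullback_lift mulr_sumr.
apply: eq_bigr => t _; rewrite /phi (eigen_wedge_pullback Uu UA).
have [->|ct] := eqVneq (c t) 0; first by rewrite !mul0r mulr0.
by rewrite -/(weight t) (cl t ct) mulrCA.
Qed.

(* The polynomial Q with the weights as roots satisfies Q(f^* ) = 0. *)
Lemma eigenvalue_is_weight l w v0 : eigenform f k l w -> w v0 != 0 ->
  exists t, l = weight t.
Proof.
move=> [wpq wl] wv0.
have wA v : w (fun b => v b *m A) = l * w v.
  have := congr1 (fun h => h (0 : X) v) wl => /= <-.
  by rewrite pullback_lift.
have wAj j v : w (fun b => v b *m A ^+ j) = l ^+ j * w v.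
  elim: j v => [|j IH] v.
    by rewrite expr0 mul1r; congr w; apply/funext => b; rewrite mulmx1.
  rewrite [in RHS]exprS -mulrA -IH -wA.
  by congr w; apply/funext => b; rewrite exprSr mulmxA.
have [c wc] := pq_form_eigenP Uu wpq.
have wj j : l ^+ j * w v0 = \sum_t c t * (weight t ^+ j * phi t v0).
  rewrite -wAj wc; apply: eq_bigr => t _; congr (_ * _).
  exact: eigen_wedge_iter.
pose Q : {poly C} := \prod_t ('X - (weight t)%:P).
have : Q.[l] * w v0 = 0.
  rewrite horner_coef mulr_suml.
  under eq_bigr do rewrite -mulrA wj mulr_sumr.
  rewrite exchange_big big1// => t _.
  transitivity (c t * phi t v0 * Q.[weight t]).
    rewrite horner_coef mulr_sumr; apply: eq_bigr => i _; ring.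
  have -> : Q.[weight t] = 0.
    by rewrite horner_prod (bigD1 t)//= hornerXsubC subrr mul0r.
  by rewrite mulr0.
move=> /eqP; rewrite mulf_eq0 (negbTE wv0) orbF horner_prod => /prodf_eq0[t _].
by rewrite hornerXsubC subr_eq0 => /eqP ->; exists t.
Qed.

Lemma eigenform_eigen_wedge t : eigenform f k (weight t) (phi t).
Proof.
have := @eigenform_wedge (fun s => (s == t)%:R) (weight t).
rewrite (_ : (fun v => _) = phi t).
  by apply => s; have [->//|_] := eqVneq s t; rewrite mulr0n eqxx.
apply/funext => u; rewrite (bigD1 t)//= eqxx mul1r big1 ?addr0//.
by move=> s /negbTE ->; rewrite mul0r.
Qed.

(** A wedge with a repeated index vanishes, and its weight need not be an eigenvalue; hence the
    condition that [phi t] be nonzero. The supremum defining the dynamical degree is finite because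
    every eigenvalue is one of finitely many weights. *)
Lemma weight_le t v : phi t v != 0 -> modulus (weight t) <= lambda.
Proof.
move=> pv.
have wt : [set complex.Re `|lam| | lam in [set lam : C |
    exists2 w, eigenform f k lam w & exists v, w v != 0]] (modulus (weight t)).
  exists (weight t) => //; exists (phi t); last by exists v.
  exact: eigenform_eigen_wedge.
apply: sup_upper_bound => //; split; first by eexists; exact: wt.
exists (\sum_t modulus (weight t)) => _ [l [w wl [u wu]] <-].
have [s ->] := eigenvalue_is_weight wl wu.
by rewrite (bigD1 s)//= lerDl sumr_ge0// => s' _; exact: modulus_ge0.
Qed.

Let ratio (t : T) : C := weight t / real_complex R lambda.

Lemma ratio_le1 t v : phi t v != 0 -> modulus (ratio t) <= 1.
Proof.
move=> /weight_le wl; rewrite /ratio modulusM modulusV modulus_real.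
have l0 : 0 <= lambda by apply: le_trans (modulus_ge0 _) wl.
rewrite ger0_norm//; have [->|ln] := eqVneq lambda 0; first by rewrite invr0 mulr0.
by rewrite ler_pdivrMr ?mul1r// lt0r ln.
Qed.

(** A current with coefficients in the wedges [phi t] is a finite combination of scalar integrals,
    each pairing one coefficient with one component of the test form. Convergence of currents thus
    reduces to convergence of correlations. *)
Lemma current_eigen (W : X -> cform R g (k + k)) (b : T -> X -> C) n
    (Th : X -> cform R g n) :
  (forall x v, W x v = \sum_t b t x * phi t v) ->
  (forall t, complex_bmeas (b t)) -> (forall v, complex_bmeas (fun x => Th x v)) ->
  current mu W Th = (covolume L)%:C%C *
    ((((k + k)`!)%:R * (n`!)%:R)^-1 * \sum_(s : 'S_((k + k) + n)) (-1) ^+ s *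
      \sum_t phi t (fun a => real_frame (s (lshift n a))) *
        CI (fun x => b t x * Th x (fun a => real_frame (s (rshift (k + k) a))))).
Proof.
move=> WE bb bTh; rewrite /current /integral_form; congr (_ * _).
rewrite /wedge.
have bs (s : 'S_((k + k) + n)) t : complex_bmeas (fun x =>
    b t x * Th x (fun a => real_frame (s (rshift (k + k) a)))) by exact: complex_bmeasM.
have -> : (fun x => ((k + k)`!%:R * n`!%:R)^-1 * \sum_(s : 'S_((k + k) + n)) (-1) ^+ s *
     (W x (fun a => real_frame (s (lshift n a))) *
      Th x (fun a => real_frame (s (rshift (k + k) a))))) =
   (fun x => ((k + k)`!%:R * n`!%:R)^-1 * \sum_(s : 'S_((k + k) + n)) (-1) ^+ s *
     \sum_t phi t (fun a => real_frame (s (lshift n a))) *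
      (b t x * Th x (fun a => real_frame (s (rshift (k + k) a))))).
  apply/funext => x; congr (_ * _); apply: eq_bigr => s _; congr (_ * _).
  rewrite WE mulr_suml; apply: eq_bigr => t _; ring.
rewrite complex_intZ; last first.
  apply: complex_bmeas_sum => s; apply: complex_bmeasZ; apply: complex_bmeas_sum => t.
  exact: complex_bmeasZ.
rewrite complex_int_sum; last first.
  move=> s; apply: complex_bmeasZ; apply: complex_bmeas_sum => t; exact: complex_bmeasZ.
congr (_ * _); apply: eq_bigr => s _; rewrite complex_intZ; last first.
  by apply: complex_bmeas_sum => t; exact: complex_bmeasZ.
congr (_ * _); rewrite complex_int_sum; last by move=> t; exact: complex_bmeasZ.
by apply: eq_bigr => t _; rewrite complex_intZ.
Qed.

(** In the coefficient of [phi t], the [j]-th term of the mean is [ratio t ^+ j] times the composite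
    of [c t] with [iter j f]. Its correlation with a test component tends, by mixing, to the product
    of the two means, and twisted averaging keeps only the indices of ratio 1. *)
Lemma cesaro_currents (Omega : X -> cform R g (k + k)) : smooth_form k k Omega ->
  exists2 w, dynamical_eigenspace f k w &
    cvg_currents mu k (cesaro_mean f k Omega) (fun=> w).
Proof.
move=> sO.
have [l [le lw]] := coefficients_from_values phi (index_enum_uniq T).
pose c t x := l t (Omega x).
have bc t : complex_bmeas (c t).
  apply: complex_bmeas_evaluation => // v; exact: smooth_form_bmeas sO.
have OE x v : Omega x v = \sum_t c t x * phi t v.
  have [b Ob] := pq_form_eigenP Uu (sO.1 x).
  exact: (lw b (Omega x) Ob).
pose cw t := if ratio t == 1 then CI (c t) else 0.
pose w : cform R g (k + k) := fun v => \sum_t cw t * phi t v.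
exists w.
  apply: eigenform_wedge => t; rewrite /cw.
  have [|_] := eqVneq (ratio t) 1; last by rewrite eqxx.
  (* A ratio equal to 1 excludes [lambda = 0], since a quotient by 0 is 0; the surviving weights are
     therefore equal to [lambda]. *)
  rewrite /ratio => h _; have [l0|l0] := eqVneq (real_complex R lambda) 0.
    by move: h; rewrite l0 invr0 mulr0 => /eqP; rewrite eq_sym oner_eq0.
  by rewrite -[LHS](divfK l0) h mul1r.
move=> Th sTh.
have bTh v : complex_bmeas (fun x => Th x v) by exact: smooth_form_bmeas sTh.
pose b M t x : C := M%:R^-1 * \sum_(1 <= j < M.+1) ratio t ^+ j * c t (iter j f x).
have biter t j : complex_bmeas (fun x => c t (iter j f x)).
  exact: complex_bmeas_comp (linear_lift_continuous (linear_lift_iter j fA)) (bc t).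
have bb M t : complex_bmeas (b M t).
  by apply: complex_bmeasZ; apply: complex_bmeas_sum => j; exact: complex_bmeasZ.
have meanE M x v : cesaro_mean f k Omega M x v = \sum_t b M t x * phi t v.
  rewrite /cesaro_mean.
  under [RHS]eq_bigr do rewrite /b -mulrA mulr_suml.
  rewrite -mulr_sumr exchange_big; congr (_ * _); apply: eq_bigr => j _.
  rewrite pullback_iter OE mulr_suml; apply: eq_bigr => t _.
  rewrite /phi (eigen_wedge_iter Uu UA) /ratio expr_div_n; ring.
rewrite (current_eigen (b := fun t _ => cw t) _ (fun t => complex_bmeas_cst _ (cw t)) bTh)//.
rewrite (_ : (fun M => _) = fun M => (covolume L)%:C%C *
    ((((k + k)`!)%:R * (((g - k) + (g - k))`!)%:R)^-1 *
     \sum_(s : 'S_((k + k) + ((g - k) + (g - k)))) (-1) ^+ s *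
      \sum_t phi t (fun a => real_frame (s (lshift _ a))) *
        CI (fun x => b M t x * Th x (fun a => real_frame (s (rshift (k + k) a)))))); last first.
  by apply/funext => M; exact: current_eigen.
apply: (@cvgMr C _ \oo); apply: (@cvgMr C _ \oo).
apply: (@cvg_sum _ \oo _ C C^o) => s; apply: (@cvgMr C _ \oo).
apply: (@cvg_sum _ \oo _ C C^o) => t.
set v := fun a => real_frame (s (lshift _ a)).
pose th (x : X) := Th x (fun a => real_frame (s (rshift (k + k) a))).
(* Either the term contributes nothing, or [phi t] is nonzero, which bounds its ratio by 1. *)
have [->|pv] := eqVneq (phi t v) 0.
  by rewrite mul0r; under eq_fun do rewrite mul0r; exact: cvg_cst.
apply: (@cvgMr C _ \oo).
have -> : CI (fun x => cw t * th x) = if ratio t == 1 then CI (c t) * CI th else 0.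
  rewrite complex_intZ; last exact: bTh.
  by rewrite /cw; case: ifP => _; rewrite ?mul0r.
rewrite (_ : (fun M => _) = fun M => M%:R^-1 * \sum_(1 <= j < M.+1)
    (ratio t ^+ j * CI (fun x => c t (iter j f x) * th x))); last first.
  apply/funext => M.
  have bj j : complex_bmeas (fun x => c t (iter j f x) * th x).
    by apply: complex_bmeasM; [exact: biter|exact: bTh].
  rewrite (_ : (fun x => _) = fun x => M%:R^-1 * \sum_(1 <= j < M.+1)
      (ratio t ^+ j * (c t (iter j f x) * th x))); last first.
    apply/funext => x; rewrite /b -mulrA; congr (_ * _).
    by rewrite mulr_suml; apply: eq_bigr => j _; rewrite mulrA.
  rewrite complex_intZ; last by apply: complex_bmeas_sum => j; exact: complex_bmeasZ.
  congr (_ * _); rewrite complex_int_sum; last by move=> j; exact: complex_bmeasZ.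
  by apply: eq_bigr => j _; rewrite complex_intZ.
apply: cvg_cesaro_twist; first exact: ratio_le1 pv.
by apply: (complex_mixing haar_mu fA PA orbit_inj (bc t)); exact: bTh.
Qed.

End EigenCurrents.

(** * The dichotomy *)

Section PeriodMatrix.
Context {R : realType} {g : nat} (L : lattice R g.+1).
Local Notation C := R[i].
Variables (f f' : torus L -> torus L) (A B : 'M[C]_g.+1) (N : 'M[int]_(g.+1 + g.+1)).
Hypotheses (fA : linear_lift f A) (fB : linear_lift f' B).
Hypotheses (AB : A *m B = 1%:M) (BA : B *m A = 1%:M).
Hypothesis PA : periods L *m A = map_mx intr N *m periods L.
Local Notation horner_period q := (@horner_mx int (g + g.+1) N q).

Lemma period_matrix_unit : N \in unitmx.
Proof.
have [N' PB] := linear_lift_int fB.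
have : N *m N' = 1%:M.
  apply: (@intmx_periods_inj _ _ L); rewrite map_mxM -mulmxA -PB mulmxA -PA.
  by rewrite -mulmxA AB mulmx1 map_mx1 mul1mx.
by case/mulmx1_unit.
Qed.

Lemma period_matrix_finite_order j :
  N ^+ j = 1%:M -> forall x, iter j f x = x.
Proof.
move=> Nj x; have [z ->] := torus_pi_surj x.
rewrite (linear_lift_iter j fA) (_ : A ^+ j = 1%:M) ?mulmx1//.
apply/subr0_eq; apply: (@periods_mul_eq0 _ _ L).
by rewrite mulmxBr mulmx1 (linear_lift_int_iter PA) Nj map_mx1 mul1mx subrr.
Qed.

Lemma semi_conjugate_of_polynomial (q : {poly int}) : abelian_variety L ->
  horner_period q != 0 -> \det (horner_period q) = 0 ->
  semi_conjugate_smaller f.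
Proof.
move=> avL q0 dq.
apply: (semi_conjugate_of_singular (T := horner_mx A (map_poly intr q))
  avL fA fB AB BA _ _ q0 dq).
  rewrite (@horner_mx_intertwine _ (g + g.+1) g _ _ (map_mx intr N))//.
  by rewrite -map_horner_mx.
exact: esym (horner_mx_intertwine _ erefl).
Qed.

Hypothesis irr : forall q : {poly int},
  horner_period q = 0 \/ \det (horner_period q) != 0.
Hypothesis aperiodic : forall j, (0 < j)%N -> N ^+ j != 1%:M.

(** As [N] is invertible, two equal terms of the orbit give a nonzero vector fixed by the transpose
    of [N^m] with [m = j - i > 0]. Then [X^m - 1] is singular at [N], hence zero there, against the
    absence of finite order. *)
Lemma period_orbit_inj (n : 'rV[int]_(g.+1 + g.+1)) : n != 0 ->
  injective (fun j => n *m (N ^+ j)^T).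
Proof.
move=> n0.
suff lt_absurd i j : (i < j)%N -> n *m (N ^+ i)^T <> n *m (N ^+ j)^T.
  move=> i j /= ij; apply/eqP; case: ltngtP => // h; exfalso.
    exact: lt_absurd h ij.
  exact: lt_absurd h (esym ij).
move=> ij; rewrite -(subnK (ltnW ij)); set m := (j - i)%N.
have m0 : (0 < m)%N by rewrite subn_gt0.
rewrite addnC exprD -mulmxE trmx_mul mulmxA => nij.
have Ni : (N ^+ i)^T \in unitmx.
  by rewrite unitmx_tr; apply: unitrX; exact: period_matrix_unit.
have nm : n *m (N ^+ m)^T = n by apply: (can_inj (mulmxK Ni)).
have hE : horner_period ('X^m - 1) = N ^+ m - 1%:M.
  by rewrite rmorphB rmorphXn /= horner_mx_X rmorph1.
have [|] := irr ('X^m - 1); rewrite hE.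
  by move/eqP; rewrite subr_eq0; apply/negP; exact: aperiodic.
apply/negP; rewrite negbK -(intr_eq0 rat) -det_map_mx -det_tr.
apply/det0P; exists (map_mx intr n).
  apply: contraNneq n0 => /rowP h; apply/eqP/rowP => l.
  by have /eqP := h l; rewrite !mxE intr_eq0 => /eqP.
rewrite map_trmx -map_mxM linearB /= trmx1 mulmxBr mulmx1 nm subrr.
exact: map_mx0.
Qed.

End PeriodMatrix.

Theorem theoremA (R : realType) (g : nat) (L : lattice R g)
    (f : torus L -> torus L) (mu : probability (borel (torus L)) R) :
  (g <= 4)%N ->
  abelian_variety L ->
  torus_automorphism f ->
  (0 < topological_entropy R f)%E ->
  haar mu ->
  semi_conjugate_smaller f \/
  (ergodic_measure mu f /\ invariant_measure mu f) /\
  (forall k : nat, (1 <= k <= g - 1)%N ->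
    forall Omega : torus L -> cform R g (k + k), smooth_form k k Omega ->
    exists2 w, dynamical_eigenspace f k w &
      cvg_currents mu k (cesaro_mean f k Omega) (fun=> w)).
Proof.
move=> _ avL faut ent haar_mu.
have not_periodic j : (0 < j)%N -> ~ forall x, iter j f x = x.
  move=> j0 fj; have := @topological_entropy_periodic R (torus L) f j j0 fj.
  by rewrite leNgt ent.
case: g L f mu avL faut ent haar_mu not_periodic =>
    [|g] L f mu avL faut ent haar_mu not_periodic.
  (* In dimension 0 the torus is a point, and its only map is the identity. *)
  exfalso; apply: (not_periodic 1) => // x.
  have [z ->] := torus_pi_surj x; have [w ->] := torus_pi_surj (iter 1 f (torus_pi L z)).
  by congr (torus_pi L _); apply/rowP; case.
have [f' [A [B [fA fB AB BA]]]] := torus_automorphism_lift faut.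
have [N PA] := linear_lift_int fA.
have [[q [q0 dq]]|noq] := pselect (exists q : {poly int},
    @horner_mx int (g + g.+1) N q != 0 /\ \det (@horner_mx int (g + g.+1) N q) = 0).
  by left; exact (semi_conjugate_of_polynomial fA fB AB BA PA avL q0 dq).
right.
have irr q : @horner_mx int (g + g.+1) N q = 0 \/
    \det (@horner_mx int (g + g.+1) N q) != 0.
  have [|q0] := eqVneq (@horner_mx int (g + g.+1) N q) 0; first by left.
  by right; apply/eqP => dq; apply: noq; exists q.
have aper j : (0 < j)%N -> N ^+ j != 1%:M.
  move=> j0; apply/eqP => Nj; apply: (not_periodic j j0).
  exact (period_matrix_finite_order fA PA Nj).
have orb := period_orbit_inj fB AB PA irr aper.
split.
  split; first exact (haar_ergodic haar_mu fA PA orb).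
  exact (haar_invariant haar_mu fA PA orb).
have [U [d [Uu UA]]] := diagonalizable_lift PA irr.
move=> k _ Omega sO; exact (cesaro_currents haar_mu fA PA orb Uu UA sO).
Qed.
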